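(* Let $0<\alpha<2$, $0<\gamma<1/\alpha$, and $b(n)=n^\gamma$. For each $n\ge2$ let $\{\xi_k(b(n))\}_{k\in\mathbb Z}$ be i.i.d. copies of the centered tapered Pareto random variable $\xi(\alpha,b(n))$ defined in the context, let $\bar X^{(n)}_k=\sum_{i=0}^{\infty}\tilde a_i^{(n)}\xi_{k-i}(b(n))$, $k\in\mathbb Z$, with $\tilde a_i^{(n)}=a_i\mathbf 1_{[0\le i\le\lambda(n)]}$, and let $\bar Z_n^{(j)}(t)=(\bar A_n^{(j)})^{-1}\sum_{k=1}^{[nt]}\bar X_k^{(n)}$, $t\ge0$, where $\bar A_n^{(j)}=A_n^{(j)}\big(E(\xi_1(b(n)))^2\big)^{1/2}$, the index $j\in\{1,\dots,9\}$ encodes the case (growth of $\lambda(n)$ and type of filter $\{a_i\}$), and $A_n^{(j)}>0$ is as specified in the context. Then for every $j=1,\dots,9$, in case $j$, the finite-dimensional distributions of $\{\bar Z_n^{(j)}(t)\}_{t\ge0}$ converge weakly, as $n\to\infty$, to those of $\{U^{(j)}(t)\}_{t\ge0}$, where $U^{(j)}$ is the mean-zero Gaussian process with $U^{(j)}(0)=0$ and covariance function, for $s,t>0$, $$E\,U^{(j)}(t)U^{(j)}(s)=\tfrac12\left(W^{(j)}(t)+W^{(j)}(s)-W^{(j)}(|t-s|)\right),$$ with $W^{(j)}$ as given in the context (so $U^{(j)}$ is standard Brownian motion for $j=1,2,3,5,8$ and standard fractional Brownian motion with Hurst parameter $3/2-\beta$ for $j=4,6$).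
   Context: Tapered Pareto innovations. For $\alpha>0$ let $\theta$ have the standard Pareto distribution with density $\alpha x^{-\alpha-1}$, $x\ge1$, and let $R$ be a standard exponential random variable independent of $\theta$. For $b>1$ put $\zeta(\alpha,b)=\theta\mathbf 1_{[\theta<b]}+(b+R)\mathbf 1_{[\theta\ge b]}$ and $\xi(\alpha,b)=\zeta(\alpha,b)-E\zeta(\alpha,b)$. (The condition $0<\gamma<1/\alpha$ with $b(n)=n^\gamma$ is called hard tapering.) Filter. $\{a_i\}_{i\ge0}$ is a real sequence with $a_n\sim n^{-\beta}$ as $n\to\infty$ (i.e. $a_n n^{\beta}\to1$). Three types are considered: (i) $1/2<\beta<1$; (ii) $\beta>1$ and $\sum_{i=0}^\infty a_i\neq0$ (the series converges absolutely); (iii) $1<\beta<3/2$ and $\sum_{i=0}^\infty a_i=0$. Filter taper. $\lambda(n)=n^{\gamma_1}$ with $0<\gamma_1<1$ (strong tapering), $\lambda(n)=n^{\gamma_1}$ with $\gamma_1>1$ (weak tapering), or $\lambda(n)=cn$ with $0<c<\infty$ (moderate tapering). Cases. $j=1,2,3$: strong tapering with filter type (i), (ii), (iii) respectively; $j=4,5,6$: weak tapering with type (i), (ii), (iii) respectively; $j=7,8,9$: moderate tapering with type (i), (ii), (iii) respectively. Constants. Put $z=c/t$ and $P(t,\beta,c)=\int_0^{z-1}\big(\int_0^1(x+y)^{-\beta}dx\big)^2dy+\int_{z-1}^{z}\big(\int_0^{z-y}(x+y)^{-\beta}dx\big)^2dy$ if $0<t\le c$, and $P(t,\beta,c)=\int_0^{z}\big(\int_0^{z-y}(x+y)^{-\beta}dx\big)^2dy$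 if $t>c$. For $1/2<\beta<1$: $K_7(t,\beta,c)=P(t,\beta,c)+\int_0^1\big(\int_0^{1-y}x^{-\beta}dx\big)^2dy$ if $0<t\le c$, and $K_7(t,\beta,c)=P(t,\beta,c)+\int_0^{1-z}\big(\int_0^{z}x^{-\beta}dx\big)^2dy+\int_{1-z}^1\big(\int_0^{1-y}x^{-\beta}dx\big)^2dy$ if $t>c$. For $1<\beta<3/2$: $K_9(t,\beta,c)=P(t,\beta,c)+\int_0^1\big(\int_{1-y}^\infty x^{-\beta}dx\big)^2dy$ if $0<t\le c$, and $K_9(t,\beta,c)=P(t,\beta,c)+\int_0^{1-z}\big(\int_{z}^\infty x^{-\beta}dx\big)^2dy+\int_{1-z}^1\big(\int_{1-y}^\infty x^{-\beta}dx\big)^2dy$ if $t>c$. Let $C_1(\beta)=\int_0^\infty\big(\int_0^1(x+y)^{-\beta}dx\big)^2dy$. Normalization. $(A_n^{(j)})^2=n\big(\sum_{i=0}^\infty a_i\big)^2$ for $j=2,5,8$; $(A_n^{(j)})^2=(1-\beta)^{-2}n^{1+2\gamma_1(1-\beta)}$ for $j=1,3$; $(A_n^{(4)})^2=\big(\tfrac{1}{(1-\beta)^2(3-2\beta)}+C_1(\beta)\big)n^{3-2\beta}$; $(A_n^{(6)})^2=\big(\int_0^1(\int_{1-v}^\infty u^{-\beta}du)^2dv+C_1(\beta)\big)n^{3-2\beta}$; $(A_n^{(7)})^2=K_7(1,\beta,c)n^{3-2\beta}$; $(A_n^{(9)})^2=K_9(1,\beta,c)n^{3-2\beta}$. Limit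 variances. $W^{(j)}(0)=0$ and, for $t>0$: $W^{(j)}(t)=t$ for $j=1,2,3,5,8$; $W^{(j)}(t)=t^{3-2\beta}$ for $j=4,6$; $W^{(7)}(t)=t^{3-2\beta}K_7(t,\beta,c)/K_7(1,\beta,c)$; $W^{(9)}(t)=t^{3-2\beta}K_9(t,\beta,c)/K_9(1,\beta,c)$. *)

(* Defs.v *)
From HB Require Import structures.
From mathcomp Require Import all_boot all_order all_algebra.
From mathcomp Require Import all_classical all_reals all_analysis.

Import Order.TTheory GRing.Theory Num.Theory.
Import numFieldNormedType.Exports.

Set Implicit Arguments.
Unset Strict Implicit.
Unset Printing Implicit Defensive.

Local Open Scope classical_set_scope.
Local Open Scope ring_scope.

Section TaperedPareto.
Context {R : realType}.

Definition pareto_pdf (alpha x : R) : R :=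
  if 1 <= x then alpha * x `^ (- alpha - 1) else 0.

Definition standard_pareto d (T : measurableType d) (P : probability T R)
    (alpha : R) (theta : {RV P >-> R}) : Prop :=
  forall A : set R, measurable A ->
    distribution P theta A
    = (\int[lebesgue_measure]_(x in A) (pareto_pdf alpha x)%:E)%E.

Definition standard_exponential d (T : measurableType d) (P : probability T R)
    (X : {RV P >-> R}) : Prop :=
  forall A : set R, measurable A ->
    distribution P X A = exponential_prob 1 A.

Definition independent2 d (T : measurableType d) (P : probability T R)
    (X Y : {RV P >-> R}) : Prop :=
  forall A B : set R, measurable A -> measurable B ->
    P (X @^-1` A `&` Y @^-1` B) = (P (X @^-1` A) * P (Y @^-1` B))%E.

Definition mutually_independent d (T : measurableType d) (P : probability T R)
    (I : choiceType) (X : I -> {RV P >-> R}) : Prop :=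
  forall (s : seq I) (A : I -> set R), uniq s ->
    (forall k, measurable (A k)) ->
    P (\bigcap_(k in [set` s]) X k @^-1` A k)
    = (\prod_(k <- s) P (X k @^-1` A k))%E.

Definition zeta T (theta E : T -> R) (b : R) : T -> R := fun w =>
  if theta w < b then theta w else b + E w.

Definition tapered_pareto d (T : measurableType d) (P : probability T R)
    (theta E : T -> R) (b : R) : T -> R := fun w =>
  zeta theta E b w - fine ('E_P[zeta theta E b])%E.

Definition iid_copies d (T : measurableType d) (P : probability T R)
    (I : choiceType) (X : I -> {RV P >-> R})
    d' (T' : measurableType d') (P' : probability T' R) (Y : T' -> R) : Prop :=
  mutually_independent X /\
  forall (k : I) (A : set R), measurable A ->
    distribution P (X k) A = P' (Y @^-1` A).

End TaperedPareto.

Section Cases.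
Context {R : realType}.
Implicit Types (j : nat) (a : nat -> R) (beta c t : R).

Local Notation mu := (@lebesgue_measure R).

Definition filter_sum a : R := limn (series a).

(* The index [j], meant to range over 1..9, encodes the growth of the filter
   taper (1-3 strong, 4-6 weak, 7-9 moderate) and the filter type
   ((i), (ii), (iii) according to [j] mod 3); values outside 1..9 are junk. *)
Definition filter_case j a beta : Prop :=
  match j with
  | 1%N | 4%N | 7%N => 1 / 2 < beta < 1
  | 2%N | 5%N | 8%N => 1 < beta /\ filter_sum a != 0
  | _ => 1 < beta < 3 / 2 /\ filter_sum a = 0
  end.

Definition taper_case j (gamma1 : R) c : Prop :=
  match j with
  | 1%N | 2%N | 3%N => 0 < gamma1 < 1
  | 4%N | 5%N | 6%N => 1 < gamma1
  | _ => 0 < c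
  end.

Definition lambda j (gamma1 : R) c (n : nat) : R :=
  if (j <= 6)%N then n%:R `^ gamma1 else c * n%:R.

(* The integrals below are finite; an inner integral that diverges at an end
   point of the outer range, where [Rintegral] is 0, does so on a null set. *)
Definition Pint t beta c : R :=
  let z := c / t in
  if t <= c then
    \int[mu]_(y in `[0, z - 1]) (\int[mu]_(x in `[0, 1]) (x + y) `^ (- beta)) ^+ 2
    + \int[mu]_(y in `[z - 1, z])
        (\int[mu]_(x in `[0, z - y]) (x + y) `^ (- beta)) ^+ 2
  else
    \int[mu]_(y in `[0, z])
      (\int[mu]_(x in `[0, z - y]) (x + y) `^ (- beta)) ^+ 2.

Definition K7 t beta c : R :=
  let z := c / t in
  Pint t beta c +
  if t <= c then
    \int[mu]_(y in `[0, 1]) (\int[mu]_(x in `[0, 1 - y]) x `^ (- beta)) ^+ 2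
  else
    \int[mu]_(y in `[0, 1 - z]) (\int[mu]_(x in `[0, z]) x `^ (- beta)) ^+ 2
    + \int[mu]_(y in `[1 - z, 1])
        (\int[mu]_(x in `[0, 1 - y]) x `^ (- beta)) ^+ 2.

Definition K9 t beta c : R :=
  let z := c / t in
  Pint t beta c +
  if t <= c then
    \int[mu]_(y in `[0, 1]) (\int[mu]_(x in `[1 - y, +oo[) x `^ (- beta)) ^+ 2
  else
    \int[mu]_(y in `[0, 1 - z]) (\int[mu]_(x in `[z, +oo[) x `^ (- beta)) ^+ 2
    + \int[mu]_(y in `[1 - z, 1])
        (\int[mu]_(x in `[1 - y, +oo[) x `^ (- beta)) ^+ 2.

Definition C1 beta : R :=
  \int[mu]_(y in `[0, +oo[) (\int[mu]_(x in `[0, 1]) (x + y) `^ (- beta)) ^+ 2.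

Definition Asq j a beta (gamma1 : R) c (n : nat) : R :=
  match j with
  | 1%N | 3%N => (1 - beta) ^- 2 * n%:R `^ (1 + 2 * gamma1 * (1 - beta))
  | 2%N | 5%N | 8%N => n%:R * (filter_sum a) ^+ 2
  | 4%N => (((1 - beta) ^+ 2 * (3 - 2 * beta))^-1 + C1 beta)
         * n%:R `^ (3 - 2 * beta)
  | 6%N => (\int[mu]_(v in `[0, 1])
            (\int[mu]_(u in `[1 - v, +oo[) u `^ (- beta)) ^+ 2 + C1 beta)
         * n%:R `^ (3 - 2 * beta)
  | 7%N => K7 1 beta c * n%:R `^ (3 - 2 * beta)
  | _ => K9 1 beta c * n%:R `^ (3 - 2 * beta)
  end.

Definition W j beta c t : R :=
  if t == 0 then 0 else
  match j with
  | 1%N | 2%N | 3%N | 5%N | 8%N => t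
  | 4%N | 6%N => t `^ (3 - 2 * beta)
  | 7%N => t `^ (3 - 2 * beta) * K7 t beta c / K7 1 beta c
  | _ => t `^ (3 - 2 * beta) * K9 t beta c / K9 1 beta c
  end.

Definition limit_cov j beta c (s t : R) : R :=
  2^-1 * (W j beta c t + W j beta c s - W j beta c `|t - s|).

End Cases.

Section PartialSumProcess.
Context {R : realType} d (T : measurableType d).

(* [a i] is killed beyond [l], so the series has finitely many nonzero terms. *)
Definition linear_process (a : nat -> R) (l : R) (X : int -> T -> R)
    (k : int) : T -> R := fun w =>
  limn (series (fun i : nat => (if i%:R <= l then a i else 0) * X (k - i%:Z) w)).

(* For [t >= 0], [Num.truncn (n%:R * t)] is the integer part of [n t]. *)
Definition Z (P : probability T R) (a : nat -> R) (l A : R)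
    (X : int -> T -> R) (n : nat) (t : R) : T -> R := fun w =>
  (A * Num.sqrt (fine 'E_P[fun v => (X 1 v ^+ 2)%R]%E))^-1
  * \sum_(1 <= k < (Num.truncn (n%:R * t)).+1) linear_process a l X k%:Z w.

End PartialSumProcess.

Section GaussianLimit.
Context {R : realType}.

(* [normal_prob m s] is not degenerate at [s = 0]: constants need the Dirac
   measure. *)
Definition gaussian d (T : measurableType d) (Q : probability T R)
    (X : T -> R) : Prop :=
  exists m s : R, forall A : set R, measurable A ->
    Q (X @^-1` A) = if s == 0 then \d_m A else normal_prob m s A.

(* Processes are indexed by [R]; only their values at times [t >= 0] matter. *)
Definition gaussian_process d (T : measurableType d) (Q : probability T R)
    (U : R -> {RV Q >-> R}) : Prop :=
  forall (m : nat) (t c : 'I_m -> R), (forall i, 0 <= t i) ->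
    gaussian Q (fun w => \sum_(i < m) c i * U (t i) w).

Definition centered_gaussian_process d (T : measurableType d)
    (Q : probability T R) (G : R -> R -> R) (U : R -> {RV Q >-> R}) : Prop :=
  [/\ gaussian_process U,
      forall t : R, 0 <= t -> 'E_Q[U t]%E = 0%E,
      {ae Q, forall w, U 0 w = 0}
    & forall s t : R, 0 < s -> 0 < t ->
        'E_Q[fun w => (U t w * U s w)%R]%E = (G s t)%:E].

Definition positive_semidefinite (G : R -> R -> R) : Prop :=
  forall (m : nat) (t c : 'I_m -> R), (forall i, 0 < t i) ->
    0 <= \sum_(i < m) \sum_(k < m) c i * c k * G (t i) (t k).

(* The vectors being compared may live on a different space for each [n]. *)
Definition fdd_cvg (d : nat -> measure_display)
    (T : forall n, measurableType (d n)) (P : forall n, probability (T n) R)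
    (Y : forall n, R -> T n -> R)
    d' (T' : measurableType d') (Q : probability T' R) (U : R -> T' -> R)
    : Prop :=
  forall (m : nat) (t : 'I_m -> R), (forall i, 0 <= t i) ->
  forall f : 'rV[R]_m -> R, continuous f -> (exists M : R, forall x, `|f x| <= M) ->
    ('E_(P n)[fun w => f (\row_i Y n (t i) w)])%E @[n --> \oo]
    --> ('E_Q[fun w => f (\row_i U (t i) w)])%E.

End GaussianLimit.

(* Main.v *)
(**
Up to the normalization, a linear combination of the values of the process is a sum
[sum_k w_(n,k) xi_k / sigma_n] over independent centered innovations, with [sigma_n] their
standard deviation and deterministic weights [w_(n,k)].  Each weight is a difference of two
tapered partial sums of the filter.  Setting [k = ceil (n y)] turns the weights, rescaled by
[sqrt n], into step functions of [y] which converge to combinations of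
[Phi (t - y) - Phi (- y)], where [Phi x] is [0] for [x <= 0] and otherwise a multiple of
[1], [x^(1 - beta)] or [(min x c)^(1 - beta)] according to the taper, and which are dominated
by a square integrable function.  Hence [sum_k w_(n,k)^2] converges and the squares of the
rescaled weights are uniformly integrable.

Tapering at [b = n^gamma] gives [E |xi|^3 <= C b^(alpha / 2) sigma^3], and
[gamma alpha / 2 < 1 / 2], so Taylor expansion of the characteristic functions (to the second
order for the few large weights, to the third for the others) proves the central limit theorem
for the expectations of [cos (Z + phi)].  Continuous bounded functions are approximated by
trigonometric polynomials on cubes, which replaces Levy's continuity theorem.

The limit covariance is the Gram matrix of the kernels [Phi (t - y) - Phi (- y)].  By translation
invariance and polarization it is determined by their squared norms, which scaling
reduces to the constants of the statement.
*)
Require Import Defs.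
From HB Require Import structures.
From mathcomp Require Import all_boot all_order all_algebra.
From mathcomp Require Import all_classical all_reals all_analysis.
From mathcomp Require Import measurable_realfun zify ring lra.
Import Order.TTheory GRing.Theory Num.Theory.
Import numFieldNormedType.Exports.

Set Implicit Arguments.
Unset Strict Implicit.
Unset Printing Implicit Defensive.

Local Open Scope classical_set_scope.
Local Open Scope ring_scope.

(** * Characteristic functions of sums of independent variables *)

(** The obstacle is that the weights are not uniformly small. For filters of type (iii) under a weak
    or moderate taper the limit kernel is unbounded near 0 and near [t], so innovations close to the
    two ends of the summation may carry weights far above the typical order [n^(-1/2)]. A third
    order expansion has relative error of the size of the weight times [n^(gamma alpha / 2)] and is
    of no use for them. Uniform integrability makes their total square negligible, and then the
    crude second order bound suffices; for the other weights the error is of order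
    [n^(gamma alpha / 2 - 1 / 2)], which is where hard tapering enters.

    The nine cases stay together until the constants are computed. Tapering freezes the partial sums
    of the filter at the index [L], so a case is a pair of data: the growth of the partial sums, and
    the size of [min m L] compared with [n]. Domination has two ranges: near the ends the two
    partial sums are bounded separately, by powers above -1/2; far in the past only their difference
    is small, of order [y^(- beta)] with [beta > 1 / 2]. *)

Section density.
Context {R : realType} d (T : measurableType d) (mu : {measure set T -> \bar R}).
Import HBNNSimple.
Lemma integral_density_nnsfun (X H : T -> R) (g : {nnsfun R >-> R}) :
  measurable_fun setT X -> measurable_fun setT H -> (forall x, 0 <= H x) ->
  (\int[mu]_x (H x * g (X x))%:E =
   \sum_(r \in range g) r%:E * \int[mu]_(x in X @^-1` (g @^-1` [set r])) (H x)%:E)%E.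
Proof.
move=> mX mH H0.
have mg r : measurable (X @^-1` (g @^-1` [set r])).
  by rewrite -[X in measurable X]setTI; exact: mX.
transitivity (\int[mu]_x (\sum_(r \in range g)
    (r * (H x * \1_(X @^-1` (g @^-1` [set r])) x))%:E))%E.
  apply: eq_integral => x _; rewrite fimfunE fsumEFin//; congr EFin.
  rewrite !fsbig_finite//= big_distrr/=; apply: eq_bigr => r _.
  by rewrite mulrCA.
rewrite ge0_integral_fsum//=; last 2 first.
- move=> r; apply/measurable_EFinP/measurable_funM => //.
  by apply: measurable_funM => //; exact: measurable_indic.
- move=> r x _; rewrite lee_fin.
  have [xr|xr] := pselect ((X @^-1` (g @^-1` [set r])) x).
    by move: (xr) => /= <-; rewrite !mulr_ge0.
  by rewrite indicE memNset// !mulr0.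
apply: eq_fsbigr => r /[!inE] -[y _ <-].
under eq_integral do rewrite EFinM.
rewrite ge0_integralZl//=; last 3 first.
- by apply/measurable_EFinP/measurable_funM => //; exact: measurable_indic.
- by move=> x _; rewrite lee_fin mulr_ge0.
- by rewrite lee_fin.
congr (_ * _)%E; rewrite [RHS]integral_mkcond/=; apply: eq_integral => x _.
by rewrite patchE indicE; case: ifPn; rewrite ?mulr1 ?mulr0.
Qed.

End density.

Import HBNNSimple.
(** The transfer principle behind all computations with laws: simple functions and monotone
    convergence lead from sets to functions. With [H] equal to 1 it compares laws, with an indicator
    or a product as [H] it expresses independence, and with a probability density it turns an
    expectation into a Lebesgue integral. *)
Lemma eq_integral_density {R : realType} d1 d2 (T1 : measurableType d1)
    (T2 : measurableType d2) (m1 : {measure set T1 -> \bar R})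
    (m2 : {measure set T2 -> \bar R}) (X1 H1 : T1 -> R) (X2 H2 : T2 -> R) :
  measurable_fun setT X1 -> measurable_fun setT H1 -> (forall x, 0 <= H1 x) ->
  measurable_fun setT X2 -> measurable_fun setT H2 -> (forall x, 0 <= H2 x) ->
  (forall A, measurable A -> \int[m1]_(x in X1 @^-1` A) (H1 x)%:E =
     \int[m2]_(x in X2 @^-1` A) (H2 x)%:E)%E ->
  forall f : R -> R, measurable_fun setT f -> (forall x, 0 <= f x) ->
  (\int[m1]_x (H1 x * f (X1 x))%:E = \int[m2]_x (H2 x * f (X2 x))%:E)%E.
Proof.
move=> mX1 mH1 H10 mX2 mH2 H20 E f mf f0.
have mEf : measurable_fun [set: R] (EFin \o f) by exact/measurable_EFinP.
pose g n := nnsfun_approx measurableT mEf n.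
suff L d (T : measurableType d) (m : {measure set T -> \bar R}) (X H : T -> R) :
  measurable_fun setT X -> measurable_fun setT H -> (forall x, 0 <= H x) ->
  (\sum_(r \in range (g n)) r%:E *
    \int[m]_(x in X @^-1` (g n @^-1` [set r])) (H x)%:E)%E @[n --> \oo] -->
  (\int[m]_x (H x * f (X x))%:E)%E.
  apply: (@cvg_unique _ _ (\sum_(r \in range (g n)) r%:E *
    \int[m1]_(x in X1 @^-1` (g n @^-1` [set r])) (H1 x)%:E @[n --> \oo])%E) => //.
    exact: L.
  rewrite (_ : (fun n => _) = (fun n => (\sum_(r \in range (g n)) r%:E *
    \int[m2]_(x in X2 @^-1` (g n @^-1` [set r])) (H2 x)%:E)%E)); first exact: L.
  by apply/funext => n; apply: eq_fsbigr => r _; rewrite E.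
move=> mX mH H0.
under eq_fun do rewrite -integral_density_nnsfun//.
rewrite (_ : (\int[m]_x (H x * f (X x))%:E)%E =
  (\int[m]_x (limn (fun n => (H x * g n (X x))%:E)))%E); last first.
  apply: eq_integral => x _; apply/esym/cvg_lim => //.
  under eq_fun do rewrite EFinM.
  rewrite EFinM; apply: cvgeZl => //.
  exact: (cvg_nnsfun_approx measurableT mEf (fun x _ => f0 x) I).
apply: cvg_monotone_convergence => //.
- move=> n; apply/measurable_EFinP/measurable_funM => //.
  exact: measurableT_comp.
- by move=> n x _; rewrite lee_fin mulr_ge0.
- move=> x _ a b ab; rewrite lee_fin ler_wpM2l//.
  exact/lefP/nd_nnsfun_approx.
Qed.

Section bounded_measurable.
Context {R : realType}.

(** This class is stable under sums, products and composition and consists of functions integrable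
    for every probability, so integrability becomes a closure argument. *)
Definition bmeas d (T : measurableType d) (f : T -> R) :=
  measurable_fun setT f /\ exists M : R, forall x, `|f x| <= M.

Lemma bmeas_cst d (T : measurableType d) (r : R) : bmeas (cst r : T -> R).
Proof. by split; [exact: measurable_cst|exists `|r|]. Qed.

Lemma bmeasD d (T : measurableType d) (f g : T -> R) :
  bmeas f -> bmeas g -> bmeas (fun x => f x + g x).
Proof.
move=> [mf [M fM]] [mg [N gN]]; split; first exact: measurable_funD.
by exists (M + N) => x; rewrite (le_trans (ler_normD _ _))// lerD.
Qed.

Lemma bmeasM d (T : measurableType d) (f g : T -> R) :
  bmeas f -> bmeas g -> bmeas (fun x => f x * g x).
Proof.
move=> [mf [M fM]] [mg [N gN]]; split; first exact: measurable_funM.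
by exists (M * N) => x; rewrite normrM ler_pM.
Qed.

Lemma bmeas_prod d (T : measurableType d) (I : Type) (s : seq I) (f : I -> T -> R) :
  (forall i, bmeas (f i)) -> bmeas (fun x => \prod_(i <- s) f i x).
Proof.
move=> bf; elim: s => [|i s IH].
  by under eq_fun do rewrite big_nil; exact: bmeas_cst.
by under eq_fun do rewrite big_cons; exact: bmeasM.
Qed.

Lemma bmeas_indic d (T : measurableType d) (A : set T) : measurable A ->
  bmeas (\1_A : T -> R).
Proof.
move=> mA; split; first exact: measurable_indic.
by exists 1 => x; rewrite indicE; case: (_ \in _); rewrite ?normr1 ?normr0.
Qed.

Lemma bmeas_comp d (T : measurableType d) (f : R -> R) (X : T -> R) :
  bmeas f -> measurable_fun setT X -> bmeas (fun x => f (X x)).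
Proof.
move=> [mf [M fM]] mX; split; first exact: measurableT_comp.
by exists M => x; exact: fM.
Qed.

Lemma bmeas_integrable d (T : measurableType d) (P : probability T R) f :
  bmeas f -> P.-integrable setT (EFin \o f).
Proof.
move=> [mf [M fM]]; apply: measurable_bounded_integrable => //.
  by rewrite (le_lt_trans (probability_le1 P _))// ltry.
exists M; split; first exact: num_real.
by move=> x Mx y _; exact: le_trans (fM y) (ltW Mx).
Qed.

Lemma Rintegral_prob_cst d (T : measurableType d) (P : probability T R) (r : R) :
  \int[P]_x (cst r x) = r.
Proof. rewrite /= (@Rintegral_cst _ T R P)// [X in fine X](_ : _ = 1%E) ?mulr1//.
exact: probability_setT. Qed.

(** An instance of [eq_integral_density] with density [H] on one side and the constant expectation
    of [H] on the other: the hypothesis is exactly that the two agree on the events of [X]. *)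
Lemma Rintegral_factor_ge0 d (T : measurableType d) (P : probability T R)
    (X H : T -> R) (f : R -> R) : measurable_fun setT X -> bmeas H -> bmeas f ->
  (forall x, 0 <= H x) -> (forall x, 0 <= f x) ->
  (forall A, measurable A ->
    \int[P]_(x in X @^-1` A) H x = fine (P (X @^-1` A)) * \int[P]_x H x) ->
  \int[P]_x (H x * f (X x)) = \int[P]_x H x * \int[P]_x f (X x).
Proof.
move=> mX bH bf H0 f0 E.
have [mH _] := bH; have [mf _] := bf.
have iH := bmeas_integrable P bH.
have c0 : 0 <= \int[P]_x H x by exact: Rintegral_ge0.
rewrite -RintegralZl//; last exact/bmeas_integrable/bmeas_comp.
rewrite /Rintegral.
rewrite (@eq_integral_density _ _ _ T T P P X H X (cst (\int[P]_x H x)))//=.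
move=> A mA.
have mXA : measurable (X @^-1` A) by rewrite -[X in measurable X]setTI; exact: mX.
have iHA : P.-integrable (X @^-1` A) (EFin \o H) by exact: integrableS iH.
rewrite -[LHS](@fineK); last exact: integrable_fin_num.
rewrite [X in X%:E](E _ mA) integral_cst//= EFinM fineK; last exact: fin_num_measure.
by rewrite muleC.
Qed.

(** Adding the bounds [M] and [N] to [H] and [f] makes both nonnegative; the product formula is
    bilinear, so the extra terms cancel. *)
Lemma Rintegral_factor d (T : measurableType d) (P : probability T R)
    (X H : T -> R) (f : R -> R) : measurable_fun setT X -> bmeas H -> bmeas f ->
  (forall A, measurable A ->
    \int[P]_(x in X @^-1` A) H x = fine (P (X @^-1` A)) * \int[P]_x H x) ->
  \int[P]_x (H x * f (X x)) = \int[P]_x H x * \int[P]_x f (X x).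
Proof.
move=> mX bH bf E.
have [mH [M HM]] := bH; have [mf [N fN]] := bf.
have iH := bmeas_integrable P bH.
have bfX := bmeas_comp bf mX.
have bHf := bmeasM bH bfX.
have HE A : measurable A -> \int[P]_(x in X @^-1` A) (H x + M) =
    fine (P (X @^-1` A)) * \int[P]_x (H x + M).
  move=> mA.
  have mXA : measurable (X @^-1` A) by rewrite -[X in measurable X]setTI; exact: mX.
  rewrite !RintegralD//.
  - by rewrite E// Rintegral_cst// Rintegral_prob_cst; ring.
  - exact/bmeas_integrable/(bmeas_cst _ M).
  - exact: integrableS iH.
  - by apply: integrableS (bmeas_integrable P (bmeas_cst T M)).
have H0 x : 0 <= H x + M by have := HM x; rewrite ler_norml => /andP[]; lra.
have f0 x : 0 <= f x + N by have := fN x; rewrite ler_norml => /andP[]; lra.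
have := Rintegral_factor_ge0 mX (bmeasD bH (bmeas_cst _ M))
  (bmeasD bf (bmeas_cst _ N)) H0 f0 HE.
have -> : (fun x => (H x + cst M x) * (f (X x) + cst N (X x))) =
  (fun x => (H x * f (X x) + N * H x) + (M * f (X x) + cst (M * N) x)).
  by apply/funext => x /=; ring.
rewrite !RintegralD//=; do ?[exact: bmeas_integrable bfX|
  exact: bmeas_integrable (bmeas_cst _ _)|exact: bmeas_integrable bHf|
  exact: bmeas_integrable (bmeasM (bmeas_cst _ _) _)|
  exact: bmeas_integrable (bmeasD bHf (bmeasM (bmeas_cst _ _) _))|
  exact: bmeas_integrable (bmeasD (bmeasM (bmeas_cst _ _) _) (bmeas_cst _ _))].
rewrite ?RintegralZl//; do ?[exact: bmeas_integrable|exact: (bmeas_integrable P (bmeas_cst T N))].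
rewrite !Rintegral_prob_cst.
by move=> e; apply: (addIr (N * \int[P]_x H x + (M * \int[P]_x f (X x) + M * N)));
  rewrite addrA e; ring.
Qed.

End bounded_measurable.

Section independent_product.
Context {R : realType} d (T : measurableType d) (P : probability T R)
  (I : choiceType) (X : I -> {RV P >-> R}).

(** The list [s2] of events makes the induction on [s1] possible: to split off the factor of [X k],
    the other factors must be integrated over an event of [X k], and this is the induction
    hypothesis with [k] moved to [s2]. *)
Lemma mutually_independent_Rintegral_in : mutually_independent X ->
  forall (s1 s2 : seq I) (f : I -> R -> R) (A : I -> set R), uniq (s1 ++ s2) ->
  (forall k, bmeas (f k)) -> (forall k, measurable (A k)) ->
  \int[P]_(w in \bigcap_(k in [set` s2]) X k @^-1` A k)
     (\prod_(k <- s1) f k (X k w)) =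
  (\prod_(k <- s1) \int[P]_w f k (X k w)) *
  \prod_(k <- s2) fine (P (X k @^-1` A k)).
Proof.
move=> indX; elim=> [|k s1 IH] s2 f A us bf mA.
  rewrite big_nil mul1r; under eq_Rintegral do rewrite big_nil.
  have mC : measurable (\bigcap_(k in [set` s2]) X k @^-1` A k).
    by apply: fin_bigcap_measurable => // k _; exact: measurable_funPTI.
  rewrite (@Rintegral_cst _ T R P)// mul1r.
  rewrite [X in fine X](_ : _ = \prod_(k <- s2) P (X k @^-1` A k))%E; last first.
    exact: (indX s2 A us mA).
  elim: s2 {us mC} => [|k s2 IH]; first by rewrite !big_nil.
  have fP i : P (X i @^-1` A i) \is a fin_num.
    by apply: fin_num_measure; exact: measurable_funPTI.
  rewrite !big_cons fineM ?IH//.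
  by elim/big_ind : _ => // x y; exact: fin_numM.
have bfX j : bmeas (fun w => f j (X j w)) by exact: bmeas_comp (bf j) _.
pose B := \bigcap_(k in [set` s2]) X k @^-1` A k.
have mB : measurable B.
  by apply: fin_bigcap_measurable => // j _; exact: measurable_funPTI.
pose H w := (\prod_(j <- s1) f j (X j w)) * \1_B w.
have bH : bmeas H by apply: bmeasM; [exact: bmeas_prod|exact: bmeas_indic].
have E D (g : T -> R) : measurable D ->
    \int[P]_(w in D) (g w * \1_B w) = \int[P]_(w in D `&` B) g w.
  move=> mD; rewrite Rintegral_mkcondr; apply: eq_Rintegral => w _.
  by rewrite patchE indicE; case: ifP; rewrite ?mulr1 ?mulr0.
have us' : uniq (s1 ++ s2) by move: us => /= /andP[].
have HE D : measurable D -> \int[P]_(w in X k @^-1` D) H w =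
    fine (P (X k @^-1` D)) * \int[P]_w H w.
  move=> mD; rewrite E; last exact: measurable_funPTI.
  rewrite E// setTI IH//.
  (* The family of events of the induction hypothesis, with the event [D] put at the index [k]. *)
  pose A' i := if i == k then D else A i.
  have kn : k \notin s2 by move: us => /=; rewrite mem_cat negb_or => /andP[/andP[]].
  have uks : uniq (s1 ++ [:: k] ++ s2) by rewrite uniq_catCA.
  have e2 i : i \in s2 -> A' i = A i.
    by move=> si; rewrite /A' ifN//; apply: contraNN kn => /eqP <-.
  have -> : X k @^-1` D `&` B = \bigcap_(j in [set` k :: s2]) X j @^-1` A' j.
    apply/seteqP; split => [w [Dw Bw] j /=|w Cw].
      rewrite inE => /predU1P[->|js]; first by rewrite /A' eqxx.
      by rewrite e2//; exact: Bw.
    split; first by have := Cw k (mem_head _ _); rewrite /A' eqxx.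
    by move=> j js; rewrite -(e2 j js); apply: Cw; rewrite /= inE js orbT.
  rewrite (IH (k :: s2) f A' uks bf); last by move=> i; rewrite /A'; case: ifP.
  rewrite big_cons {1}/A' eqxx mulrCA; congr (_ * (_ * _)).
  by apply: eq_big_seq => i /e2 ->.
rewrite big_cons -mulrA -(IH s2 f A us' bf mA).
transitivity (\int[P]_w (H w * f k (X k w))).
  rewrite -[in LHS](setTI (\bigcap_(j in _) _)) -/B -E//.
  by apply: eq_Rintegral => w _; rewrite big_cons /H; ring.
by rewrite (Rintegral_factor _ bH (bf k) HE)// mulrC /H E// setTI.
Qed.

Lemma mutually_independent_Rintegral : mutually_independent X ->
  forall (s : seq I) (f : I -> R -> R), uniq s -> (forall k, bmeas (f k)) ->
  \int[P]_w (\prod_(k <- s) f k (X k w)) = \prod_(k <- s) \int[P]_w f k (X k w).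
Proof.
move=> indX s f us bf.
have := mutually_independent_Rintegral_in indX (s2 := [::]) (A := fun=> setT) _ bf.
move=> /(_ s); rewrite cats0 => /(_ us (fun=> measurableT)).
by rewrite big_nil mulr1 set_nil bigcap_set0.
Qed.

Lemma bmeas_cosD (u phi : R) : bmeas (fun x : R => cos (u * x + phi)).
Proof.
split; last by exists 1 => x; exact: cos_max.
by apply: continuous_measurable_fun => x; apply: continuous_comp;
  [apply: cvgD; [apply: cvgMr; exact: cvg_id|exact: cvg_cst]|exact: continuous_cos].
Qed.

Lemma measurable_lin (s : seq I) (u : I -> R) :
  measurable_fun setT (fun w => \sum_(k <- s) u k * X k w).
Proof. by apply: measurable_sum => k; exact: measurable_funM. Qed.

(** Writing sines as shifted cosines keeps a single family of functions, the cosines with a phase,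
    in the inductions below. *)
Lemma cosDBhalf (a b : R) : cos (a + b) = cos a * cos b - cos (a - pi / 2) * cos (b - pi / 2).
Proof.
have s x : cos (x - pi / 2) = sin x :> R.
  by rewrite cosB cos_pihalf sin_pihalf mulr0 add0r mulr1.
by rewrite cosD !s.
Qed.

(** The list [s'] is an accumulator. The addition formula splits the head of [s] off as a bounded
    factor, and the induction hypothesis at [j :: s'] separates it. *)
Lemma independent_cos_factor : mutually_independent X ->
  forall (s s' : seq I) (f : I -> R -> R) (u : I -> R) (phi : R),
  uniq (s' ++ s) -> (forall k, bmeas (f k)) ->
  \int[P]_w ((\prod_(k <- s') f k (X k w)) * cos (\sum_(k <- s) u k * X k w + phi)) =
  (\prod_(k <- s') \int[P]_w f k (X k w)) *
  \int[P]_w cos (\sum_(k <- s) u k * X k w + phi).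
Proof.
move=> indX.
have bf0 (f : I -> R -> R) k : bmeas (f k) -> bmeas (fun w => f k (X k w)).
  by move=> bfk; exact: bmeas_comp bfk _.
have bS s u phi : bmeas (fun w => cos (\sum_(k <- s) u k * X k w + phi)).
  have := bmeas_comp (bmeas_cosD 1 phi) (measurable_lin s u).
  by under eq_fun do rewrite mul1r.
elim=> [|j s IH] s' f u phi us bf.
  under eq_Rintegral do rewrite big_nil add0r.
  under [X in _ * X]eq_Rintegral do rewrite big_nil add0r.
  rewrite RintegralZr//; last by apply/bmeas_integrable/bmeas_prod => k; exact: bf0.
  rewrite mutually_independent_Rintegral//; last by rewrite cats0 in us.
  by rewrite (Rintegral_prob_cst P).
pose g (psi : R) k := if k == j then (fun x : R => cos (u j * x + psi)) else f k.
have bg psi k : bmeas (g psi k) by rewrite /g; case: eqP => // _; exact: bmeas_cosD.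
have E (H : T -> R) : bmeas H -> \int[P]_w (H w * cos (\sum_(k <- j :: s) u k * X k w + phi)) =
   \int[P]_w (H w * cos (u j * X j w + 0) * cos (\sum_(k <- s) u k * X k w + phi)) -
   \int[P]_w (H w * cos (u j * X j w - pi / 2) * cos (\sum_(k <- s) u k * X k w + (phi - pi / 2))).
  move=> bH; rewrite -RintegralB//.
  - by apply: eq_Rintegral => w _; rewrite big_cons -addrA cosDBhalf addr0 addrA; ring.
  - by apply/bmeas_integrable/bmeasM => //; apply: bmeasM => //; apply: (bmeas_comp (bmeas_cosD _ _)).
  - by apply/bmeas_integrable/bmeasM => //; apply: bmeasM => //; apply: (bmeas_comp (bmeas_cosD _ _)).
have js' : j \notin s'.
  by move: us; rewrite cat_uniq /= => /and3P[_ /norP[]].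
have us2 : uniq ((j :: s') ++ s).
  by have := us; rewrite -cat1s uniq_catCA.
have us1 : uniq ([:: j] ++ s) by move: us2; rewrite /= mem_cat negb_or cat_uniq => /andP[/andP[_ ->] /and3P[]].
have gs' psi k : k \in s' -> g psi k = f k.
  by move=> ks; rewrite /g ifN//; apply: contraNN js' => /eqP <-.
have gj psi : g psi j = (fun x : R => cos (u j * x + psi)) by rewrite /g eqxx.
have bP : bmeas (fun w => \prod_(k <- s') f k (X k w)) by apply: bmeas_prod => k; exact: bf0.
have IHg psi phi' : \int[P]_w ((\prod_(k <- s') f k (X k w)) * cos (u j * X j w + psi) *
      cos (\sum_(k <- s) u k * X k w + phi')) =
    (\prod_(k <- s') \int[P]_w f k (X k w)) * \int[P]_w cos (u j * X j w + psi) *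
    \int[P]_w cos (\sum_(k <- s) u k * X k w + phi').
  have := IH (j :: s') (g psi) u phi' us2 (bg psi).
  rewrite big_cons gj [_ * \prod_(_ <- _) _]mulrC.
  have -> : \prod_(k <- s') \int[P]_w g psi k (X k w) = \prod_(k <- s') \int[P]_w f k (X k w).
    by apply: eq_big_seq => k ks; rewrite gs'.
  move=> <-; apply: eq_Rintegral => w _; rewrite big_cons gj.
  have -> : \prod_(k <- s') g psi k (X k w) = \prod_(k <- s') f k (X k w).
    by apply: eq_big_seq => k ks; rewrite gs'.
  by rewrite [X in X * cos _]mulrC.
(* The same separation with only [j] accumulated; it folds the expansion back into the cosine of the
   whole sum at the end. *)
have IH1 psi phi' : \int[P]_w (1 * cos (u j * X j w + psi) *
      cos (\sum_(k <- s) u k * X k w + phi')) =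
    \int[P]_w cos (u j * X j w + psi) *
    \int[P]_w cos (\sum_(k <- s) u k * X k w + phi').
  have := IH [:: j] (g psi) u phi' us1 (bg psi).
  rewrite big_seq1 gj => <-.
  by apply: eq_Rintegral => w _; rewrite big_seq1 gj mul1r.
rewrite E// !IHg.
have := E (cst 1) (bmeas_cst _ 1); rewrite !IH1.
under eq_Rintegral do rewrite mul1r.
by move=> ->; rewrite mulrBr !mulrA.
Qed.

Lemma independent_cos_cons : mutually_independent X ->
  forall j (s : seq I) (u : I -> R) (phi : R), uniq (j :: s) ->
  \int[P]_w cos (\sum_(k <- j :: s) u k * X k w + phi) =
  (\int[P]_w cos (u j * X j w)) * (\int[P]_w cos (\sum_(k <- s) u k * X k w + phi))
  - (\int[P]_w sin (u j * X j w)) *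
    (\int[P]_w cos (\sum_(k <- s) u k * X k w + (phi - pi / 2))).
Proof.
move=> indX j s u phi us.
have bS psi : bmeas (fun w => cos (\sum_(k <- s) u k * X k w + psi)).
  have := bmeas_comp (bmeas_cosD 1 psi) (measurable_lin s u).
  by under eq_fun do rewrite mul1r.
have F psi phi' : \int[P]_w (cos (u j * X j w + psi) * cos (\sum_(k <- s) u k * X k w + phi'))
  = \int[P]_w (cos (u j * X j w + psi)) * \int[P]_w cos (\sum_(k <- s) u k * X k w + phi').
  have := independent_cos_factor indX (s' := [:: j]) (s := s)
    (f := fun=> fun x => cos (u j * x + psi)) u phi' us (fun=> bmeas_cosD _ _).
  by rewrite big_seq1 => <-; apply: eq_Rintegral => w _; rewrite big_seq1.
have cE : (fun w => cos (u j * X j w)) = (fun w => cos (u j * X j w + 0)).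
  by apply/funext => w; rewrite addr0.
have sE : (fun w => sin (u j * X j w)) = (fun w => cos (u j * X j w - pi / 2)).
  by apply/funext => w; rewrite cosB cos_pihalf sin_pihalf mulr0 add0r mulr1.
rewrite cE sE -!F -RintegralB//.
- by apply: eq_Rintegral => w _; rewrite big_cons -addrA cosDBhalf addr0 addrA.
- by apply/bmeas_integrable/bmeasM => //; apply: (bmeas_comp (bmeas_cosD _ _)).
- by apply/bmeas_integrable/bmeasM => //; apply: (bmeas_comp (bmeas_cosD _ _)).
Qed.

Lemma le_normr_Rintegral_cst (f : T -> R) (M : R) : measurable_fun setT f ->
  (forall w, `|f w| <= M) -> `|\int[P]_w f w| <= M.
Proof.
move=> mf fM; have bf : bmeas f by split => //; exists M.
apply: le_trans (le_normr_Rintegral _ _) _ => //; first exact: bmeas_integrable.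
rewrite -[leRHS](Rintegral_prob_cst P); apply: le_Rintegral => //.
- by apply: bmeas_integrable; split; [exact: measurableT_comp|exists M => x; rewrite normr_id].
- exact: bmeas_integrable (bmeas_cst _ M).
Qed.

(* The factors are replaced one at a time; expanding [cos (x + y)] also produces
   expectations of sines, which must be small. *)
Lemma independent_cos_bound (r delta : I -> R) (u : I -> R) :
  mutually_independent X ->
  (forall k, 0 <= r k <= 1) ->
  (forall k, `|\int[P]_w cos (u k * X k w) - r k| + `|\int[P]_w sin (u k * X k w)|
    <= delta k) ->
  forall (s : seq I) (phi : R), uniq s ->
  `|\int[P]_w cos (\sum_(k <- s) u k * X k w + phi) - cos phi * \prod_(k <- s) r k| <=
  \sum_(k <- s) delta k.
Proof.
move=> indX r01 hd; elim=> [|j s IH] phi us.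
  under eq_Rintegral do rewrite big_nil add0r.
  by rewrite !big_nil mulr1 (Rintegral_prob_cst P) subrr normr0.
rewrite independent_cos_cons// !big_cons.
have /(IH phi) : uniq s by case/andP: us.
have := hd j; have /andP[] := r01 j.
have F psi : `|\int[P]_w cos (\sum_(k <- s) u k * X k w + psi)| <= 1.
  apply: le_normr_Rintegral_cst => [|w]; last exact: cos_max.
  have [+ _] := bmeas_comp (bmeas_cosD 1 psi) (measurable_lin s u).
  by under eq_fun do rewrite mul1r.
have := F phi; have := F (phi - pi / 2).
set A := \int[P]_w cos (_ + phi); set B := \int[P]_w cos (_ + (_ - _)).
set C := \int[P]_w _; set S := \int[P]_w _.
set r0 := r j; set p := cos phi * \prod_(_ <- _) _; set D := \sum_(_ <- _) _.
move=> B1 A1 r0ge r0le hdj hD.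
have -> : C * A - S * B - cos phi * (r0 * \prod_(j0 <- s) r j0) =
  (C - r0) * A - S * B + r0 * (A - p) by rewrite /p; ring.
apply: le_trans (ler_normD _ _) _; apply: lerD.
  apply: le_trans (ler_normB _ _) _; apply: le_trans hdj.
  by rewrite !normrM lerD// ler_piMr.
by rewrite normrM (ger0_norm r0ge) (le_trans _ hD)// ler_piMl.
Qed.

End independent_product.

Section integrable_EFin.
Context {R : realType} d (T : measurableType d) (mu : {measure set T -> \bar R}).
Variable D : set T.
Hypothesis mD : measurable D.
Implicit Types f g : T -> R.

Lemma integrableD_EFin f g : mu.-integrable D (EFin \o f) ->
  mu.-integrable D (EFin \o g) -> mu.-integrable D (EFin \o (fun x => f x + g x)).
Proof. exact: integrableD. Qed.

Lemma integrableB_EFin f g : mu.-integrable D (EFin \o f) ->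
  mu.-integrable D (EFin \o g) -> mu.-integrable D (EFin \o (fun x => f x - g x)).
Proof. exact: integrableB. Qed.

Lemma integrableZl_EFin (r : R) f : mu.-integrable D (EFin \o f) ->
  mu.-integrable D (EFin \o (fun x => r * f x)).
Proof. exact: integrableZl. Qed.

End integrable_EFin.

(** * Taylor bounds for sine, cosine and the exponential *)

Section elementary_bounds.
Context {R : realType}.
Implicit Types x y : R.

(** Each application raises the order of a Taylor remainder by one. The constants obtained this way
    are not sharp, but only the orders matter later. *)
Lemma norm_le_MVT0 (f df g : R -> R) : f 0 = 0 ->
  (forall x, is_derive x 1 f (df x)) ->
  (forall x y, `|x| <= `|y| -> `|df x| <= g y) ->
  forall x, `|f x| <= g x * `|x|.
Proof.
move=> f0 fdf dfg x.
have cf (a b : R) : {within `[a, b], continuous f}.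
  by apply: derivable_within_continuous => z _; have [] := fdf z.
have [x0|x0] := leP 0 x.
  have [c + e] := MVT_segment x0 (fun z _ => fdf z) (cf 0 x).
  rewrite in_itv/= => /andP[c0 cx].
  move: e; rewrite f0 !subr0 => ->; rewrite normrM ler_wpM2r// dfg//.
  by rewrite !ger0_norm.
have [c + e] := MVT_segment (ltW x0) (fun z _ => fdf z) (cf x 0).
rewrite in_itv/= => /andP[c0 cx].
move: e; rewrite f0 !sub0r => e; rewrite -normrN e normrM normrN ler_wpM2r// dfg//.
by rewrite !ler0_norm ?lerN2// ltW.
Qed.

Lemma norm_sin_le x : `|sin x| <= `|x|.
Proof.
rewrite -[leRHS]mul1r; apply: (@norm_le_MVT0 sin cos (cst 1)) => // [|y z _].
  exact: sin0.
exact: cos_max.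
Qed.

Lemma norm_cosB1_le x : `|cos x - 1| <= `|x|.
Proof.
rewrite -[leRHS]mul1r.
apply: (@norm_le_MVT0 (fun x => cos x - 1) (fun x => - sin x) (cst 1)) => [|y|y z _].
- by rewrite cos0 subrr.
- by apply: is_derive_eq; rewrite subr0.
- by rewrite normrN sin_max.
Qed.

Lemma norm_cosB1_le_sqr x : `|cos x - 1| <= x ^+ 2.
Proof.
rewrite -real_normK ?num_real// expr2.
apply: (@norm_le_MVT0 (fun x => cos x - 1) (fun x => - sin x) (fun x => `|x|)) => [|y|y z yz].
- by rewrite cos0 subrr.
- by apply: is_derive_eq; rewrite subr0.
- by rewrite normrN (le_trans (norm_sin_le _)).
Qed.

Lemma norm_sinBid_le_sqr x : `|sin x - x| <= x ^+ 2.
Proof.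
rewrite -real_normK ?num_real// expr2.
apply: (@norm_le_MVT0 (fun x => sin x - x) (fun x => cos x - 1) (fun x => `|x|)) => [|y z yz].
- by rewrite sin0 subrr.
- by rewrite (le_trans (norm_cosB1_le _)).
Qed.

Lemma norm_sinBid_le x : `|sin x - x| <= `|x| ^+ 3.
Proof.
rewrite exprSr.
apply: (@norm_le_MVT0 (fun x => sin x - x) (fun x => cos x - 1) (fun x => `|x| ^+ 2))
  => [|y z yz].
- by rewrite sin0 subrr.
- by rewrite (le_trans (norm_cosB1_le_sqr _))// -real_normK ?num_real// ler_sqr ?nnegrE.
Qed.

Lemma norm_cos_taylor2_le x : `|cos x - 1 + x ^+ 2 / 2| <= `|x| ^+ 3.
Proof.
rewrite [leRHS]exprSr.
apply: (@norm_le_MVT0 (fun x => cos x - 1 + x ^+ 2 / 2) (fun x => x - sin x)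
  (fun x => `|x| ^+ 2)) => [|y|y z yz].
- by rewrite cos0 subrr expr0n/= mul0r addr0.
- apply: is_derive_eq; rewrite /GRing.scale/=; by field.
- by rewrite distrC (le_trans (norm_sinBid_le_sqr _))// -real_normK ?num_real// ler_sqr ?nnegrE.
Qed.

Lemma expRN_bound1 y : 0 <= y -> `|expR (- y) - 1| <= y.
Proof.
move=> y0; have := expR_ge1Dx (- y).
have : expR (- y) <= 1 by rewrite -expR0 ler_expR oppr_le0.
by rewrite ler_norml => ? ?; apply/andP; split; lra.
Qed.

Lemma expRN_bound2 y : 0 <= y -> `|expR (- y) - (1 - y)| <= y ^+ 2.
Proof.
move=> y0; have e0 := expR_gt0 y; have h1 := expR_ge1Dx y.
have h2 := expR_ge1Dx (- y).
have h3 : expR (- y) <= (1 + y)^-1 by rewrite expRN lef_pV2// posrE; lra.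
have h4 : (1 + y)^-1 <= 1 - y + y ^+ 2.
  rewrite -[leLHS]mul1r ler_pdivrMr; last lra.
  have : 0 <= y ^+ 3 by exact: exprn_ge0.
  by rewrite (_ : (1 - y + y ^+ 2) * (1 + y) = 1 + y ^+ 3); [lra|ring].
by rewrite ler_norml; apply/andP; split; have := sqr_ge0 y; lra.
Qed.

End elementary_bounds.

Section characteristic_function_bounds.
Context {R : realType} d (T : measurableType d) (P : probability T R).
Variable (X : T -> R).
Hypothesis mX : measurable_fun setT X.
Hypothesis X2 : P.-integrable setT (EFin \o (fun w => X w ^+ 2)).

Lemma integrable_sqr_id : P.-integrable setT (EFin \o X).
Proof.
have i1 := integrableD measurableT (bmeas_integrable P (bmeas_cst T 1)) X2.
apply: (le_integrable measurableT _ _ i1); first exact/measurable_EFinP.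
move=> w _ /=; rewrite lee_fin [leRHS]ger0_norm ?addr_ge0 ?sqr_ge0//.
by have := sqr_ge0 (`|X w| - 1); rewrite sqrrB real_normK ?num_real//; have := normr_ge0 (X w); lra.
Qed.

Let m2 := \int[P]_w (X w ^+ 2).

Let icos u : P.-integrable setT (EFin \o (fun w => cos (u * X w))).
Proof.
have := bmeas_integrable P (bmeas_comp (bmeas_cosD u 0) mX).
by under eq_fun do rewrite addr0.
Qed.

Let isin u : P.-integrable setT (EFin \o (fun w => sin (u * X w))).
Proof.
have := bmeas_integrable P (bmeas_comp (bmeas_cosD u (- (pi / 2))) mX).
by under eq_fun do rewrite cosB cos_pihalf sin_pihalf mulr0 add0r mulr1.
Qed.

Lemma Rintegral_dist_le (f g h : T -> R) : P.-integrable setT (EFin \o f) ->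
  P.-integrable setT (EFin \o g) -> P.-integrable setT (EFin \o h) ->
  (forall w, `|f w - g w| <= h w) ->
  `|\int[P]_w f w - \int[P]_w g w| <= \int[P]_w h w.
Proof.
move=> intf intg inth fgh; rewrite -RintegralB//.
have intfg : P.-integrable setT (EFin \o (fun w => f w - g w)) by exact: integrableB_EFin.
apply: le_trans (le_normr_Rintegral _ intfg) _ => //.
by apply: le_Rintegral => //; exact: integrable_norm.
Qed.

Lemma Rintegral_cos_le u : `|\int[P]_w cos (u * X w) - 1| <= u ^+ 2 * m2.
Proof.
rewrite -{1}(Rintegral_prob_cst P 1) -RintegralZl//.
apply: Rintegral_dist_le => //.
- exact: bmeas_integrable (bmeas_cst _ _).
- exact: integrableZl_EFin.
- by move=> w; rewrite -exprMn norm_cosB1_le_sqr.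
Qed.

(** Both the cosine and the Gaussian factor are within the variance of [u X] from 1, and the linear
    term of the sine disappears because [X] is centered. The bound involves no third moment, so it
    can be afforded for the large weights. *)
Lemma cf_bound_sqr u : \int[P]_w X w = 0 ->
  `|\int[P]_w cos (u * X w) - expR (- (u ^+ 2 * m2 / 2))| + `|\int[P]_w sin (u * X w)|
  <= 3 * (u ^+ 2 * m2).
Proof.
move=> X0; have m20 : 0 <= m2 by apply: Rintegral_ge0 => w _; exact: sqr_ge0.
have v0 : 0 <= u ^+ 2 * m2 by rewrite mulr_ge0 ?sqr_ge0.
have h1 := Rintegral_cos_le u.
have /expRN_bound1 : 0 <= u ^+ 2 * m2 / 2 by rewrite divr_ge0.
have iX := integrable_sqr_id.
have h2 : `|\int[P]_w sin (u * X w)| <= u ^+ 2 * m2.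
  rewrite -[X in `|X|]subr0 -[X in _ - X](mulr0 u) -X0 -!RintegralZl//.
  apply: Rintegral_dist_le => //.
  - exact: integrableZl_EFin.
  - exact: integrableZl_EFin.
  - by move=> w; rewrite -exprMn norm_sinBid_le_sqr.
move: h1 h2; set A := \int[P]_w _; set B := \int[P]_w _; set e := expR _ => h1 h2 h3.
have := ler_distD 1 A e; rewrite (distrC 1 e); lra.
Qed.

(** The terms of order two of the cosine and of the exponential cancel. What remains is one third
    moment from the cosine, one from the sine, and the second order remainder of the exponential. *)
Lemma cf_bound_cube u (m3 : R) : \int[P]_w X w = 0 ->
  P.-integrable setT (EFin \o (fun w => `|X w| ^+ 3)) ->
  \int[P]_w (`|X w| ^+ 3) <= m3 ->
  `|\int[P]_w cos (u * X w) - expR (- (u ^+ 2 * m2 / 2))| + `|\int[P]_w sin (u * X w)|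
  <= 2 * `|u| ^+ 3 * m3 + (u ^+ 2 * m2) ^+ 2.
Proof.
move=> X0 X3 m3le; have m20 : 0 <= m2 by apply: Rintegral_ge0 => w _; exact: sqr_ge0.
have v0 : 0 <= u ^+ 2 * m2 by rewrite mulr_ge0 ?sqr_ge0.
have iX := integrable_sqr_id.
have i3 : P.-integrable setT (EFin \o (fun w => `|u| ^+ 3 * `|X w| ^+ 3)) by exact: integrableZl_EFin.
have u3 : 0 <= `|u| ^+ 3 by exact: exprn_ge0.
have I3 : \int[P]_w (`|u| ^+ 3 * `|X w| ^+ 3) <= `|u| ^+ 3 * m3.
  by rewrite RintegralZl// ler_wpM2l.
have h2 : `|\int[P]_w sin (u * X w)| <= `|u| ^+ 3 * m3.
  apply: le_trans I3.
  rewrite -[X in `|X|]subr0 -[X in _ - X](mulr0 u) -X0 -RintegralZl//.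
  apply: Rintegral_dist_le => //.
  - exact: integrableZl_EFin.
  - by move=> w; rewrite -exprMn -normrM norm_sinBid_le.
have i2 : P.-integrable setT (EFin \o (fun w => 1 - (u ^+ 2 / 2) * X w ^+ 2)).
  by apply: integrableB_EFin => //; [exact: bmeas_integrable (bmeas_cst _ _)|exact: integrableZl_EFin].
have h1 : `|\int[P]_w cos (u * X w) - (1 - u ^+ 2 * m2 / 2)| <= `|u| ^+ 3 * m3.
  apply: le_trans I3.
  rewrite (_ : 1 - _ = \int[P]_w (1 - (u ^+ 2 / 2) * X w ^+ 2)); last first.
    rewrite RintegralB//; [|exact: bmeas_integrable (bmeas_cst _ _)|exact: integrableZl_EFin].
    rewrite (RintegralZl _ measurableT X2) (Rintegral_prob_cst P) -/m2.
    by congr (_ - _); rewrite mulrAC.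
  apply: Rintegral_dist_le => // w.
  rewrite -exprMn -normrM.
  rewrite (_ : _ - _ = cos (u * X w) - 1 + (u * X w) ^+ 2 / 2); last by field.
  exact: norm_cos_taylor2_le.
have /expRN_bound2 : 0 <= u ^+ 2 * m2 / 2 by rewrite divr_ge0.
move: h1 h2; set A := \int[P]_w _; set B := \int[P]_w _; set e := expR _ => h1 h2.
rewrite distrC => h3; have := ler_distD (1 - u ^+ 2 * m2 / 2) A e.
have : (u ^+ 2 * m2 / 2) ^+ 2 <= (u ^+ 2 * m2) ^+ 2.
  by rewrite ler_sqr ?nnegrE ?divr_ge0//; lra.
lra.
Qed.

End characteristic_function_bounds.

(** * Gaussian laws *)

Section real_convergence.
Context {R : realType}.

Lemma cvg_harmonic_bound (u : nat -> R) (l C : R) :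
  (forall n, `|u n - l| <= C / n.+1%:R) -> u @ \oo --> l.
Proof.
move=> h; apply/subr_cvg0/norm_cvg0P.
apply: (@squeeze_cvgr _ _ _ _ (cst 0) (fun n => C * harmonic n)).
- by apply: nearW => n; rewrite normr_ge0/= h.
- exact: cvg_cst.
- by rewrite -[X in _ --> X](mulr0 C); apply: cvgMr; exact: cvg_harmonic.
Qed.

Lemma Rdominated_cvg_ae d (T : measurableType d) (mu : {measure set T -> \bar R})
    (D : set T) (f_ : nat -> T -> R) (f g : T -> R) : measurable D ->
  (forall n, measurable_fun D (f_ n)) -> measurable_fun D f ->
  {ae mu, forall x, D x -> f_ n x @[n --> \oo] --> f x} ->
  mu.-integrable D (EFin \o g) ->
  {ae mu, forall x, forall n, D x -> `|f_ n x| <= g x} ->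
  mu.-integrable D (EFin \o f) /\
  \int[mu]_(x in D) f_ n x @[n --> \oo] --> \int[mu]_(x in D) f x.
Proof.
move=> mD mf_ mf ff ig fg.
have [|||||i1 _ i3] := @dominated_convergence _ T R mu D mD
  (fun n => EFin \o f_ n) (EFin \o f) (EFin \o g).
- by move=> n; exact/measurable_EFinP.
- exact/measurable_EFinP.
- by apply: filterS ff => x h Dx; apply: cvg_EFin; [exact: nearW|exact: h].
- by [].
- by apply: filterS fg => x h n Dx; rewrite lee_fin h.
split => //; apply: fine_cvg; rewrite /Rintegral fineK//.
exact: integrable_fin_num.
Qed.

Lemma Rdominated_cvg d (T : measurableType d) (mu : {measure set T -> \bar R})
    (D : set T) (f_ : nat -> T -> R) (f g : T -> R) : measurable D ->
  (forall n, measurable_fun D (f_ n)) -> measurable_fun D f ->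
  {ae mu, forall x, D x -> f_ n x @[n --> \oo] --> f x} ->
  mu.-integrable D (EFin \o g) ->
  (forall n x, D x -> `|f_ n x| <= g x) ->
  mu.-integrable D (EFin \o f) /\
  \int[mu]_(x in D) f_ n x @[n --> \oo] --> \int[mu]_(x in D) f x.
Proof.
move=> mD mf_ mf ff ig fg; apply: (Rdominated_cvg_ae mD mf_ mf ff ig).
by apply: aeW => x n; exact: fg.
Qed.

End real_convergence.

Section integral_derivative.
Context {R : realType}.
Local Notation mu := (@lebesgue_measure R).

(** Windows centered at [m] exhaust the line; on each one the integral is a difference of boundary
    values, of order [1 / n]. *)
Lemma integral_derivative0 (H h : R -> R) (m C : R) :
  (forall x : R, is_derive x 1 H (h x)) -> continuous h ->
  mu.-integrable setT (EFin \o h) ->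
  (forall n : nat, `|H (m + n.+1%:R)| <= C / n.+1%:R) ->
  (forall n : nat, `|H (m - n.+1%:R)| <= C / n.+1%:R) ->
  \int[mu]_x h x = 0.
Proof.
move=> dH ch ih Hp Hm.
pose A (n : nat) : set R := `[m - n.+1%:R, m + n.+1%:R]%classic.
have L n : \int[mu]_x (h x * \1_(A n) x) = H (m + n.+1%:R) - H (m - n.+1%:R).
  have -> : \int[mu]_x (h x * \1_(A n) x) = \int[mu]_(x in A n) h x.
    rewrite [RHS]Rintegral_mkcond; apply: eq_Rintegral => x _.
    by rewrite patchE indicE; case: ifP; rewrite ?mulr1 ?mulr0.
  have n0 : 0 < n.+1%:R :> R by rewrite ltr0n.
  have lt : m - n.+1%:R < m + n.+1%:R :> R by lra.
  rewrite /Rintegral (@continuous_FTC2 _ h H)//.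
  - exact: continuous_subspaceT.
  - have cH (x : R) : {for x, continuous H}.
      by apply/differentiable_continuous/derivable1_diffP; have [] := dH x.
    split => [x _||]; first by have [] := dH x.
    + exact: cvg_at_right_filter (cH _).
    + exact: cvg_at_left_filter (cH _).
  - by move=> x _; rewrite derive1E; have [_ ->] := dH x.
have mh : measurable_fun setT h by exact: continuous_measurable_fun.
have [] := @Rdominated_cvg R _ _ mu setT (fun n x => h x * \1_(A n) x) h (fun x => `|h x|).
- by [].
- by move=> n; apply: measurable_funM => //; apply: measurable_indic; exact: measurable_itv.
- by [].
- apply: aeW => x _; apply: cvg_near_cst; near=> n.
  rewrite indicE mem_set ?mulr1// /A/= in_itv/=.
  have : `|x - m| <= n.+1%:R.
    near: n; exists (Num.truncn `|x - m|) => // n /= hn.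
    rewrite (le_trans (ltW (truncnS_gt _)))// ler_nat ltnS//.
  by rewrite ler_norml => /andP[? ?]; apply/andP; split; lra.
- exact: integrable_norm.
- by move=> n x _; rewrite normrM indicE; case: (_ \in _); rewrite ?normr1 ?mulr1// normr0 mulr0.
move=> _; under eq_fun do rewrite L.
move=> cv; apply/esym; move: cv; apply: cvg_unique => //.
apply: (@cvg_harmonic_bound _ _ _ (C + C)) => n.
by rewrite subr0 (le_trans (ler_normB _ _))// mulrDl lerD.
Unshelve. all: by end_near. Qed.

End integral_derivative.

Section normal_characteristic_function.
Context {R : realType} (m s : R) (s0 : s != 0).
Local Notation mu := (@lebesgue_measure R).
Local Notation p := (normal_pdf m s).

Lemma integrable_bounded_normal_pdf (f : R -> R) : bmeas f ->
  mu.-integrable setT (EFin \o (fun x => f x * p x)).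
Proof.
move=> [mf [M fM]].
apply: (le_integrable measurableT _ _ (integrableZl_EFin measurableT M (integrable_normal_pdf m s))).
  by apply/measurable_EFinP/measurable_funM => //; exact: measurable_normal_pdf.
move=> x _; rewrite lee_fin !normrM ler_wpM2r// (le_trans (fM x))//.
exact: ler_norm.
Qed.

(** Doubling the standard deviation frees the factor [expR (- z)] with [z = 3 (x - m)^2 / (8 s^2)],
    where [3 / 8 = 1 / 2 - 1 / 8]. It absorbs the linear factor, since [|y| <= 1 + y^2] and
    [y^2 = (8 s^2 / 3) z]. *)
Lemma normal_pdf_moment_bound x :
  `|x - m| * p x <= (1 + s ^+ 2 * 8 / 3) * normal_peak s / normal_peak (2 * s) * normal_pdf m (2 * s) x.
Proof.
have s20 : 2 * s != 0 by rewrite mulf_neq0.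
rewrite !normal_pdfE// [leRHS]mulrA divfK ?gt_eqF ?normal_peak_gt0// mulrCA [leRHS]mulrAC mulrC.
rewrite ler_wpM2r ?normal_peak_ge0//.
rewrite /normal_fun; set y := x - m.
have sp : 0 < s ^+ 2 by rewrite exprn_even_gt0.
pose z : R := 3 * y ^+ 2 / (s ^+ 2 * 8).
have z0 : 0 <= z by rewrite divr_ge0// mulr_ge0// ?sqr_ge0// ltW.
have -> : - y ^+ 2 / (s ^+ 2 *+ 2) = - z - y ^+ 2 / ((2 * s) ^+ 2 *+ 2).
  by rewrite /z; field.
rewrite expRD mulNr mulrA ler_wpM2r ?expR_ge0//.
have e1 : 1 + z <= expR z := expR_ge1Dx z.
rewrite expRN ler_pdivrMr ?expR_gt0//.
apply: (@le_trans _ _ ((1 + s ^+ 2 * 8 / 3) * (1 + z))); last first.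
  by rewrite ler_wpM2l//; have := sqr_ge0 s; lra.
have -> : (1 + s ^+ 2 * 8 / 3) * (1 + z) = 1 + s ^+ 2 * 8 / 3 + z + y ^+ 2.
  by rewrite /z; field.
have := sqr_ge0 (`|y| - 1); rewrite sqrrB real_normK ?num_real//.
have := normr_ge0 y; have := sqr_ge0 s; lra.
Qed.

Lemma integrable_normal_pdf_moment :
  mu.-integrable setT (EFin \o (fun x => `|x - m| * p x)).
Proof.
pose C := (1 + s ^+ 2 * 8 / 3) * normal_peak s / normal_peak (2 * s).
apply: (le_integrable measurableT _ _ (integrableZl_EFin measurableT C (integrable_normal_pdf m (2 * s)))).
  apply/measurable_EFinP/measurable_funM; last exact: measurable_normal_pdf.
  by apply: measurableT_comp => //; exact: measurable_funB.
move=> x _; rewrite lee_fin ger0_norm; last by rewrite mulr_ge0// normal_pdf_ge0.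
exact: le_trans (normal_pdf_moment_bound x) (ler_norm _).
Qed.

Lemma is_derive_normal_pdf (x : R) : is_derive x 1 p (- ((x - m) / s ^+ 2) * p x).
Proof.
rewrite normal_pdfE//.
apply: is_derive_eq; rewrite /GRing.scale/=.
by rewrite /normal_fun; field.
Qed.


Definition normal_cos (phi delta : R) := \int[mu]_x (cos (delta * (x - m) + phi) * p x).

Lemma continuous_normal_pdfE : continuous p.
Proof. exact: continuous_normal_pdf. Qed.

Lemma bmeas_cos_shift (delta phi : R) :
  bmeas (fun x : R => cos (delta * (x - m) + phi)).
Proof.
have := bmeas_cosD delta (phi - delta * m).
suff -> : (fun x : R => cos (delta * x + (phi - delta * m))) =
  (fun x => cos (delta * (x - m) + phi)) by [].
by apply/funext => x; congr cos; ring.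
Qed.

(** Differentiation under the integral produces the factor [x - m], and [(x - m) p] is [- s^2] times
    the derivative of [p]; integrating by parts closes a linear differential equation in [delta]. *)
Lemma is_derive_normal_cos (phi delta : R) :
  is_derive delta 1 (normal_cos phi) (- (s ^+ 2 * delta) * normal_cos phi delta).
Proof.
pose f (d x : R) := cos (d * (x - m) + phi) * p x.
have df (d x : R) : is_derive d 1 (f ^~ x) (- ((x - m) * sin (d * (x - m) + phi) * p x)).
  by rewrite /f; apply: is_derive_eq; rewrite /GRing.scale/=; ring.
have dfE (d x : R) : partial1of2 f d x = - ((x - m) * sin (d * (x - m) + phi) * p x).
  by rewrite partial1of2E; have [_ ->] := df d x.
have a1 : `]delta - 1, delta + 1[%classic delta.
  by rewrite /= in_itv/=; apply/andP; split; lra.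
have intf d : `]delta - 1, delta + 1[%classic d -> mu.-integrable setT (EFin \o f d).
  by move=> _; exact/integrable_bounded_normal_pdf/bmeas_cos_shift.
have intG := integrable_normal_pdf_moment.
have G0 x : 0 <= `|x - m| * p x by rewrite mulr_ge0// normal_pdf_ge0.
have derf d x : `]delta - 1, delta + 1[%classic d -> setT x -> derivable (f ^~ x) d 1.
  by move=> _ _; have [] := df d x.
have Gub d x : `]delta - 1, delta + 1[%classic d -> setT x ->
    `|partial1of2 f d x| <= `|x - m| * p x.
  move=> _ _; rewrite dfE normrN !normrM (ger0_norm (normal_pdf_ge0 _ _ _)).
  by rewrite ler_wpM2r ?normal_pdf_ge0// ler_piMr// sin_max.
have D := derivable_under_integral measurableT a1 intf derf G0 intG Gub.
have E := differentiation_under_integral measurableT a1 intf derf G0 intG Gub.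
apply: DeriveDef; first exact: D.
rewrite -derive1E [LHS]E.
(* integration by parts *)
pose H (x : R) := sin (delta * (x - m) + phi) * p x.
pose h (x : R) := delta * (cos (delta * (x - m) + phi) * p x)
  - (s ^+ 2)^-1 * ((x - m) * sin (delta * (x - m) + phi) * p x).
have cont_lin : continuous (fun x : R => delta * (x - m) + phi).
  move=> x; apply: cvgD; last exact: cvg_cst.
  by apply: cvgMr; apply: cvgB; [exact: cvg_id|exact: cvg_cst].
have cc : continuous (fun x : R => cos (delta * (x - m) + phi)).
  by move=> x; apply: continuous_comp; [exact: cont_lin|exact: continuous_cos].
have cs : continuous (fun x : R => sin (delta * (x - m) + phi)).
  by move=> x; apply: continuous_comp; [exact: cont_lin|exact: continuous_sin].
have i1 : mu.-integrable setT (EFin \o (fun x => cos (delta * (x - m) + phi) * p x)).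
  exact: intf a1.
have c2 : continuous (fun x : R => (x - m) * sin (delta * (x - m) + phi) * p x).
  move=> x; apply: cvgM; last exact: continuous_normal_pdfE.
  by apply: cvgM; [apply: cvgB; [exact: cvg_id|exact: cvg_cst]|exact: cs].
have i2 : mu.-integrable setT (EFin \o (fun x => (x - m) * sin (delta * (x - m) + phi) * p x)).
  apply: (le_integrable measurableT _ _ intG).
    by apply/measurable_EFinP; exact: continuous_measurable_fun c2.
  move=> x _; rewrite lee_fin [leRHS]ger0_norm// !normrM (ger0_norm (normal_pdf_ge0 _ _ _)).
  by rewrite ler_wpM2r ?normal_pdf_ge0// ler_piMr// sin_max.
have I0 : \int[mu]_x h x = 0.
  have s2 : 0 < s ^+ 2 by rewrite exprn_even_gt0.
  (* Decay of order [1 / n] at the ends of the windows is enough, so the exponential is only bounded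
     below by its argument. *)
  have Hb x n : `|x - m| = n.+1%:R -> `|H x| <= (normal_peak s * s ^+ 2 *+ 2) / n.+1%:R.
    move=> xm; rewrite /H normrM (ger0_norm (normal_pdf_ge0 _ _ _)).
    apply: (@le_trans _ _ (p x)); first by rewrite ler_piMl ?normal_pdf_ge0// sin_max.
    rewrite normal_pdfE// -mulrnAr -mulrA ler_wpM2l ?normal_peak_ge0//.
    rewrite /normal_fun mulNr expRN -real_normK ?num_real// xm.
    have n0 : 0 < n.+1%:R :> R by rewrite ltr0n.
    have n1 : 1 <= n.+1%:R :> R by rewrite ler1n.
    have z0 : 0 < n.+1%:R ^+ 2 / (s ^+ 2 *+ 2) :> R.
      by rewrite divr_gt0 ?exprn_gt0// pmulrn_rgt0.
    apply: (@le_trans _ _ ((n.+1%:R ^+ 2 / (s ^+ 2 *+ 2))^-1)).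
      rewrite lef_pV2 ?posrE ?expR_gt0//.
      by have := expR_ge1Dx (n.+1%:R ^+ 2 / (s ^+ 2 *+ 2)); lra.
    rewrite invf_div ler_wpM2l//; first by rewrite mulrn_wge0// ltW.
    by rewrite lef_pV2 ?posrE ?exprn_gt0// expr2 ler_peMl// ltW.
  apply: (@integral_derivative0 _ H h m (normal_peak s * s ^+ 2 *+ 2)) => [x||||].
  - have dp := is_derive_normal_pdf x.
    rewrite /H; apply: is_derive_eq; rewrite /GRing.scale/= /h; field.
    exact: s0.
  - move=> x; apply: cvgB; apply: cvgMr; last exact: c2.
    by apply: cvgM; [exact: cc|exact: continuous_normal_pdfE].
  - by apply: integrableB_EFin => //; exact: integrableZl_EFin.
  - by move=> n; apply: Hb; rewrite addrC addKr ger0_norm.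
  - by move=> n; apply: Hb; rewrite addrC addKr normrN ger0_norm.
move: I0; rewrite /h RintegralB//; try exact: integrableZl_EFin.
rewrite !RintegralZl//.
rewrite (@eq_Rintegral _ _ R mu setT (fun x => -1 * ((x - m) * sin (delta * (x - m) + phi) * p x))
  (partial1of2 f delta)); last first.
  by move=> x _; rewrite dfE mulN1r.
rewrite RintegralZl// /normal_cos; set A := \int[mu]_x _; set B := \int[mu]_x _ => e.
have -> : B = s ^+ 2 * (delta * A).
  move/eqP: e; rewrite subr_eq0 => /eqP ->; rewrite mulrA mulfV ?mul1r//.
  by rewrite expf_neq0.
by rewrite mulN1r mulNr mulrA.
Qed.

(** The differential equation is solved by an integrating factor: [K] has derivative 0, and its
    value at 0 comes from the total mass of the density. *)
Lemma normal_cosE (phi delta : R) :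
  normal_cos phi delta = cos phi * expR (- (delta ^+ 2 * s ^+ 2 / 2)).
Proof.
pose K (d : R) := normal_cos phi d * expR (d ^+ 2 * s ^+ 2 / 2).
have dK (d : R) : is_derive d 1 K 0.
  have dn := is_derive_normal_cos phi d.
  by rewrite /K; apply: is_derive_eq; rewrite /GRing.scale/=; field.
have := is_derive_0_is_cst delta 0 dK.
rewrite /K expr0n/= mul0r mul0r expR0 mulr1.
have -> : normal_cos phi 0 = cos phi.
  rewrite /normal_cos; under eq_Rintegral do rewrite mul0r add0r.
  rewrite RintegralZl//; last exact: integrable_normal_pdf.
  by rewrite /Rintegral integral_normal_pdf mulr1.
by move=> <-; rewrite expRN mulfK// gt_eqF// expR_gt0.
Qed.

End normal_characteristic_function.

Section gaussian_cos.
Context {R : realType} d (T : measurableType d) (Q : probability T R).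
Implicit Types X : T -> R.

Lemma gaussian_cosE X : measurable_fun setT X -> gaussian Q X ->
  exists m s : R, forall delta phi : R,
    \int[Q]_w cos (delta * X w + phi) =
    cos (delta * m + phi) * expR (- (delta ^+ 2 * s ^+ 2 / 2)).
Proof.
move=> mX [m [s hQ]]; exists m, s => delta phi.
have bc := bmeas_comp (bmeas_cosD delta phi) mX.
have mc : measurable_fun setT (fun x : R => cos (delta * x + phi)).
  by have [] := bmeas_cosD delta phi.
have c0 (x : R) : 0 <= cos (delta * x + phi) + 1.
  by have := cos_geN1 (delta * x + phi); lra.
have Q1 A : measurable A -> (\int[Q]_(x in X @^-1` A) (cst 1 x)%:E = Q (X @^-1` A))%E.
  move=> mA; have mXA : measurable (X @^-1` A) by rewrite -[X in measurable X]setTI; exact: mX.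
  exact: (etrans (integral_cst Q mXA 1%:E) (mul1e _)).
have mc1 : measurable_fun setT (fun x : R => cos (delta * x + phi) + 1).
  exact: measurable_funD.
(* Adding 1 makes the integrand nonnegative, as [eq_integral_density] requires. *)
have -> : \int[Q]_w cos (delta * X w + phi) =
    \int[Q]_w (cst 1 w * (cos (delta * X w + phi) + 1)) - 1.
  under [in RHS]eq_Rintegral do rewrite mul1r.
  rewrite RintegralD//; [|exact: bmeas_integrable|exact: bmeas_integrable (bmeas_cst _ _)].
  by rewrite (Rintegral_prob_cst Q) addrK.
have [s0|s0] := eqVneq s 0.
  rewrite /Rintegral.
  rewrite (@eq_integral_density R d _ T R Q \d_m X (cst 1) idfun (cst 1) mX
    (measurable_cst _) _ (@measurable_id _ _ setT) (measurable_cst _) _ _ _ mc1)//; last first.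
    move=> A mA; rewrite Q1// hQ// s0 eqxx.
    exact/esym/(etrans (integral_cst \d_m mA 1%:E) (mul1e _)).
  rewrite integral_dirac//=; last first.
    by apply/measurable_EFinP; apply: measurable_funM.
  by rewrite indicE in_setT !mul1r addrK s0 expr0n/= mulr0 mul0r oppr0 expR0 mulr1.
rewrite {1}/Rintegral.
rewrite (@eq_integral_density R d _ T _ Q (@lebesgue_measure R) X (cst 1) idfun (normal_pdf m s) mX
    (measurable_cst _) _ (@measurable_id _ _ setT) _ _ _ _ mc1)//; first last.
- by move=> A mA; rewrite Q1// hQ// (negbTE s0).
- exact: normal_pdf_ge0.
- exact: measurable_normal_pdf.
have e := normal_cosE m s0 (phi + delta * m) delta.
rewrite -/(Rintegral lebesgue_measure setT (fun x => normal_pdf m s x * (cos (delta * x + phi) + 1))).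
have -> : (fun x => normal_pdf m s x * (cos (delta * x + phi) + 1)) =
   (fun x => cos (delta * (x - m) + (phi + delta * m)) * normal_pdf m s x + normal_pdf m s x).
  apply/funext => x; rewrite mulrDr mulr1 mulrC; congr (cos _ * _ + _); ring.
rewrite RintegralD//; last 2 first.
- by apply: integrable_bounded_normal_pdf => //; exact: bmeas_cos_shift.
- exact: integrable_normal_pdf.
move: e; rewrite /normal_cos => ->.
by rewrite /Rintegral integral_normal_pdf addrK (addrC phi).
Qed.

Lemma cvg_mul_sin_div (m : R) : (n.+1%:R * sin (n.+1%:R^-1 * m)) @[n --> \oo] --> m.
Proof.
apply: (@cvg_harmonic_bound _ _ _ (m ^+ 2)) => n.
have n0 : 0 < n.+1%:R :> R by rewrite ltr0n.
rewrite -[X in _ - X](mulVKf (lt0r_neq0 n0)) -mulrBr normrM (ger0_norm (ltW n0)).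
apply: le_trans (ler_wpM2l (ltW n0) (norm_sinBid_le_sqr _)) _.
by rewrite le_eqVlt; apply/orP; left; apply/eqP; field; rewrite nat1r pnatr_eq0.
Qed.

Lemma cvg_expR_harmonic (C : R) : expR (- (n.+1%:R^-1 ^+ 2 * C)) @[n --> \oo] --> (1 : R).
Proof.
rewrite -[X in _ --> X]expR0; apply: continuous_cvg; first exact: continuous_expR.
have h : (n.+1%:R^-1 : R) @[n --> \oo] --> (0 : R) by exact: cvg_harmonic.
have h2 : (n.+1%:R^-1 ^+ 2 : R) @[n --> \oo] --> (0 : R).
  rewrite -[X in _ --> X](mulr0 0) (_ : (fun n => _) = (fun n => n.+1%:R^-1 * n.+1%:R^-1)).
    exact: cvgM.
  by apply/funext => n; rewrite expr2.
rewrite -[X in _ --> X]oppr0 -[X in _ --> - X](mul0r C).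
by apply: cvgN; apply: cvgM => //; exact: cvg_cst.
Qed.

(* The parameters of the law are read off the expectations of [cos (u X)] and [sin (u X)]
   as [u] tends to 0, so the moments of normal laws need not be computed. *)
Lemma gaussian_centered_cosE X (V : R) : measurable_fun setT X -> gaussian Q X ->
  Q.-integrable setT (EFin \o (fun w => X w ^+ 2)) ->
  \int[Q]_w X w = 0 -> \int[Q]_w (X w ^+ 2) = V ->
  forall phi, \int[Q]_w cos (X w + phi) = cos phi * expR (- (V / 2)).
Proof.
move=> mX gX X2 X0 XV phi.
have [m [s cE]] := gaussian_cosE mX gX.
have iX := integrable_sqr_id mX X2.
have n0 n : 0 < n.+1%:R :> R by rewrite ltr0n.
have msin u : measurable_fun setT (fun w => sin (u * X w)).
  by apply: measurableT_comp; [apply: continuous_measurable_fun; exact: continuous_sin|exact: measurable_funM].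
have mcos u : measurable_fun setT (fun w => cos (u * X w)).
  by apply: measurableT_comp; [apply: continuous_measurable_fun; exact: continuous_cos|exact: measurable_funM].
have sE u : \int[Q]_w sin (u * X w) = sin (u * m) * expR (- (u ^+ 2 * s ^+ 2 / 2)).
  have := cE u (- (pi / 2)).
  by under eq_Rintegral do rewrite cosB cos_pihalf sin_pihalf mulr0 add0r mulr1;
    rewrite cosB cos_pihalf sin_pihalf mulr0 add0r mulr1.
have isin u : Q.-integrable setT (EFin \o (fun w => sin (u * X w))).
  by apply: bmeas_integrable; split => //; exists 1 => x; exact: sin_max.
have icos u : Q.-integrable setT (EFin \o (fun w => cos (u * X w))).
  by apply: bmeas_integrable; split => //; exists 1 => x; exact: cos_max.
have m0 : m = 0.
  have h1 : n.+1%:R * \int[Q]_w sin (n.+1%:R^-1 * X w) @[n --> \oo] --> m.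
    rewrite (_ : (fun n => _) = (fun n => (n.+1%:R * sin (n.+1%:R^-1 * m)) *
      expR (- (n.+1%:R^-1 ^+ 2 * (s ^+ 2 / 2))))); last first.
      by apply/funext => n; rewrite sE !mulrA.
    rewrite -[X in _ --> X]mulr1.
    by apply: cvgM; [exact: cvg_mul_sin_div|exact: cvg_expR_harmonic].
  have h2 : n.+1%:R * \int[Q]_w sin (n.+1%:R^-1 * X w) @[n --> \oo] --> (0 : R).
    apply: (@cvg_harmonic_bound _ _ _ (\int[Q]_w (X w ^+ 2))) => n.
    rewrite -X0 -RintegralZl// [leRHS]mulrC -[leRHS]RintegralZl//.
    apply: Rintegral_dist_le => //; try exact: integrableZl_EFin.
    move=> w; rewrite -[X in _ - X](mulVKf (lt0r_neq0 (n0 n))) -mulrBr normrM (ger0_norm (ltW (n0 n))).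
    apply: le_trans (ler_wpM2l (ltW (n0 n)) (norm_sinBid_le_sqr _)) _.
    by rewrite le_eqVlt; apply/orP; left; apply/eqP; field; rewrite nat1r pnatr_eq0.
  exact: cvg_unique h1 h2.
have sV : s ^+ 2 = V.
  have h1 : 2 * n.+1%:R ^+ 2 * (1 - \int[Q]_w cos (n.+1%:R^-1 * X w)) @[n --> \oo] --> s ^+ 2.
    apply: (@cvg_harmonic_bound _ _ _ (s ^+ 2 * s ^+ 2)) => n.
    have := cE n.+1%:R^-1 0; rewrite m0 mulr0 addr0 cos0 mul1r.
    under eq_Rintegral do rewrite addr0.
    move=> ->; set y := _ * s ^+ 2 / 2.
    have y0 : 0 <= y by rewrite divr_ge0// mulr_ge0// ?sqr_ge0.
    have -> : 2 * n.+1%:R ^+ 2 * (1 - expR (- y)) - s ^+ 2 =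
        - (2 * n.+1%:R ^+ 2 * (expR (- y) - (1 - y))).
      by rewrite /y; field; rewrite nat1r pnatr_eq0.
    rewrite normrN normrM ger0_norm ?mulr_ge0 ?sqr_ge0//.
    apply: le_trans (ler_wpM2l _ (expRN_bound2 y0)) _; first by rewrite mulr_ge0 ?sqr_ge0.
    have -> : 2 * n.+1%:R ^+ 2 * y ^+ 2 = s ^+ 2 * s ^+ 2 / n.+1%:R * (n.+1%:R^-1 / 2).
      by rewrite /y; field; rewrite nat1r pnatr_eq0.
    rewrite ler_piMr//.
      by apply: divr_ge0 => //; apply: mulr_ge0; exact: sqr_ge0.
    have : n.+1%:R^-1 <= 1 :> R by rewrite invf_le1// ler1n.
    by move=> h; rewrite ler_pdivrMr// mul1r (le_trans h)// ler1n.
  have h2 : 2 * n.+1%:R ^+ 2 * (1 - \int[Q]_w cos (n.+1%:R^-1 * X w)) @[n --> \oo] --> V.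
    rewrite -XV.
    have [] := @Rdominated_cvg R _ _ Q setT
      (fun n w => 2 * n.+1%:R ^+ 2 * (1 - cos (n.+1%:R^-1 * X w))) (fun w => X w ^+ 2)
      (fun w => 2 * X w ^+ 2) => //.
    - by move=> n; apply: measurable_funM => //; exact: measurable_funB.
    - exact: measurable_funX.
    - apply: aeW => w _; apply: (@cvg_harmonic_bound _ _ _ (2 * `|X w| ^+ 3)) => n.
      have -> : 2 * n.+1%:R ^+ 2 * (1 - cos (n.+1%:R^-1 * X w)) - X w ^+ 2 =
        - (2 * n.+1%:R ^+ 2 * (cos (n.+1%:R^-1 * X w) - 1 + (n.+1%:R^-1 * X w) ^+ 2 / 2)).
        by field; rewrite nat1r pnatr_eq0.
      rewrite normrN normrM ger0_norm ?mulr_ge0 ?sqr_ge0//.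
      apply: le_trans (ler_wpM2l _ (norm_cos_taylor2_le _)) _; first by rewrite mulr_ge0 ?sqr_ge0.
      rewrite normrM (@ger0_norm _ n.+1%:R^-1) ?invr_ge0// exprMn.
      by rewrite le_eqVlt; apply/orP; left; apply/eqP; field; rewrite nat1r pnatr_eq0.
    - exact: integrableZl_EFin.
    - move=> n w _; rewrite -normrN -mulrN opprB normrM ger0_norm ?mulr_ge0 ?sqr_ge0//.
      apply: le_trans (ler_wpM2l _ (norm_cosB1_le_sqr _)) _; first by rewrite mulr_ge0 ?sqr_ge0.
      by rewrite le_eqVlt; apply/orP; left; apply/eqP; field; rewrite nat1r pnatr_eq0.
    move=> _; apply: cvg_trans; apply: near_eq_cvg; near=> n.
    rewrite RintegralZl//; last by apply: integrableB_EFin => //; exact: bmeas_integrable (bmeas_cst _ _).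
    rewrite RintegralB//; last exact: bmeas_integrable (bmeas_cst _ _).
    by rewrite (Rintegral_prob_cst Q).
  exact: cvg_unique h1 h2.
have := cE 1 phi; rewrite m0 mulr0 add0r sV expr1n mul1r => <-.
by apply: eq_Rintegral => w _; rewrite mul1r.
Unshelve. all: by end_near. Qed.

End gaussian_cos.

(** * From expectations of cosines to convergence in law *)

Section trigonometric_polynomials.
Context {R : realType} {m : nat}.
Implicit Types (h g : 'rV[R]_m -> R).

(** A term is stored as coefficient, frequency vector and phase. The phase gives sines, and hence
    closure under products, and matches the form in which the central limit theorem is proved. *)
Definition trig_sum (s : seq (R * ('I_m -> R) * R)) (x : 'rV[R]_m) : R :=
  \sum_(p <- s) p.1.1 * cos (\sum_i p.1.2 i * x ord0 i + p.2).

Definition trigpoly h := exists s, h =1 trig_sum s.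

Lemma trigpoly_cst (r : R) : trigpoly (cst r).
Proof.
exists [:: (r, fun=> 0, 0)] => x; rewrite /trig_sum big_seq1/=.
by rewrite big1 ?addr0 ?cos0 ?mulr1// => i _; rewrite mul0r.
Qed.

Lemma trigpolyD h g : trigpoly h -> trigpoly g -> trigpoly (fun x => h x + g x).
Proof. by move=> [s hs] [t gt]; exists (s ++ t) => x; rewrite /trig_sum big_cat/= hs gt. Qed.

Lemma cosM2 (a b : R) : cos a * cos b = 2^-1 * (cos (a + b) + cos (a - b)).
Proof. by rewrite cosD cosB; field. Qed.

Lemma trigpolyM h g : trigpoly h -> trigpoly g -> trigpoly (fun x => h x * g x).
Proof.
move=> [s hs] [t gt].
pose f (e : R) (p q : R * ('I_m -> R) * R) :=
  (p.1.1 * q.1.1 / 2, fun i => p.1.2 i + e * q.1.2 i, p.2 + e * q.2).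
exists ([seq f 1 p q | p <- s, q <- t] ++ [seq f (-1) p q | p <- s, q <- t]) => x.
rewrite /trig_sum big_cat/= !big_flatten !big_map hs gt /trig_sum big_distrl/= -big_split/=.
apply: eq_bigr => p _; rewrite !big_map big_distrr/= -big_split/=; apply: eq_bigr => q _.
have E e : \sum_i (p.1.2 i + e * q.1.2 i) * x ord0 i + (p.2 + e * q.2) =
   (\sum_i p.1.2 i * x ord0 i + p.2) + e * (\sum_i q.1.2 i * x ord0 i + q.2).
  under eq_bigr do rewrite mulrDl -mulrA.
  by rewrite big_split/= -big_distrr/=; ring.
by rewrite !E mul1r mulN1r mulrACA cosM2; field.
Qed.

Lemma trigpoly_sum (I : Type) (s : seq I) (F : I -> 'rV[R]_m -> R) :
  (forall i, trigpoly (F i)) -> trigpoly (fun x => \sum_(i <- s) F i x).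
Proof.
move=> hF; elim: s => [|i s [t ts]].
  by have [t e] := trigpoly_cst 0; exists t => x; rewrite big_nil -e.
by have [u e] := trigpolyD (hF i) (ex_intro _ t ts); exists u => x; rewrite big_cons -e.
Qed.

Lemma trigpoly_prod (I : Type) (s : seq I) (F : I -> 'rV[R]_m -> R) :
  (forall i, trigpoly (F i)) -> trigpoly (fun x => \prod_(i <- s) F i x).
Proof.
move=> hF; elim: s => [|i s [t ts]].
  by have [t e] := trigpoly_cst 1; exists t => x; rewrite big_nil -e.
by have [u e] := trigpolyM (hF i) (ex_intro _ t ts); exists u => x; rewrite big_cons -e.
Qed.

Lemma trigpoly_sin (i : 'I_m) (u : R) : trigpoly (fun x => sin (u * x ord0 i)).
Proof.
exists [:: (1, fun j => if j == i then u else 0, - (pi / 2))] => x.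
rewrite /trig_sum big_seq1/= mul1r (bigD1 i)//= eqxx big1 ?addr0.
  by rewrite cosB cos_pihalf sin_pihalf mulr0 add0r mulr1.
by move=> j /negbTE ->; rewrite mul0r.
Qed.

End trigonometric_polynomials.

(** * Mean and variance of the Bernstein weights *)

Section bernstein.
Context {R : realType}.

(* ['C(N, k) p^k (1 - p)^(N - k)], by recursion on the number of trials. *)
Fixpoint bernstein_weight (N k : nat) (p : R) : R :=
  match N with
  | 0 => (k == 0)%:R
  | N'.+1 => (if k is k'.+1 then p * bernstein_weight N' k' p else 0)
             + (1 - p) * bernstein_weight N' k p
  end.
Local Notation bw := bernstein_weight.

Lemma bernstein_weight_ge0 N k p : 0 <= p <= 1 -> 0 <= bw N k p.
Proof.
move=> /andP[p0 p1]; elim: N k => [|N IH] [|k] //=.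
  by rewrite add0r mulr_ge0// subr_ge0.
by rewrite addr_ge0// mulr_ge0// subr_ge0.
Qed.

Lemma bernstein_weight_gt N k p : (N < k)%N -> bw N k p = 0.
Proof.
elim: N k => [|N IH] [|k] //= Nk.
by rewrite !IH ?mulr0 ?addr0// ltnW.
Qed.

Lemma bernstein_recE N p (g : nat -> R) :
  \sum_(k < N.+2) bw N.+1 k p * g k =
  p * (\sum_(k < N.+1) bw N k p * g k.+1) + (1 - p) * (\sum_(k < N.+1) bw N k p * g k).
Proof.
transitivity (\sum_(k < N.+2) (if (k : nat) is k'.+1 then p * bw N k' p else 0) * g k +
   \sum_(k < N.+2) (1 - p) * bw N k p * g k).
  by rewrite -big_split/=; apply: eq_bigr => k _; rewrite mulrDl.
congr (_ + _).
  rewrite big_ord_recl/= mul0r add0r big_distrr/=; apply: eq_bigr => k _.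
  by rewrite mulrA.
rewrite big_ord_recr/= bernstein_weight_gt// mulr0 mul0r addr0 big_distrr/=.
by apply: eq_bigr => k _; rewrite mulrA.
Qed.

Lemma bernstein_sum N p : \sum_(k < N.+1) bw N k p = 1.
Proof.
have E n : \sum_(k < n.+1) bw n k p * 1 = \sum_(k < n.+1) bw n k p.
  by apply: eq_bigr => k _; rewrite mulr1.
elim: N => [|N IH]; first by rewrite big_ord1.
by have := bernstein_recE N p (fun=> 1); rewrite !E IH => ->; ring.
Qed.

Lemma bernstein_var_aux N p :
  \sum_(k < N.+1) bw N k p * (k%:R - N%:R * p) = 0 /\
  \sum_(k < N.+1) bw N k p * (k%:R - N%:R * p) ^+ 2 = N%:R * (p * (1 - p)).
Proof.
elim: N => [|N [IH1 IH2]].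
  by rewrite !big_ord1 /= !mul0r subr0 mulr0 expr0n/= mulr0.
have s1 := bernstein_sum N p.
(* Passing from [N] to [N.+1] shifts the centered index by [1 - p] or by [- p]; the shifted square
   is a polynomial of this form, whose mean follows from the induction hypotheses. *)
have E (a b c : R) : \sum_(k < N.+1) bw N k p * (a * (k%:R - N%:R * p) ^+ 2 + b * (k%:R - N%:R * p) + c) =
    a * (N%:R * (p * (1 - p))) + c.
  rewrite (_ : \sum_(k < N.+1) _ = a * (\sum_(k < N.+1) bw N k p * (k%:R - N%:R * p) ^+ 2) +
    b * (\sum_(k < N.+1) bw N k p * (k%:R - N%:R * p)) + c * \sum_(k < N.+1) bw N k p).
    by rewrite IH1 IH2 s1; ring.
  by rewrite !big_distrr/= -!big_split/=; apply: eq_bigr => k _; ring.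
split.
  have := bernstein_recE N p (fun k => k%:R - N.+1%:R * p); rewrite /= => ->.
  rewrite (_ : \sum_(k < N.+1) bw N k p * (k.+1%:R - N.+1%:R * p) = 1 - p); last first.
    have := E 0 1 (1 - p); rewrite mul0r add0r => <-.
    by apply: eq_bigr => k _; rewrite -!natr1; ring.
  rewrite (_ : \sum_(k < N.+1) bw N k p * (k%:R - N.+1%:R * p) = - p); last first.
    have := E 0 1 (- p); rewrite mul0r add0r => <-.
    by apply: eq_bigr => k _; rewrite -!natr1; ring.
  by ring.
have := bernstein_recE N p (fun k => (k%:R - N.+1%:R * p) ^+ 2); rewrite /= => ->.
rewrite (_ : \sum_(k < N.+1) bw N k p * (k.+1%:R - N.+1%:R * p) ^+ 2 =
   N%:R * (p * (1 - p)) + (1 - p) ^+ 2); last first.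
  have := E 1 (2 * (1 - p)) ((1 - p) ^+ 2); rewrite mul1r => <-.
  by apply: eq_bigr => k _; rewrite -!natr1; ring.
rewrite (_ : \sum_(k < N.+1) bw N k p * (k%:R - N.+1%:R * p) ^+ 2 =
   N%:R * (p * (1 - p)) + p ^+ 2); last first.
  have := E 1 (2 * - p) (p ^+ 2); rewrite mul1r => <-.
  by apply: eq_bigr => k _; rewrite -!natr1; ring.
by rewrite -natr1; ring.
Qed.

Lemma bernstein_variance N p : (0 < N)%N -> 0 <= p <= 1 ->
  \sum_(k < N.+1) bw N k p * (k%:R / N%:R - p) ^+ 2 <= N%:R^-1.
Proof.
move=> N0 /andP[p0 p1]; have [_ e] := bernstein_var_aux N p.
have NN : N%:R != 0 :> R by rewrite pnatr_eq0 -lt0n.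
rewrite (_ : \sum_(_ < _) _ = (N%:R ^+ 2)^-1 * (N%:R * (p * (1 - p)))); last first.
  rewrite -e big_distrr/=; apply: eq_bigr => k _.
  by field.
rewrite (_ : _ * _ = N%:R^-1 * (p * (1 - p))); last by field.
rewrite ler_piMr ?invr_ge0//.
by rewrite mulrBr mulr1; have := sqr_ge0 p; rewrite expr2; lra.
Qed.

End bernstein.

Section uniform_continuity_box.
Context {R : realType} {m : nat}.

(** Only [x] is confined to the cube. Compactness is used in its covering form: near each point of
    the cube some [del] works for all neighbours, inside or outside the cube. *)
Lemma box_unif_continuous (f : 'rV[R]_m -> R) (K e : R) : continuous f -> 0 < e ->
  exists2 del, 0 < del & forall x y : 'rV[R]_m, (forall i, `|x ord0 i| <= K) ->
    (forall i, `|x ord0 i - y ord0 i| <= del) -> `|f x - f y| <= e.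
Proof.
move=> cf e0.
pose A : set 'rV[R]_m := [set v | forall i, `[- K, K]%classic (v ord0 i)].
have cA : compact A.
  by apply: (@rV_compact R m (fun=> `[- K, K]%classic)) => i; exact: segment_compact.
have [|del /= del0 H] := (compact_near_coveringP A).1 cA R (0^'+)
  (fun del x => forall y : 'rV[R]_m,
    (forall i, `|x ord0 i - y ord0 i| <= del) -> `|f x - f y| <= e).
- move=> x Ax.
  have e20 : 0 < e / 2 by rewrite divr_gt0.
  have /cvgrPdist_lt/(_ _ e20)/nbhs_ballP[r /= r0 hr] := cf x.
  have r20 : 0 < r / 2 by rewrite divr_gt0.
  exists (ball x (r / 2), [set del | del < r / 2]) => /=.
    split; first exact: nbhsx_ballx.
    by apply: nbhs_right_lt.
  move=> [x' del] /= [bx' dr] y xy.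
  have bx : ball x r x'.
    by apply: le_ball bx'; lra.
  have bxy : ball x r y.
    rewrite (splitr r); apply: ball_triangle bx' _.
    by split=> // i j; rewrite (ord1 i) /ball/=; apply: le_lt_trans dr; exact: xy.
  have h1 := hr _ bx; have h2 := hr _ bxy.
  rewrite /= in h1 h2.
  have := ler_distD (f x) (f x') (f y); rewrite (distrC (f x') (f x)); lra.
- exists (del / 2); first by rewrite divr_gt0.
  move=> x y xK xy; apply: (H (del / 2) _ _ x) => //=.
  + by rewrite sub0r normrN gtr0_norm ?divr_gt0//; lra.
  + by rewrite divr_gt0.
  + by move=> i; rewrite /= in_itv/= -ler_norml.
Qed.
End uniform_continuity_box.

Section trigonometric_approximation.
Context {R : realType} {m : nat}.
Local Notation bw := bernstein_weight.
Implicit Types (f : 'rV[R]_m -> R) (x : 'rV[R]_m).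

(** The value [L sin (x_j / L)] carried affinely from [-L, L] to [0, 1], so that it can serve as the
    success probability of the Bernstein weights for every [x]. *)
Definition sin_coord (L : R) x (j : 'I_m) : R := (1 + sin (L^-1 * x ord0 j)) / 2.

(* The Bernstein polynomial of [f] on the cube [-L, L]^m at the points
   [L sin (x_i / L)], which are close to [x_i] when [L] is large. *)
Definition bernstein_op f (L : R) (N : nat) x : R :=
  \sum_(k : {ffun 'I_m -> 'I_N.+1}) f (\row_j (L * (2 * ((k j)%:R / N%:R) - 1))) *
    \prod_j bw N (k j) (sin_coord L x j).

Lemma sin_coord01 L x j : 0 <= sin_coord L x j <= 1.
Proof.
rewrite /sin_coord; have := sin_geN1 (L^-1 * x ord0 j); have := sin_le1 (L^-1 * x ord0 j).
by move=> ? ?; apply/andP; split; lra.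
Qed.

Lemma trigpoly_bernstein f L N : trigpoly (bernstein_op f L N).
Proof.
apply: trigpoly_sum => k; apply: trigpolyM; first exact: trigpoly_cst.
apply: trigpoly_prod => j; move: (nat_of_ord (k j)) => {k}.
have tp : trigpoly (sin_coord L ^~ j).
  apply: (@trigpolyM _ _ (fun x => 1 + sin (L^-1 * x ord0 j)) (cst 2^-1)); last exact: trigpoly_cst.
  by apply: (@trigpolyD _ _ (cst 1)); [exact: trigpoly_cst|exact: trigpoly_sin].
have tq : trigpoly (fun x => 1 - sin_coord L x j).
  have [s hs] := trigpolyD (trigpoly_cst 1) (trigpolyM (trigpoly_cst (-1)) tp).
  by exists s => x; rewrite -hs/= mulN1r.
elim: N => [|N IH] k /=; first exact: trigpoly_cst.
apply: (@trigpolyD _ _ (fun x => if k is k'.+1 then _ else _)); last exact: trigpolyM.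
by case: k => [|k]; [exact: trigpoly_cst|exact: trigpolyM].
Qed.

Lemma bernstein_weight_prod_sum N (p : 'I_m -> R) :
  \sum_(k : {ffun 'I_m -> 'I_N.+1}) \prod_j bw N (k j) (p j) = 1.
Proof.
rewrite -(bigA_distr_bigA (fun j (k : 'I_N.+1) => bw N k (p j))).
by rewrite big1// => j _; exact: bernstein_sum.
Qed.

Lemma bernstein_weight_prod_var N (p : 'I_m -> R) i : (0 < N)%N ->
  (forall j, 0 <= p j <= 1) ->
  \sum_(k : {ffun 'I_m -> 'I_N.+1}) (\prod_j bw N (k j) (p j)) * ((k i)%:R / N%:R - p i) ^+ 2
  <= N%:R^-1.
Proof.
move=> N0 p01.
pose F j (k : 'I_N.+1) := bw N k (p j) * (if j == i then (k%:R / N%:R - p i) ^+ 2 else 1).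
rewrite (_ : \sum_(k : {ffun _}) _ = \sum_(k : {ffun 'I_m -> 'I_N.+1}) \prod_j F j (k j)).
  rewrite -(bigA_distr_bigA F) (bigD1 i)//= [X in _ * X]big1 ?mulr1.
    by rewrite /F eqxx; exact: bernstein_variance.
  move=> j ji; rewrite -[RHS](bernstein_sum N (p j)); apply: eq_bigr => k _.
  by rewrite /F (negbTE ji) mulr1.
apply: eq_bigr => k _; rewrite /F big_split/=; congr (_ * _).
by rewrite (bigD1 i)//= eqxx big1 ?mulr1// => j /negbTE ->.
Qed.

Lemma bernstein_op_bound f L N M x : (forall y, `|f y| <= M) -> `|bernstein_op f L N x| <= M.
Proof.
move=> fM; apply: le_trans (ler_norm_sum _ _ _) _.
apply: (@le_trans _ _ (M * \sum_(k : {ffun 'I_m -> 'I_N.+1}) \prod_j bw N (k j) (sin_coord L x j)));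
  last by rewrite bernstein_weight_prod_sum mulr1.
rewrite big_distrr/=.
apply: ler_sum => k _; rewrite normrM.
have P0 : 0 <= \prod_j bw N (k j) (sin_coord L x j).
  by apply: prodr_ge0 => j _; rewrite bernstein_weight_ge0// sin_coord01.
by rewrite (ger0_norm P0) ler_wpM2r.
Qed.

(** Chebyshev's argument: nodes within [del] of [y] cost [e], the others cost [2 M] times the
    squared distance over [del^2]. A coordinate of node minus point is [2 L] times [k / N - p], so
    [8 = 2 * 2^2], and the variance of each coordinate is at most [1 / N]. *)
Lemma bernstein_op_error f L N M e del x : (0 < N)%N -> 0 <= L -> 0 < del ->
  (forall y, `|f y| <= M) ->
  (forall y z : 'rV[R]_m, (forall i, `|y ord0 i| <= L) ->
    (forall i, `|y ord0 i - z ord0 i| <= del) -> `|f y - f z| <= e) ->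
  `|bernstein_op f L N x - f (\row_j (L * sin (L^-1 * x ord0 j)))|
  <= e + 8 * M * L ^+ 2 / del ^+ 2 * (m%:R / N%:R).
Proof.
move=> N0 L0 del0 fM fe; set y := \row_j _.
set p := sin_coord L x.
have p01 j : 0 <= p j <= 1 by exact: sin_coord01.
have M0 : 0 <= M by exact: le_trans (normr_ge0 _) (fM y).
pose w (k : {ffun 'I_m -> 'I_N.+1}) := \prod_j bw N (k j) (p j).
have w0 k : 0 <= w k by apply: prodr_ge0 => j _; rewrite bernstein_weight_ge0.
pose nd (k : {ffun 'I_m -> 'I_N.+1}) : 'rV[R]_m := \row_j (L * (2 * ((k j)%:R / N%:R) - 1)).
have -> : bernstein_op f L N x - f y = \sum_k (f (nd k) - f y) * w k.
  rewrite -[X in _ - X]mulr1 -(bernstein_weight_prod_sum N p) big_distrr/= -sumrB.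
  by apply: eq_bigr => k _; rewrite mulrBl.
have yL i : `|y ord0 i| <= L.
  by rewrite mxE normrM (ger0_norm L0) ler_piMr// sin_max.
have d2 : 0 < del ^+ 2 by rewrite exprn_gt0.
have C0 : 0 <= 2 * M / del ^+ 2 by rewrite divr_ge0 ?mulr_ge0// ltW.
have key k : `|f (nd k) - f y| <= e + 2 * M / del ^+ 2 * \sum_i (nd k ord0 i - y ord0 i) ^+ 2.
  have [near|] := pselect (forall i, `|y ord0 i - nd k ord0 i| <= del).
    rewrite distrC; apply: le_trans (fe _ _ yL near) _; rewrite lerDl mulr_ge0//.
    by apply: sumr_ge0 => i _; exact: sqr_ge0.
  move=> /existsNP[i /negP]; rewrite -ltNge => far.
  have e0 : 0 <= e.
    have := fe y y yL; rewrite subrr normr0; apply => j.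
    by rewrite subrr normr0 ltW.
  apply: le_trans (ler_normB _ _) _; apply: (@le_trans _ _ (0 + 2 * M)).
    by rewrite add0r; have := fM (nd k); have := fM y; lra.
  apply: lerD => //; rewrite -mulrA ler_peMr ?mulr_ge0// mulrC ler_pdivlMr// mul1r.
  rewrite (bigD1 i)//= ler_wpDr//; first by apply: sumr_ge0 => j _; exact: sqr_ge0.
  by rewrite -[leRHS]real_normK ?num_real// distrC ler_sqr ?nnegrE ?(ltW del0)// ltW.
apply: le_trans (ler_norm_sum _ _ _) _.
apply: (@le_trans _ _ (\sum_k (e * w k + 2 * M / del ^+ 2 *
    \sum_i (w k * (nd k ord0 i - y ord0 i) ^+ 2)))).
  apply: ler_sum => k _; rewrite normrM (ger0_norm (w0 k)) -big_distrr/=.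
  apply: le_trans (ler_wpM2r (w0 k) (key k)) _.
  by rewrite le_eqVlt; apply/orP; left; apply/eqP; ring.
rewrite big_split/= -!big_distrr/= bernstein_weight_prod_sum mulr1 lerD2l.
rewrite exchange_big/=.
rewrite (_ : 8 * M * L ^+ 2 / del ^+ 2 * (m%:R / N%:R) =
  2 * M / del ^+ 2 * (\sum_(i < m) (4 * L ^+ 2 * N%:R^-1))); last first.
  by rewrite sumr_const card_ord -mulr_natr; field; rewrite (gt_eqF del0) pnatr_eq0 -lt0n N0.
apply: ler_wpM2l => //; apply: ler_sum => i _.
rewrite (_ : \sum_k _ = 4 * L ^+ 2 * \sum_k (w k * ((k i)%:R / N%:R - p i) ^+ 2)).
  by rewrite ler_wpM2l ?mulr_ge0 ?sqr_ge0// bernstein_weight_prod_var.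
rewrite big_distrr/=; apply: eq_bigr => k _; rewrite !mxE /p /sin_coord; field.
by rewrite pnatr_eq0 -lt0n N0.
Qed.

(** The approximation holds on the cube only, but the bound [M] is preserved everywhere; this is
    what controls the error outside the cube. *)
Lemma trigonometric_approximation f M K e : continuous f -> (forall y, `|f y| <= M) ->
  0 < e -> exists h, [/\ trigpoly h, forall x, `|h x| <= M &
    forall x, (forall i, `|x ord0 i| <= K) -> `|h x - f x| <= e].
Proof.
move=> cf fM e0; have e20 : 0 < e / 3 by rewrite divr_gt0.
have M0 : 0 <= M by exact: le_trans (normr_ge0 _) (fM 0).
have [d1 d10 h1] := box_unif_continuous K cf e20.
(* On the cube [|L sin (x / L) - x| <= x^2 / L <= K^2 / L], which this choice keeps below [d1]. *)
pose L := 1 + K ^+ 2 / d1.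
have L0 : 0 < L by rewrite ltr_pwDl// divr_ge0 ?sqr_ge0// ltW.
have [d2 d20 h2] := box_unif_continuous L cf e20.
pose C := 8 * M * L ^+ 2 / d2 ^+ 2 * m%:R.
pose N := (Num.truncn (C / (e / 3))).+1.
have NC : C / N%:R <= e / 3.
  rewrite ler_pdivrMr ?ltr0n// mulrC -ler_pdivrMr//.
  by rewrite ltW// truncnS_gt.
exists (bernstein_op f L N); split.
- exact: trigpoly_bernstein.
- by move=> x; exact: bernstein_op_bound.
move=> x xK.
have b1 := @bernstein_op_error f L N M (e / 3) d2 x isT (ltW L0) d20 fM h2.
have b2 : `|f x - f (\row_j (L * sin (L^-1 * x ord0 j)))| <= e / 3.
  apply: h1 => // i; rewrite mxE distrC.
  rewrite -[X in _ - X](mulVKf (lt0r_neq0 L0)) -mulrBr normrM (gtr0_norm L0).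
  apply: le_trans (ler_wpM2l (ltW L0) (norm_sinBid_le_sqr _)) _.
  rewrite (_ : L * _ = x ord0 i ^+ 2 / L); last by field; rewrite (gt_eqF L0).
  have xi : x ord0 i ^+ 2 <= K ^+ 2.
    by rewrite -real_normK ?num_real// ler_sqr ?nnegrE// (le_trans _ (xK i)).
  rewrite ler_pdivrMr//; apply: le_trans xi _.
  rewrite /L mulrDr mulr1 mulrCA mulfV ?gt_eqF// mulr1.
  by rewrite lerDr ltW.
move: b1 b2; rewrite mulrA -/C; set A := bernstein_op _ _ _ _; set B := f (\row_j _) => b1 b2.
have := ler_distD B A (f x); rewrite (distrC B); lra.
Qed.

End trigonometric_approximation.

(** * Tail bounds from cosines, and passage to bounded continuous functions *)

Section characteristic_function_transfer.
Context {R : realType}.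

Lemma norm_cos_lower (x : R) : `|x| <= 4^-1 -> x ^+ 2 / 4 <= 1 - cos x.
Proof.
move=> x4; have := norm_cos_taylor2_le x; rewrite ler_norml => /andP[_].
have : `|x| ^+ 3 <= x ^+ 2 / 4.
  by rewrite exprSr real_normK ?num_real// ler_wpM2l ?sqr_ge0.
lra.
Qed.

(** Where [K < |X| <= n + 1], taking [del = 1 / (4 (n + 1))] puts [del X] in the range where
    [1 - cos] is at least a quarter of the square. The factor [del^2] cancels, so the bound is
    uniform in [n] and passes to the limit. *)
Lemma tail_of_cos d (T : measurableType d) (P : probability T R) (X : T -> R) (C K : R) :
  measurable_fun setT X -> 0 < K ->
  (forall del, \int[P]_w (1 - cos (del * X w)) <= C * del ^+ 2) ->
  \int[P]_w \1_[set w | K < `|X w|] w <= 4 * C / K ^+ 2.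
Proof.
move=> mX K0 h.
have mnX : measurable_fun setT (fun w => `|X w|) by exact: measurableT_comp.
have mA (c : R) : measurable [set w | K < `|X w| <= c].
  rewrite (_ : mkset _ = (fun w => `|X w|) @^-1` `]K, c]).
    by rewrite -[X in measurable X]setTI; exact: mnX.
  by apply/seteqP; split => w /=; rewrite in_itv.
have mA' : measurable [set w | K < `|X w|].
  rewrite (_ : mkset _ = (fun w => `|X w|) @^-1` `]K, +oo[).
    by rewrite -[X in measurable X]setTI; exact: mnX.
  by apply/seteqP; split => w /=; rewrite in_itv/= andbT.
have b n : \int[P]_w \1_[set w | K < `|X w| <= n.+1%:R] w <= 4 * C / K ^+ 2.
  pose del : R := (4 * n.+1%:R)^-1.
  have d0 : 0 < del by rewrite invr_gt0 mulr_gt0.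
  have bc : bmeas (fun w => cos (del * X w)).
    have := bmeas_comp (bmeas_cosD del 0) mX.
    by under eq_fun do rewrite addr0.
  have c0 : 0 < del ^+ 2 * K ^+ 2 / 4 by rewrite divr_gt0// mulr_gt0// exprn_gt0.
  rewrite -(ler_pM2l c0) -RintegralZl//; last exact/bmeas_integrable/bmeas_indic.
  rewrite (_ : del ^+ 2 * K ^+ 2 / 4 * (4 * C / K ^+ 2) = C * del ^+ 2); last first.
    by field; rewrite gt_eqF.
  apply: le_trans (h del); apply: le_Rintegral => //.
  - exact/bmeas_integrable/bmeasM/bmeas_indic/mA/bmeas_cst.
  - by apply: integrableB_EFin => //; [exact: bmeas_integrable (bmeas_cst _ _)|exact: bmeas_integrable].
  move=> w _; rewrite indicE; have [|_] := boolP (w \in _); last first.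
    by rewrite mulr0; have := cos_le1 (del * X w); lra.
  rewrite inE/= => /andP[KX Xn]; rewrite mulr1.
  apply: (@le_trans _ _ ((del * X w) ^+ 2 / 4)).
    rewrite exprMn ler_wpM2r// ler_wpM2l ?sqr_ge0// -[leRHS]real_normK ?num_real//.
    by rewrite ler_sqr ?nnegrE ?(ltW K0)// ltW.
  apply: norm_cos_lower; rewrite normrM (gtr0_norm d0) /del invfM -mulrA ler_piMr//.
  by rewrite mulrC ler_pdivrMr// mul1r.
have [] := @Rdominated_cvg R _ _ P setT (fun n w => \1_[set w | K < `|X w| <= n.+1%:R] w)
  (fun w => \1_[set w | K < `|X w|] w) (cst 1) => //.
- by move=> n; exact: measurable_indic.
- exact: measurable_indic.
- apply: aeW => w _; apply: cvg_near_cst; near=> n.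
  rewrite !indicE; congr (_%:R); congr (nat_of_bool _).
  apply/idP/idP; rewrite !inE/=; first by case/andP.
  move=> -> /=.
  near: n; exists (Num.truncn `|X w|) => // n /= hn.
  by rewrite (le_trans (ltW (truncnS_gt _)))// ler_nat ltnS.
- exact: bmeas_integrable (bmeas_cst _ 1).
- by move=> n w _; rewrite indicE; case: (_ \in _); rewrite ?normr1 ?normr0.
move=> _ cv; apply: (@ler_cvg_to _ _ _ _ _ _ _ _ cv (cvg_cst _)).
exact: nearW.
Unshelve. all: by end_near. Qed.

Lemma Rintegral_sum d (T : measurableType d) (mu : {measure set T -> \bar R}) (D : set T)
    (I : Type) (s : seq I) (f : I -> T -> R) : measurable D ->
  (forall i, mu.-integrable D (EFin \o f i)) ->
  mu.-integrable D (EFin \o (fun x => \sum_(i <- s) f i x)) /\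
  \int[mu]_(x in D) (\sum_(i <- s) f i x) = \sum_(i <- s) \int[mu]_(x in D) f i x.
Proof.
move=> mD hf; elim: s => [|i s [IH1 IH2]].
  split.
    by apply: (eq_integrable mD (cst 0%E)) => [x _|]; [rewrite /= big_nil|exact: integrable0].
  rewrite big_nil (@eq_Rintegral _ _ _ _ _ (cst 0)) => [|x _]; last by rewrite big_nil.
  by rewrite (Rintegral_cst mu mD) mul0r.
have e : (fun x => \sum_(j <- i :: s) f j x) = (fun x => f i x + \sum_(j <- s) f j x).
  by apply/funext => x; rewrite big_cons.
rewrite e; split; first exact: integrableD_EFin.
by rewrite RintegralD// IH2 big_cons.
Qed.

Lemma trigpoly_comp_bmeas m d (T : measurableType d) (X : 'I_m -> T -> R) (h : 'rV[R]_m -> R) :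
  (forall i, measurable_fun setT (X i)) -> trigpoly h ->
  bmeas (fun w => h (\row_i X i w)).
Proof.
move=> mX [s hs].
rewrite (_ : (fun w => _) = (fun w => \sum_(p <- s) p.1.1 * cos (\sum_i p.1.2 i * X i w + p.2))); last first.
  apply/funext => w; rewrite hs /trig_sum; apply: eq_bigr => p _.
  by congr (_ * cos (_ + _)); apply: eq_bigr => i _; rewrite mxE.
elim: s {hs} => [|p s IH].
  by under eq_fun do rewrite big_nil; exact: bmeas_cst.
under eq_fun do rewrite big_cons; apply: bmeasD => //; apply: bmeasM; first exact: bmeas_cst.
have mS : measurable_fun setT (fun w => \sum_i p.1.2 i * X i w).
  by apply: measurable_sum => i; exact: measurable_funM.
have := bmeas_comp (bmeas_cosD 1 p.2) mS.
by under eq_fun do rewrite mul1r.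
Qed.

(** Measurability comes from a pointwise limit of trigonometric polynomials on growing cubes, so it
    rests on the measurability of the coordinates alone. *)
Lemma continuous_comp_bmeas m d (T : measurableType d) (X : 'I_m -> T -> R) (f : 'rV[R]_m -> R) (M : R) :
  (forall i, measurable_fun setT (X i)) -> continuous f -> (forall x, `|f x| <= M) ->
  bmeas (fun w => f (\row_i X i w)).
Proof.
move=> mX cf fM; split; last by exists M.
have /choice[h hP] (n : nat) : exists h : 'rV[R]_m -> R, [/\ trigpoly h, forall x, `|h x| <= M &
    forall x : 'rV[R]_m, (forall i, `|x ord0 i| <= n%:R) -> `|h x - f x| <= n.+1%:R^-1].
  by apply: trigonometric_approximation => //; rewrite invr_gt0.
apply: (@measurable_fun_cvg _ _ _ _ (fun n w => h n (\row_i X i w))).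
- by move=> n; have [/(trigpoly_comp_bmeas mX)[]] := hP n.
- move=> w _; apply/cvgrPdist_le => e e0; near=> n.
  have [_ _ H] := hP n; rewrite distrC.
  apply: le_trans (H _ _) _.
    move=> i; rewrite mxE.
    apply: (@le_trans _ _ (\sum_j `|X j w|)); first by rewrite (bigD1 i)//= lerDl sumr_ge0.
    near: n; exists (Num.truncn (\sum_j `|X j w|)).+1 => // n /= hn.
    by rewrite (le_trans (ltW (truncnS_gt _)))// ler_nat.
  near: n; exists (Num.truncn e^-1) => // n /= hn.
  rewrite invf_ple ?posrE// (le_trans (ltW (truncnS_gt _)))// ler_nat ltnS//.
Unshelve. all: by end_near. Qed.

(* A tail bound that needs no second moment: it only involves bounded functions of [X]. *)
Definition cos_tail d (T : measurableType d) (P : probability T R) (C : R) (X : T -> R) :=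
  forall del, \int[P]_w (1 - cos (del * X w)) <= C * del ^+ 2.

(** The error is [e] inside the cube and at most [2 M] outside, where at least one of the [m]
    coordinate tails is charged. *)
Lemma trig_approx_expectation m d (T : measurableType d) (P : probability T R)
    (X : 'I_m -> T -> R) (f h : 'rV[R]_m -> R) (M C K e : R) :
  (forall i, measurable_fun setT (X i)) -> continuous f -> (forall x, `|f x| <= M) ->
  trigpoly h -> (forall x, `|h x| <= M) -> 0 < K -> 0 <= e ->
  (forall x : 'rV[R]_m, (forall i, `|x ord0 i| <= K) -> `|h x - f x| <= e) ->
  (forall i, cos_tail P C (X i)) ->
  `|\int[P]_w f (\row_i X i w) - \int[P]_w h (\row_i X i w)|
  <= e + 2 * M * (m%:R * (4 * C / K ^+ 2)).
Proof.
move=> mX cf fM th hM K0 e0 hf hC.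
have M0 : 0 <= M by exact: le_trans (normr_ge0 _) (fM 0).
have bf := continuous_comp_bmeas mX cf fM.
have bh := trigpoly_comp_bmeas mX th.
have mA i : measurable [set w | K < `|X i w|].
  rewrite (_ : mkset _ = (fun w => `|X i w|) @^-1` `]K, +oo[).
    rewrite -[X in measurable X]setTI.
    by have : measurable_fun setT (fun w => `|X i w|) by [exact: measurableT_comp]; apply.
  by apply/seteqP; split => w /=; rewrite in_itv/= andbT.
pose S w : R := \sum_(i < m) \1_[set w | K < `|X i w|] w.
have bI i : bmeas (\1_[set w | K < `|X i w|] : T -> R) by exact: bmeas_indic.
have [iS IS] : P.-integrable setT (EFin \o S) /\ _ := Rintegral_sum (index_enum 'I_m) measurableT
  (fun i => bmeas_integrable P (bI i)).
apply: (@le_trans _ _ (\int[P]_w (e + 2 * M * S w))).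
  apply: Rintegral_dist_le; try exact: bmeas_integrable.
    by apply: integrableD_EFin => //; [exact: bmeas_integrable (bmeas_cst _ _)|exact: integrableZl_EFin].
  move=> w; have [near|] := pselect (forall i, `|X i w| <= K).
    rewrite distrC; apply: le_trans (hf _ _) _; first by move=> i; rewrite mxE.
    by rewrite lerDl mulr_ge0 ?mulr_ge0// sumr_ge0.
  move=> /existsNP[i /negP]; rewrite -ltNge => far.
  apply: le_trans (ler_normB _ _) _.
  apply: (@le_trans _ _ (0 + 2 * M * 1)).
    by have := fM (\row_i X i w); have := hM (\row_i X i w); lra.
  rewrite lerD// ler_wpM2l ?mulr_ge0// /S (bigD1 i)//= indicE mem_set// lerDl.
  by rewrite sumr_ge0.
rewrite RintegralD//; last 2 first.
- exact: bmeas_integrable (bmeas_cst _ _).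
- exact: integrableZl_EFin.
rewrite (Rintegral_prob_cst P) RintegralZl// lerD2l ler_wpM2l ?mulr_ge0//.
have -> : m%:R * (4 * C / K ^+ 2) = \sum_(i < m) (4 * C / K ^+ 2).
  by rewrite sumr_const card_ord mulr_natl.
rewrite IS.
by apply: ler_sum => i _; exact: (tail_of_cos (mX i) K0 (hC i)).
Qed.

Lemma cvg_sumr (I : Type) (s : seq I) (u : I -> nat -> R) (l : I -> R) :
  (forall i, u i n @[n --> \oo] --> l i) ->
  (\sum_(i <- s) u i n) @[n --> \oo] --> \sum_(i <- s) l i.
Proof.
move=> h; elim: s => [|i s IH].
  by rewrite big_nil; under eq_fun do rewrite big_nil; exact: cvg_cst.
by rewrite big_cons; under eq_fun do rewrite big_cons; exact: cvgD.
Qed.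

(** The common tail constant [C] plays the role of tightness: one cube and one trigonometric
    polynomial serve for all large [n] and for the limit, and for that polynomial convergence is a
    finite sum of the hypotheses. *)
Lemma fdd_transfer m d' (T' : measurableType d') (Q : probability T' R) (U : 'I_m -> T' -> R)
    (d : nat -> measure_display) (T : forall n, measurableType (d n))
    (P : forall n, probability (T n) R) (X : forall n, 'I_m -> T n -> R) (C : R) :
  (forall n i, measurable_fun setT (X n i)) -> (forall i, measurable_fun setT (U i)) ->
  (forall (c : 'I_m -> R) phi,
    \int[P n]_w cos (\sum_i c i * X n i w + phi) @[n --> \oo] -->
    \int[Q]_w cos (\sum_i c i * U i w + phi)) ->
  (\forall n \near \oo, forall i, cos_tail (P n) C (X n i)) ->
  (forall i, cos_tail Q C (U i)) ->
  forall f : 'rV[R]_m -> R, continuous f -> (exists M : R, forall x, `|f x| <= M) ->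
  ('E_(P n)[fun w => f (\row_i X n i w)])%E @[n --> \oo] --> ('E_Q[fun w => f (\row_i U i w)])%E.
Proof.
move=> mX mU hcos hX hU f cf [M fM].
have M0 : 0 <= M by exact: le_trans (normr_ge0 _) (fM 0).
have bX n := continuous_comp_bmeas (mX n) cf fM.
have bU := continuous_comp_bmeas mU cf fM.
have E d1 (T1 : measurableType d1) (P1 : probability T1 R) (g : T1 -> R) : bmeas g ->
    ('E_P1[g] = (\int[P1]_w g w)%:E)%E.
  by move=> bg; rewrite unlock /Rintegral fineK//; apply: integrable_fin_num => //; exact: bmeas_integrable.
rewrite (E _ _ _ _ bU); under eq_fun do rewrite (E _ _ _ _ (bX _)).
apply: cvg_EFin; first exact: nearW.
apply/cvgrPdist_le => e e0.
pose D := 2 * M * (m%:R * (4 * `|C|)).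
have D0 : 0 <= D by rewrite !mulr_ge0.
(* The summand 1 gives [K <= K^2], so that [D / K^2] is at most [D / K], hence at most [e / 8]. *)
pose K := 1 + D / (e / 8).
have K1 : 1 <= K by rewrite lerDl divr_ge0// divr_ge0// ltW.
have K0 : 0 < K by exact: lt_le_trans K1.
have e40 : 0 < e / 8 by rewrite divr_gt0.
have DK : D / K ^+ 2 <= e / 8.
  rewrite ler_pdivrMr ?exprn_gt0//; apply: (@le_trans _ _ (e / 8 * K)).
    by rewrite /K mulrDr mulr1 mulrCA mulfV ?gt_eqF// mulr1 lerDr ltW.
  by rewrite ler_wpM2l ?(ltW e40)// expr2 ler_peMl// ltW.
have [h [th hM hf]] := trigonometric_approximation K cf fM e40.
have B d1 (T1 : measurableType d1) (P1 : probability T1 R) (Y : 'I_m -> T1 -> R) :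
    (forall i, measurable_fun setT (Y i)) -> (forall i, cos_tail P1 C (Y i)) ->
    `|\int[P1]_w f (\row_i Y i w) - \int[P1]_w h (\row_i Y i w)| <= e / 4.
  move=> mY hY; apply: le_trans (trig_approx_expectation mY cf fM th hM K0 (ltW e40) hf hY) _.
  apply: (@le_trans _ _ (e / 8 + D / K ^+ 2)); last by lra.
  rewrite lerD2l /D -!mulrA ler_wpM2l// ler_wpM2l// ler_wpM2l// ler_wpM2l//.
  by rewrite ler_wpM2r ?invr_ge0 ?sqr_ge0// ler_norm.
have hh : \int[P n]_w h (\row_i X n i w) @[n --> \oo] --> \int[Q]_w h (\row_i U i w).
  have [s hs] := th.
  have hE d1 (T1 : measurableType d1) (P1 : probability T1 R) (Y : 'I_m -> T1 -> R) :
      (forall i, measurable_fun setT (Y i)) ->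
      \int[P1]_w h (\row_i Y i w) =
      \sum_(p <- s) p.1.1 * \int[P1]_w cos (\sum_i p.1.2 i * Y i w + p.2).
    move=> mY.
    have bc (p : R * ('I_m -> R) * R) : bmeas (fun w => cos (\sum_i p.1.2 i * Y i w + p.2)).
      have mS : measurable_fun setT (fun w => \sum_i p.1.2 i * Y i w).
        by apply: measurable_sum => i; exact: measurable_funM.
      have := bmeas_comp (bmeas_cosD 1 p.2) mS.
      by under eq_fun do rewrite mul1r.
    have := Rintegral_sum s measurableT (fun p => bmeas_integrable P1 (bmeasM (bmeas_cst _ p.1.1) (bc p))).
    move=> [_ e1]; transitivity (\sum_(p <- s) \int[P1]_w (p.1.1 * cos (\sum_i p.1.2 i * Y i w + p.2))).
      rewrite -e1; apply: eq_Rintegral => w _; rewrite hs /trig_sum; apply: eq_bigr => p _.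
      by congr (_ * cos (_ + _)); apply: eq_bigr => i _; rewrite mxE.
    by apply: eq_bigr => p _; rewrite RintegralZl//; exact: bmeas_integrable.
  rewrite (hE _ _ _ _ mU); under eq_fun do rewrite (hE _ _ _ _ (mX _)).
  by apply: cvg_sumr => p; apply: cvgMr; exact: hcos.
have e20 : 0 < e / 4 by rewrite divr_gt0.
move/cvgrPdist_le/(_ _ e20) : hh => hh.
near=> n.
have h1 := B _ _ _ _ mU hU.
have hXn : forall i, cos_tail (P n) C (X n i) by near: n.
have h2 := B _ _ _ _ (mX n) hXn.
have h3 : `|\int[Q]_w h (\row_i U i w) - \int[P n]_w h (\row_i X n i w)| <= e / 4 by near: n.
move: h1 h2 h3; set a := \int[Q]_w f _; set b := \int[Q]_w h _; set c := \int[P n]_w f _.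
set g := \int[P n]_w h _ => h1 h2 h3.
have := ler_distD b a c; have := ler_distD g b c; rewrite (distrC g c); lra.
Unshelve. all: by end_near. Qed.

End characteristic_function_transfer.

(** * Moments of tapered Pareto variables *)

Section almost_everywhere_Rintegral.
Context {R : realType} d (T : measurableType d) (P : {measure set T -> \bar R}).
Implicit Types f g : T -> R.

Lemma ae_le_Rintegral f g : P.-integrable setT (EFin \o f) ->
  P.-integrable setT (EFin \o g) -> {ae P, forall x, f x <= g x} ->
  \int[P]_x f x <= \int[P]_x g x.
Proof.
move=> intf intg fg; rewrite -subr_ge0 -RintegralB//.
have igf := integrableB_EFin measurableT intg intf.
have mgf : measurable_fun setT (fun x => g x - f x).
  by apply/measurable_EFinP; exact: measurable_int igf.
rewrite /Rintegral (@ae_eq_integral _ _ _ P setT (EFin \o (fun x => Num.max 0 (g x - f x)))).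
- by apply: fine_ge0; apply: integral_ge0 => x _; rewrite lee_fin le_max lexx.
- by [].
- exact: measurable_int igf.
- by apply/measurable_EFinP; exact: measurable_maxr.
- by apply: filterS fg => x h _ /=; rewrite max_r// subr_ge0.
Qed.

Lemma ae_le_integrable f g : measurable_fun setT f -> P.-integrable setT (EFin \o g) ->
  {ae P, forall x, `|f x| <= g x} -> P.-integrable setT (EFin \o f).
Proof.
move=> mf intg fg; apply/integrableP; split; first exact/measurable_EFinP.
apply: le_lt_trans (_ : (\int[P]_x `|(g x)%:E| < +oo)%E); last by case/integrableP : intg.
apply: ae_ge0_le_integral => //.
- by apply/measurable_EFinP; exact: measurableT_comp.
- by apply: measurableT_comp => //; exact: measurable_int intg.
- by apply: filterS fg => x h _ /=; rewrite lee_fin (le_trans h)// ler_norm.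
Qed.

End almost_everywhere_Rintegral.

Section same_law.
Context {R : realType} d (T : measurableType d) (P : probability T R)
  d' (T' : measurableType d') (P' : probability T' R) (X : T -> R) (Y : T' -> R).
Hypotheses (mX : measurable_fun setT X) (mY : measurable_fun setT Y).
Hypothesis XY : forall A, measurable A -> P (X @^-1` A) = P' (Y @^-1` A).

Lemma same_law_integral (f : R -> R) : measurable_fun setT f -> (forall x, 0 <= f x) ->
  (\int[P]_w (f (X w))%:E = \int[P']_w (f (Y w))%:E)%E.
Proof.
move=> mf f0.
have h A : measurable A ->
    (\int[P]_(x in X @^-1` A) (cst 1 x)%:E = \int[P']_(x in Y @^-1` A) (cst 1 x)%:E)%E.
  move=> mA; have mXA : measurable (X @^-1` A) by rewrite -[X in measurable X]setTI; exact: mX.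
  have mYA : measurable (Y @^-1` A) by rewrite -[X in measurable X]setTI; exact: mY.
  rewrite [LHS](etrans (integral_cst P mXA 1%:E) (mul1e _)).
  rewrite [RHS](etrans (integral_cst P' mYA 1%:E) (mul1e _)); exact: XY.
have := @eq_integral_density _ _ _ _ _ P P' X (cst 1) Y (cst 1) mX (measurable_cst _) (fun=> ler01)
  mY (measurable_cst _) (fun=> ler01) h f mf f0.
by under eq_integral do rewrite /= mul1r; under [RHS]eq_integral do rewrite /= mul1r.
Qed.

Lemma same_law_integrable (f : R -> R) : measurable_fun setT f ->
  P'.-integrable setT (EFin \o (f \o Y)) -> P.-integrable setT (EFin \o (f \o X)).
Proof.
move=> mf /integrableP[_ h]; apply/integrableP; split.
  by apply/measurable_EFinP; exact: measurableT_comp.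
have mn : measurable_fun setT (fun x => `|f x|) by exact: measurableT_comp.
by have := same_law_integral mn (fun=> normr_ge0 _); rewrite /= => ->.
Qed.

Lemma same_law_Rintegral (f : R -> R) : measurable_fun setT f ->
  P'.-integrable setT (EFin \o (f \o Y)) -> \int[P]_w f (X w) = \int[P']_w f (Y w).
Proof.
move=> mf iY; have iX := same_law_integrable mf iY.
have mn : measurable_fun setT (fun x => `|f x|) by exact: measurableT_comp.
have niX : P.-integrable setT (EFin \o (fun w => `|f (X w)|)) by exact: integrable_norm iX.
have niY : P'.-integrable setT (EFin \o (fun w => `|f (Y w)|)) by exact: integrable_norm iY.
have h1 : \int[P]_w `|f (X w)| = \int[P']_w `|f (Y w)|.
  by rewrite /Rintegral (same_law_integral mn).
have h2 : \int[P]_w (f (X w) + `|f (X w)|) = \int[P']_w (f (Y w) + `|f (Y w)|).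
  rewrite /Rintegral (same_law_integral (f := fun x => f x + `|f x|))//.
    exact: measurable_funD.
  by move=> x; have := ler_norm (- f x); rewrite normrN; lra.
by move: h2; rewrite !RintegralD// h1 => /addIr.
Qed.

End same_law.

(** * The Pareto and exponential laws *)

Section pareto_exponential.
Context {R : realType} d (T : measurableType d) (P : probability T R).
Variables (alpha : R) (theta E : {RV P >-> R}).
Hypothesis alpha_gt0 : 0 < alpha.
Hypothesis htheta : standard_pareto alpha theta.
Hypothesis hE : standard_exponential E.
Hypothesis hind : independent2 theta E.

Local Notation mtheta := (measurable_funPTI theta).

Lemma pareto_ge1 : {ae P, forall w, 1 <= theta w}.
Proof.
exists (theta @^-1` `]-oo, 1[); split.
- exact: measurable_funPTI.
- have := htheta (measurable_itv `]-oo, 1[); rewrite /distribution /pushforward => ->.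
  apply: integral0_eq => x /=; rewrite in_itv/= => x1.
  by rewrite /pareto_pdf leNgt x1.
- by move=> w /=; rewrite in_itv/= => /negP; rewrite -ltNge.
Qed.

Lemma exponential_ge0 : {ae P, forall w, 0 <= E w}.
Proof.
exists (E @^-1` `]-oo, 0[); split.
- exact: measurable_funPTI.
- have := hE (measurable_itv `]-oo, 0[); rewrite /distribution /pushforward => ->.
  apply: integral0_eq => x /=; rewrite in_itv/= => x1.
  by rewrite lt0_exponential_pdf.
- by move=> w /=; rewrite in_itv/= => /negP; rewrite -ltNge.
Qed.

Definition pareto_tail (b : R) := fine (P (theta @^-1` `[b, +oo[)).

(** On [b, 2 b], an interval of length [b], the density is at least its value at [2 b]; this
    explains the power of 2. *)
Lemma pareto_tail_lower (b : R) : 1 <= b ->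
  alpha * 2 `^ (- alpha - 1) * b `^ (- alpha) <= pareto_tail b.
Proof.
move=> b1; have b0 : 0 < b by exact: lt_le_trans b1.
rewrite -lee_fin fineK; last by apply: fin_num_measure; exact: measurable_funPTI.
apply: (@le_trans _ _ (P (theta @^-1` `[b, (2 * b)%R]))); last first.
  apply: le_measure; rewrite ?inE; try exact: measurable_funPTI.
  by move=> w /=; rewrite !in_itv/= andbT => /andP[].
have := htheta (measurable_itv `[b, 2 * b]); rewrite /distribution /pushforward => ->.
apply: (@le_trans _ _ (\int[lebesgue_measure]_(x in `[b, (2 * b)%R]) (alpha * (2 * b) `^ (- alpha - 1))%:E)%E).
  rewrite integral_cst//= lebesgue_measure_itv/= lte_fin ltr_pMl// ltr1n.
  rewrite -EFinB -EFinM lee_fin (_ : 2 * b - b = b); last by ring.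
  have -> : b `^ (- alpha) = b `^ (- alpha - 1) * b.
    rewrite -[X in _ = _ * X]powRr1 ?(ltW b0)// -powRD ?subrK//.
    by rewrite (gt_eqF b0) implybT.
  by rewrite powRM ?(ltW b0)// -!mulrA.
apply: ge0_le_integral => //.
- by move=> x _; rewrite lee_fin mulr_ge0 ?powR_ge0// ltW.
- apply/measurable_EFinP; apply: measurable_funTS; apply: measurable_fun_ifT => //.
  + exact: measurable_fun_ler.
  + by apply: measurable_funM => //; exact: measurable_powR.
- move=> x /=; rewrite in_itv/= => /andP[bx x2b].
  have x1 : 1 <= x by exact: le_trans bx.
  rewrite /pareto_pdf x1 lee_fin ler_wpM2l ?(ltW alpha_gt0)//.
  have xp : 0 < x by exact: lt_le_trans x1.
  rewrite -opprD !powRN lef_pV2 ?posrE ?powR_gt0 ?mulr_gt0//.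
  by rewrite ge0_ler_powR ?nnegrE ?addr_ge0 ?(ltW alpha_gt0) ?(ltW xp) ?mulr_ge0 ?(ltW b0).
Qed.

Lemma pareto_tail_small : exists2 x0 : R, 0 < x0 & forall x, x0 <= x -> pareto_tail x <= 8^-1.
Proof.
have e8 : 0 < 8^-1 :> R by rewrite invr_gt0.
have /fine_cvgP[_ /cvgrPdist_lt/(_ _ e8)[M [_ hM]]] := cvg_ccdfy0 theta.
exists (`|M| + 2) => [|x hx]; first by rewrite ltr_wpDl.
have := hM (x - 1) _; rewrite /= sub0r normrN => h.
have {h} : `|fine (ccdf theta (x - 1))| < 8^-1 by apply: h; have := ler_norm M; lra.
have -> : ccdf theta (x - 1) = P (theta @^-1` `]x - 1, +oo[) by [].
move=> /ltW; apply: le_trans; rewrite ger0_norm ?fine_ge0//.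
apply: fine_le; try by apply: fin_num_measure; exact: measurable_funPTI.
apply: le_measure; rewrite ?inE; try exact: measurable_funPTI.
by move=> w /=; rewrite !in_itv/= !andbT; lra.
Qed.

Lemma integrable_exponential_cube : P.-integrable setT (EFin \o (fun w => `|E w| ^+ 3)).
Proof.
apply/integrableP; split.
  by apply/measurable_EFinP/measurable_funX/measurableT_comp.
have mf : measurable_fun setT (fun x : R => `|x| ^+ 3) by apply: (measurable_funX 3); exact: normr_measurable.
have h A : measurable A -> (\int[P]_(x in E @^-1` A) (cst 1 x)%:E =
    \int[lebesgue_measure]_(x in A) (exponential_pdf 1 x)%:E)%E.
  move=> mA; have mEA : measurable (E @^-1` A) by exact: measurable_funPTI.
  by rewrite [LHS](etrans (integral_cst P mEA 1%:E) (mul1e _)) -[RHS]hE.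
have := @eq_integral_density _ _ _ _ _ P (@lebesgue_measure R) E (cst 1) idfun (exponential_pdf 1)
  (measurable_funPT E) (measurable_cst _) (fun=> ler01) (@measurable_id _ _ setT)
  (measurable_exponential_pdf 1) (fun x => exponential_pdf_ge0 ler01 x) h _ mf.
under eq_integral do rewrite /= mul1r.
move=> e; under eq_integral do rewrite /= normrX normr_id.
rewrite e; last by move=> x; rewrite exprn_ge0.
(* With [y = x / 2], [y^3 / 6 <= expR y] gives [x^3 <= 48 expR (x / 2)], so half of the rate absorbs
   the cube; 96 is 48 divided by the rate [2^-1] appearing in the density. *)
apply: le_lt_trans (_ : (\int[lebesgue_measure]_x (96%:E * (exponential_pdf 2^-1 x)%:E) < +oo)%E).
  apply: ge0_le_integral => //.
  - move=> x _; rewrite lee_fin mulr_ge0// exponential_pdf_ge0//.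
  - apply/measurable_EFinP/measurable_funM => //; exact: measurable_exponential_pdf.
  - apply/measurable_EFinP/measurable_funM => //; exact: measurable_exponential_pdf.
  move=> x _; rewrite -EFinM lee_fin; have [x0|x0] := leP 0 x; last first.
    by rewrite !lt0_exponential_pdf// mul0r mulr0.
  rewrite !exponential_pdfE//= /idfun ger0_norm// mul1r.
  have x20 : 0 <= x / 2 by rewrite divr_ge0.
  have := expR_ge1Dxn 2 x20; rewrite (_ : 3`!%:R = 6 :> R)//.
  rewrite (_ : - 1 * x = - (x / 2) - (x / 2)); last by field.
  rewrite (_ : - 2^-1 * x = - (x / 2)); last by field.
  rewrite expRD -mulrA => hx.
  have -> : 96 * (2^-1 * expR (- (x / 2))) = expR (- (x / 2)) * 48 by field.
  rewrite ler_wpM2l ?expR_ge0// expRN mulrC ler_pdivrMr ?expR_gt0//.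
  move: hx; rewrite (_ : 1 + (x / 2) ^+ 3 / 6 = 1 + x ^+ 3 / 48); last by field.
  lra.
rewrite ge0_integralZl//.
- by rewrite integral_exponential_pdf// mule1 ltry.
- by apply/measurable_EFinP; exact: measurable_exponential_pdf.
- by move=> x _; rewrite lee_fin exponential_pdf_ge0.
Qed.

Lemma independent_tail_exponential (b : R) (f : R -> R) : measurable_fun setT f ->
  (forall x, 0 <= f x) -> P.-integrable setT (EFin \o (f \o E)) ->
  \int[P]_w (\1_(theta @^-1` `[b, +oo[) w * f (E w)) = pareto_tail b * \int[P]_w f (E w).
Proof.
move=> mf f0 iE.
have mB : measurable (theta @^-1` `[b, +oo[) by exact: measurable_funPTI.
rewrite -RintegralZl//; rewrite /Rintegral.
rewrite (@eq_integral_density R _ _ T T P P E (\1_(theta @^-1` `[b, +oo[)) E (cst (pareto_tail b)))//.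
- by move=> x; exact: fine_ge0.
move=> A mA; have mEA : measurable (E @^-1` A) by exact: measurable_funPTI.
transitivity ((pareto_tail b)%:E * P (E @^-1` A))%E; last exact: (esym (integral_cst P mEA (pareto_tail b)%:E)).
rewrite integral_indic// /pareto_tail fineK; last exact: fin_num_measure.
by apply: hind => //; exact: measurable_itv.
Qed.

End pareto_exponential.

Section tapered_pareto_moments.
Context {R : realType} d (T : measurableType d) (P : probability T R).
Variables (alpha : R) (theta E : {RV P >-> R}).
Hypothesis alpha_gt0 : 0 < alpha.
Hypothesis htheta : standard_pareto alpha theta.
Hypothesis hE : standard_exponential E.
Hypothesis hind : independent2 theta E.

Local Notation B b := (theta @^-1` `[b, +oo[).
Local Notation q b := (pareto_tail theta b).
Local Notation xi b := (tapered_pareto P theta E b).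
Local Notation zet b := (zeta theta E b).

Lemma measurable_zeta b : measurable_fun setT (zet b).
Proof.
apply: measurable_fun_ifT => //; first exact: measurable_fun_ltr.
exact: measurable_funD.
Qed.

Lemma measurable_tapered_pareto b : measurable_fun setT (xi b).
Proof. by apply: measurable_funB => //; exact: measurable_zeta. Qed.

Let mB b : measurable (B b). Proof. exact: measurable_funPTI. Qed.

Let iE3 b : P.-integrable setT (EFin \o (fun w => (b + `|E w|) ^+ 3)).
Proof.
have iE3 := integrable_exponential_cube hE.
have : P.-integrable setT (EFin \o (fun w => 4 * `|b| ^+ 3 + 4 * `|E w| ^+ 3)).
  by apply: integrableD_EFin => //; [exact: bmeas_integrable (bmeas_cst _ _)|exact: integrableZl_EFin].
apply: le_integrable => //.
  apply/measurable_EFinP; apply: measurable_funX; apply: measurable_funD => //.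
  exact: measurableT_comp.
move=> w _; rewrite lee_fin [leRHS]ger0_norm ?addr_ge0 ?mulr_ge0 ?exprn_ge0// normrX.
apply: (@le_trans _ _ ((`|b| + `|E w|) ^+ 3)).
  rewrite ler_pXn2r ?nnegrE ?addr_ge0// (le_trans (ler_normD _ _))// normr_id//.
have := normr_ge0 b; have := normr_ge0 (E w); set x := `|b|; set y := `|E w| => y0 x0.
have : 0 <= (x + y) * (x - y) ^+ 2 by rewrite mulr_ge0 ?addr_ge0 ?sqr_ge0.
rewrite (_ : (x + y) * (x - y) ^+ 2 = x ^+ 3 + y ^+ 3 - x ^+ 2 * y - x * y ^+ 2); last by ring.
rewrite (_ : (x + y) ^+ 3 = x ^+ 3 + y ^+ 3 + 3 * (x ^+ 2 * y + x * y ^+ 2)); last by ring.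
lra.
Qed.

Let iE : P.-integrable setT (EFin \o (fun w => `|E w|)).
Proof.
apply: le_integrable (iE3 1) => //; first by apply/measurable_EFinP; exact: measurableT_comp.
move=> w _; rewrite lee_fin normr_id ger0_norm ?exprn_ge0 ?addr_ge0//.
have := normr_ge0 (E w); set y := `|E w| => y0.
rewrite (_ : (1 + y) ^+ 3 = 1 + 3 * y + 3 * y ^+ 2 + y ^+ 3); last by ring.
have := sqr_ge0 y; have : 0 <= y ^+ 3 by exact: exprn_ge0.
lra.
Qed.

Let bB b : bmeas (\1_(B b) : T -> R). Proof. exact: bmeas_indic. Qed.

Let EB b : \int[P]_w \1_(B b) w = q b.
Proof. by rewrite /Rintegral integral_indic// setIT. Qed.

Let good : {ae P, forall w, 1 <= theta w /\ 0 <= E w}.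
Proof.
have h1 := pareto_ge1 htheta; have h2 := exponential_ge0 hE.
by apply: filterS2 h1 h2.
Qed.

Lemma zeta_bound b : 1 <= b -> {ae P, forall w, 0 <= zet b w <= b + `|E w|}.
Proof.
move=> b1; apply: filterS good => w [t1 E0]; rewrite /zeta; case: ltP => tb.
  by rewrite (le_trans ler01 t1)/= (le_trans (ltW tb))// lerDl.
by rewrite ger0_norm// lexx andbT addr_ge0// (le_trans ler01).
Qed.

Let izet b : 1 <= b -> P.-integrable setT (EFin \o zet b).
Proof.
move=> b1; apply: (@ae_le_integrable _ _ _ _ _ (fun w => b + `|E w|)).
- exact: measurable_zeta.
- by apply: integrableD_EFin => //; exact: bmeas_integrable (bmeas_cst _ _).
- by apply: filterS (zeta_bound b1) => w /andP[z0 zb]; rewrite ger0_norm.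
Qed.

Definition zeta_mean b := fine ('E_P[zet b])%E.

Let mE b : zeta_mean b = \int[P]_w zet b w.
Proof. by rewrite /zeta_mean unlock. Qed.

(** After centering, at least [b / 2] then remains on the event [theta >= b], which bounds the
    variance below. The crude bound [zeta <= b / 8 + b 1[theta >= b / 8] + |E|] treats all [alpha]
    at once, whether or not [theta] has a mean; the three terms contribute at most [b / 8], [b / 8]
    and [b / 4]. *)
Lemma zeta_mean_bound : exists2 b0 : R, 1 <= b0 & forall b, b0 <= b -> 0 <= zeta_mean b <= b / 2.
Proof.
have [x0 x00 hx] := pareto_tail_small theta.
pose e1 := \int[P]_w `|E w|.
have e10 : 0 <= e1 by exact: Rintegral_ge0.
exists (1 + 8 * x0 + 4 * e1) => [|b hb]; first by rewrite -addrA lerDl addr_ge0// mulr_ge0// ltW.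
have b1 : 1 <= b by lra.
rewrite mE; apply/andP; split.
  rewrite -[leLHS](Rintegral_prob_cst P 0); apply: ae_le_Rintegral.
  - exact: bmeas_integrable (bmeas_cst _ _).
  - exact: izet.
  - by apply: filterS (zeta_bound b1) => w /andP[].
apply: (@le_trans _ _ (\int[P]_w (b / 8 + (b * \1_(B (b / 8)) w + `|E w|)))).
  apply: ae_le_Rintegral; first exact: izet.
    apply: integrableD_EFin => //; first exact: bmeas_integrable (bmeas_cst _ _).
    by apply: integrableD_EFin => //; apply: integrableZl_EFin => //; exact: bmeas_integrable.
  apply: filterS good => w [t1 E0]; rewrite /zeta indicE.
  have [|] := boolP (w \in _).
    rewrite inE/= in_itv/= andbT => t8; rewrite mulr1; case: ltP => tb; rewrite ger0_norm//; lra.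
  rewrite notin_setE/= in_itv/= andbT => /negP; rewrite -ltNge => t8.
  by rewrite mulr0 add0r; case: ltP => tb; rewrite ger0_norm//; lra.
rewrite RintegralD//; [|exact: bmeas_integrable (bmeas_cst _ _)|]; last first.
  by apply: integrableD_EFin => //; apply: integrableZl_EFin => //; exact: bmeas_integrable.
rewrite RintegralD//; last by apply: integrableZl_EFin => //; exact: bmeas_integrable.
rewrite (RintegralZl _ measurableT (bmeas_integrable P (bB _))).
rewrite (Rintegral_prob_cst P (b / 8)) EB -/e1.
have := hx (b / 8); have -> : x0 <= b / 8 by lra.
move=> /(_ isT) qb.
have : b * q (b / 8) <= b * 8^-1 by rewrite ler_wpM2l//; lra.
lra.
Qed.

(* The third moment is at most [b] times the variance, and the variance is at least
   a multiple of [b^(2 - alpha)] since the value [b + E] has probability of order [b^-alpha]. *)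
Lemma tapered_pareto_moments : exists C b0 : R, 0 < C /\ forall b, b0 <= b ->
  [/\ P.-integrable setT (EFin \o (fun w => xi b w ^+ 2)),
      P.-integrable setT (EFin \o (fun w => `|xi b w| ^+ 3)),
      \int[P]_w xi b w = 0,
      0 < \int[P]_w (xi b w ^+ 2) &
      \int[P]_w (`|xi b w| ^+ 3) <=
        C * b `^ (alpha / 2) * Num.sqrt (\int[P]_w (xi b w ^+ 2)) ^+ 3].
Proof.
have [b0 b01 hm] := zeta_mean_bound.
pose k3 := \int[P]_w ((1 + `|E w|) ^+ 3).
have k30 : 0 <= k3 by apply: Rintegral_ge0 => w _; rewrite exprn_ge0// addr_ge0.
pose c := alpha * 2 `^ (- alpha - 1).
have c0 : 0 < c by rewrite mulr_gt0// powR_gt0.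
exists ((1 + 4 * k3) * 2 / Num.sqrt c), b0; split.
  by rewrite divr_gt0 ?sqrtr_gt0// mulr_gt0// ltr_pwDl// mulr_ge0.
move=> b hb; have b1 : 1 <= b by exact: le_trans hb.
have bp : 0 < b by exact: lt_le_trans b1.
have /andP[m0 mb] := hm b hb.
have xE w : xi b w = zet b w - zeta_mean b by [].
have mxi := measurable_tapered_pareto b.
have xib : {ae P, forall w, `|xi b w| <= b + `|E w|}.
  apply: filterS (zeta_bound b1) => w /andP[z0 zb].
  by rewrite xE ler_norml; apply/andP; split; have := normr_ge0 (E w); lra.
have i3 : P.-integrable setT (EFin \o (fun w => `|xi b w| ^+ 3)).
  apply: (@ae_le_integrable _ _ _ _ _ (fun w => (b + `|E w|) ^+ 3)) => //.
    by apply: measurable_funX; exact: measurableT_comp.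
  apply: filterS xib => w h; rewrite normrX normr_id ler_pXn2r// ?nnegrE// addr_ge0//.
  exact: ltW.
have i2 : P.-integrable setT (EFin \o (fun w => xi b w ^+ 2)).
  have : P.-integrable setT (EFin \o (fun w => 1 + `|xi b w| ^+ 3)).
    by apply: integrableD_EFin => //; exact: bmeas_integrable (bmeas_cst _ _).
  apply: le_integrable => //; first by apply/measurable_EFinP; exact: measurable_funX.
  move=> w _; rewrite lee_fin normrX [leRHS]ger0_norm ?addr_ge0 ?exprn_ge0//.
  set y := `|xi b w|; have y0 : 0 <= y by exact: normr_ge0.
  have [y1|y1] := leP y 1.
    by rewrite (@le_trans _ _ 1)// ?exprn_ile1// lerDl exprn_ge0.
  rewrite (@le_trans _ _ (y ^+ 3))//; last by rewrite lerDr.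
  by rewrite [leRHS]exprSr ler_peMr ?exprn_ge0// ltW.
have E0 : \int[P]_w xi b w = 0.
  transitivity (\int[P]_w (zet b w - cst (zeta_mean b) w)); first exact: eq_Rintegral.
  rewrite RintegralB//; [|exact: izet|exact: bmeas_integrable (bmeas_cst _ _)].
  by rewrite (Rintegral_prob_cst P) mE subrr.
set s2 := \int[P]_w (xi b w ^+ 2).
(* Where [theta >= b] the centered variable is at least [b] minus its mean, hence at least
   [b / 2]. *)
have s2q : b ^+ 2 / 4 * q b <= s2.
  rewrite -EB -RintegralZl//; last exact: bmeas_integrable.
  apply: ae_le_Rintegral => //; first by apply: integrableZl_EFin => //; exact: bmeas_integrable.
  apply: filterS good => w [t1 Ew0]; rewrite indicE; have [|_] := boolP (w \in _); last first.
    by rewrite mulr0 sqr_ge0.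
  rewrite inE/= in_itv/= andbT => bt; rewrite mulr1.
  have -> : b ^+ 2 / 4 = (b / 2) ^+ 2 by field.
  rewrite ler_sqr ?nnegrE ?divr_ge0// ?(ltW bp)//; rewrite xE /zeta ltNge bt/=; lra.
have ql := pareto_tail_lower alpha_gt0 htheta b1; rewrite -/c in ql.
have s2l : b ^+ 2 / 4 * (c * b `^ (- alpha)) <= s2.
  by apply: le_trans s2q; rewrite ler_wpM2l// divr_ge0 ?sqr_ge0.
have s20 : 0 < s2.
  by apply: lt_le_trans s2l; rewrite !mulr_gt0 ?powR_gt0 ?exprn_gt0.
split => //.
(* Where [theta < b] the variable is at most [b] in absolute value, so its cube is at most [b] times
   its square. Where [theta >= b] it is at most [b + |E|]; independence gives a contribution of
   order [b^3 q b], which [s2q] turns into [b s2]. *)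
have T1 : \int[P]_w (`|xi b w| ^+ 3) <= (1 + 4 * k3) * (b * s2).
  apply: (@le_trans _ _ (\int[P]_w (b * xi b w ^+ 2 + \1_(B b) w * (b + `|E w|) ^+ 3))).
    have iBE : P.-integrable setT (EFin \o (fun w => \1_(B b) w * (b + `|E w|) ^+ 3)).
      apply: le_integrable (iE3 b) => //.
        apply/measurable_EFinP/measurable_funM; first exact: measurable_indic.
        by apply: measurable_funX; apply: measurable_funD => //; exact: measurableT_comp.
      by move=> w _; rewrite lee_fin normrM ler_piMl// indicE; case: (_ \in _); rewrite ?normr1 ?normr0.
    apply: ae_le_Rintegral => //; first by apply: integrableD_EFin => //; exact: integrableZl_EFin.
    apply: filterS2 good xib => w [t1 Ew0] xb; rewrite indicE.
    have [|] := boolP (w \in _).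
      rewrite mul1r => _; rewrite (@le_trans _ _ ((b + `|E w|) ^+ 3))//; last first.
        by rewrite lerDr mulr_ge0 ?(ltW bp)// sqr_ge0.
      by rewrite ler_pXn2r// nnegrE// addr_ge0// ltW.
    rewrite notin_setE/= in_itv/= andbT => /negP; rewrite -ltNge => tb.
    rewrite mul0r addr0 exprS -[in leRHS]real_normK ?num_real// ler_wpM2r ?exprn_ge0//.
    by rewrite xE /zeta tb ler_norml; apply/andP; split; lra.
  have iBE : P.-integrable setT (EFin \o (fun w => \1_(B b) w * (b + `|E w|) ^+ 3)).
    apply: le_integrable (iE3 b) => //.
      apply/measurable_EFinP/measurable_funM; first exact: measurable_indic.
      by apply: measurable_funX; apply: measurable_funD => //; exact: measurableT_comp.
    by move=> w _; rewrite lee_fin normrM ler_piMl// indicE; case: (_ \in _); rewrite ?normr1 ?normr0.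
  rewrite RintegralD//; last exact: integrableZl_EFin.
  rewrite RintegralZl// -/s2.
  have mf : measurable_fun setT (fun x : R => (b + `|x|) ^+ 3).
    by apply: measurable_funX; apply: measurable_funD => //; exact: measurableT_comp.
  have f0 (x : R) : 0 <= (b + `|x|) ^+ 3 by rewrite exprn_ge0// addr_ge0// ltW.
  rewrite (independent_tail_exponential hind b mf f0 (iE3 b)).
  have kb : \int[P]_w ((b + `|E w|) ^+ 3) <= b ^+ 3 * k3.
    rewrite -RintegralZl//; apply: le_Rintegral => //; first exact: integrableZl_EFin.
    move=> w _; rewrite -exprMn ler_pXn2r ?nnegrE ?mulr_ge0 ?addr_ge0 ?(ltW bp)//.
    by rewrite mulrDr mulr1 lerD2l ler_peMl.
  have q0 : 0 <= q b by exact: fine_ge0.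
  have : q b * \int[P]_w ((b + `|E w|) ^+ 3) <= 4 * k3 * (b * s2).
    apply: (@le_trans _ _ (q b * (b ^+ 3 * k3))); first by rewrite ler_wpM2l.
    rewrite (_ : q b * (b ^+ 3 * k3) = 4 * k3 * (b * (b ^+ 2 / 4 * q b))); last by field.
    by rewrite ler_wpM2l ?mulr_ge0// ler_wpM2l// ltW.
  by move=> h; rewrite [leRHS]mulrDl [X in _ <= X + _]mul1r lerD2l.
apply: le_trans T1 _.
have sq0 : 0 < Num.sqrt s2 by rewrite sqrtr_gt0.
have e2 : s2 = Num.sqrt s2 ^+ 2 by rewrite sqr_sqrtr// ltW.
rewrite [in leLHS]e2.
(* The lower bound on the variance read backwards: [sigma] is at least a multiple of
   [b^(1 - alpha / 2)], so a factor [b] is traded for [b^(alpha / 2) sigma]. *)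
have key : b <= 2 / Num.sqrt c * b `^ (alpha / 2) * Num.sqrt s2.
  have h : Num.sqrt (b ^+ 2 / 4 * (c * b `^ (- alpha))) <= Num.sqrt s2 by rewrite ler_wsqrtr.
  have e3 : Num.sqrt (b ^+ 2 / 4 * (c * b `^ (- alpha))) = b / 2 * Num.sqrt c * (b `^ (alpha / 2))^-1.
    rewrite (_ : b ^+ 2 / 4 * (c * _) = (b / 2 * Num.sqrt c * (b `^ (alpha / 2))^-1) ^+ 2).
      by rewrite sqrtr_sqr ger0_norm// mulr_ge0 ?invr_ge0 ?powR_ge0// mulr_ge0 ?sqrtr_ge0 ?divr_ge0// ltW.
    have pe : (b `^ (alpha / 2)) ^+ 2 = b `^ alpha.
      by rewrite -powR_mulrn ?powR_ge0// -powRrM; congr powR; field.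
    have sc2 : c = Num.sqrt c ^+ 2 by rewrite sqr_sqrtr// ltW.
    rewrite powRN -pe [X in _ * (X * _)]sc2; field.
    by rewrite gt_eqF// powR_gt0.
  rewrite e3 in h.
  have pc : 0 < 2 / Num.sqrt c * b `^ (alpha / 2) by rewrite mulr_gt0 ?powR_gt0// divr_gt0 ?sqrtr_gt0.
  apply: le_trans (ler_wpM2l (ltW pc) h).
  rewrite le_eqVlt; apply/orP; left; apply/eqP; field.
  by rewrite !gt_eqF ?sqrtr_gt0 ?powR_gt0.
have k40 : 0 <= 1 + 4 * k3 by rewrite addr_ge0// mulr_ge0.
apply: (@le_trans _ _ ((1 + 4 * k3) * ((2 / Num.sqrt c * b `^ (alpha / 2) * Num.sqrt s2) * Num.sqrt s2 ^+ 2))).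
  by rewrite ler_wpM2l// ler_wpM2r// sqr_ge0.
by rewrite le_eqVlt; apply/orP; left; apply/eqP; ring.
Qed.

End tapered_pareto_moments.

(** * Partial sums of the filter *)

Section power_increments.
Context {R : realType}.
Implicit Types (h beta : R).

Lemma cvg_powR_pinfty h : 0 < h -> (m.+1%:R : R) `^ h @[m --> \oo] --> +oo.
Proof.
move=> h0; apply/cvgryPge => A.
exists (Num.truncn (`|A| `^ h^-1)) => // m /= hm.
apply: le_trans (ler_norm A) _.
have -> : `|A| = (`|A| `^ h^-1) `^ h by rewrite -powRrM mulVf ?lt0r_neq0// powRr1.
rewrite ge0_ler_powR ?nnegrE ?(ltW h0) ?powR_ge0//.
by rewrite (le_trans (ltW (truncnS_gt _)))// ler_nat ltnS.
Qed.

Lemma cvg_powR_0 h : h < 0 -> (m.+1%:R : R) `^ h @[m --> \oo] --> (0 : R).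
Proof.
move=> h0; have : 0 < - h by rewrite oppr_gt0.
move=> /cvg_powR_pinfty/cvgryPge hy; apply/cvgrPdist_le => e e0.
near=> m; have : e^-1 <= m.+1%:R `^ (- h) by near: m; exact: hy.
rewrite sub0r normrN ger0_norm ?powR_ge0// -{2}[h]opprK (powRN _ (- h)) => hm.
by rewrite invf_ple ?posrE ?powR_gt0//.
Unshelve. all: by end_near. Qed.

Lemma cvg_powR_base h (u : nat -> R) (l : R) : 0 < l -> u @ \oo --> l ->
  u n `^ h @[n --> \oo] --> l `^ h.
Proof.
move=> l0 ul.
have c : {for l, continuous (fun x : R => x `^ h)}.
  apply: differentiable_continuous; apply/derivable1_diffP.
  by apply: derivable_powR; rewrite in_itv/= l0.
exact: (cvg_comp u (fun x => x `^ h) ul c).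
Qed.

(** After division by [(n + 1)^h] this is the difference quotient of [x^h] at 1 with step
    [1 / (n + 1)]. *)
Lemma cvg_powR_increment h :
  (n.+2%:R `^ h - n.+1%:R `^ h) * n.+1%:R `^ (1 - h) @[n --> \oo] --> h.
Proof.
have d1 : is_derive (1 : R) (1 : R) ((@powR R)^~ h) (h * 1 `^ (h - 1)).
  by apply: is_derive1_powR.
have [dv] := d1; rewrite powR1 mulr1 => e.
have lim1 : t^-1 *: ((((@powR R)^~ h) \o shift 1) (t *: (1 : R)) - 1 `^ h) @[t --> 0^'] --> h.
  by rewrite -[X in _ --> X]e; exact: dv.
have := (cvgr_dnbhsP _ _ _).1 lim1 (fun n => n.+1%:R^-1) (conj _ _).
have n0 (n : nat) : n.+1%:R != 0 :> R by rewrite pnatr_eq0.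
rewrite /= => /(_ (fun n => invr_neq0 (n0 n)) (@cvg_harmonic R)).
apply: cvg_trans; apply: near_eq_cvg; near=> n.
rewrite /GRing.scale/= invrK mulr1 powR1.
have -> : n.+1%:R^-1 + 1 = n.+2%:R / n.+1%:R :> R.
  by rewrite -[n.+2%:R]natr1 mulrDl divff// mul1r addrC.
have p0 (k : nat) : 0 < k.+1%:R `^ h :> R by rewrite powR_gt0.
rewrite powRM ?invr_ge0// powRB ?(n0 n) ?implybT// powRr1//.
rewrite -powR_inv1// -powRrM mulN1r powRN; field.
by rewrite gt_eqF.
Unshelve. all: by end_near. Qed.

(** The sign [s], equal to 1 or -1 in the uses below, allows both increasing and decreasing [D]. *)
Lemma telescoping_bound (e D : nat -> R) (c : R) (M : nat) (s : R) :
  (forall m, (M <= m)%N -> `|e m.+1 - e m| <= c * (s * (D m.+1 - D m))) ->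
  forall m k, (M <= m)%N -> `|e (m + k)%N - e m| <= c * (s * (D (m + k)%N - D m)).
Proof.
move=> h m k Mm; elim: k => [|k IH]; first by rewrite addn0 !subrr normr0 !mulr0.
rewrite addnS; have := h (m + k)%N (leq_trans Mm (leq_addr _ _)).
have := ler_distD (e (m + k)%N) (e (m + k).+1) (e m).
rewrite !mulrBr in IH *; lra.
Qed.

(* Stolz-Cesaro. *)
Lemma cvg_ratio_increasing (u D : nat -> R) (k : R) :
  (forall m, 0 < D m) -> (forall m, D m <= D m.+1) -> D @ \oo --> +oo ->
  (forall e, 0 < e -> \forall m \near \oo,
     `|(u m.+1 - u m) - k * (D m.+1 - D m)| <= e * `|D m.+1 - D m|) ->
  u m / D m @[m --> \oo] --> k.
Proof.
move=> D0 Di Dy h; apply/cvgrPdist_le => e e0.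
have e20 : 0 < e / 2 by rewrite divr_gt0.
have [M _ hM] := h _ e20.
pose v m := u m - k * D m.
have T : forall m j, (M <= m)%N -> `|v (m + j)%N - v m| <= e / 2 * (1 * (D (m + j)%N - D m)).
  apply: telescoping_bound => m Mm; have := hM m Mm.
  rewrite mul1r (ger0_norm (_ : 0 <= D m.+1 - D m)) ?subr_ge0//; apply: le_trans.
  by rewrite (_ : v m.+1 - v m = u m.+1 - u m - k * (D m.+1 - D m))// /v; ring.
move/cvgryPge/(_ (`|v M| / (e / 2))) : Dy => Dy.
near=> m.
have Mm : (M <= m)%N by near: m; exists M.
have := T M (m - M)%N (leqnn _); rewrite subnKC// mul1r => Tm.
have Dm : `|v M| / (e / 2) <= D m by near: m.
rewrite ler_pdivrMr// in Dm.
have -> : k - u m / D m = - (v m / D m) by rewrite /v; field; rewrite gt_eqF.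
rewrite normrN normrM normfV (gtr0_norm (D0 m)) ler_pdivrMr//.
have := ler_distD (v M) (v m) 0; rewrite !subr0.
have : 0 <= e / 2 * D M by rewrite mulr_ge0 ?ltW.
rewrite mulrBr in Tm; lra.
Unshelve. all: by end_near. Qed.

(** The variant of Stolz-Cesaro for quotients of sequences tending to 0: one telescopes from [m] to
    infinity instead of from a fixed rank to [m]. *)
Lemma cvg_ratio_decreasing (u D : nat -> R) (k : R) :
  (forall m, 0 < D m) -> (forall m, D m.+1 <= D m) ->
  D @ \oo --> (0 : R) -> u @ \oo --> (0 : R) ->
  (forall e, 0 < e -> \forall m \near \oo,
     `|(u m.+1 - u m) - k * (D m.+1 - D m)| <= e * `|D m.+1 - D m|) ->
  u m / D m @[m --> \oo] --> k.
Proof.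
move=> D0 Di Dy uy h; apply/cvgrPdist_le => e e0.
have [M _ hM] := h _ e0.
pose v m := u m - k * D m.
have T : forall m j, (M <= m)%N -> `|v (m + j)%N - v m| <= e * (-1 * (D (m + j)%N - D m)).
  apply: telescoping_bound => m Mm; have := hM m Mm.
  rewrite mulN1r (ler0_norm (_ : D m.+1 - D m <= 0)) ?subr_le0//; apply: le_trans.
  by rewrite (_ : v m.+1 - v m = u m.+1 - u m - k * (D m.+1 - D m))// /v; ring.
have vy : v @ \oo --> (0 : R).
  rewrite -[X in _ --> X](subr0 0) -[X in _ --> _ - X](mulr0 k).
  by apply: cvgB => //; apply: cvgMr.
exists M => // m /= Mm.
have vm : `|v m| <= e * D m.
  (* Letting [j] tend to infinity removes the far end, since [v] tends to 0. *)
  have c : `|v (m + j)%N - v m| @[j --> \oo] --> `|0 - v m|.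
    apply: cvg_norm; apply: cvgB; last exact: cvg_cst.
    rewrite (_ : (fun j => _) = (fun j => v (j + m)%N)); last by apply/funext => j; rewrite addnC.
    by rewrite cvg_shiftn.
  rewrite sub0r normrN in c.
  apply: (@ler_cvg_to _ _ _ _ _ _ _ _ c (cvg_cst _)).
  apply: nearW => j; apply: le_trans (T m j Mm) _.
  by rewrite ler_wpM2l ?(ltW e0)// mulN1r opprB gerBl ltW.
have -> : k - u m / D m = - (v m / D m) by rewrite /v; field; rewrite gt_eqF.
by rewrite normrN normrM normfV (gtr0_norm (D0 m)) ler_pdivrMr.
Qed.

Lemma bounded_ratio (u D : nat -> R) (k : R) : (forall m, 0 < D m) ->
  u m / D m @[m --> \oo] --> k -> exists2 C, 0 < C & forall m, `|u m| <= C * D m.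
Proof.
move=> D0 /cvgrPdist_le/(_ 1 ltr01)[M _ hM].
have S0 : 0 <= \sum_(l < M) `|u l / D l| by exact: sumr_ge0.
exists (`|k| + 1 + \sum_(l < M) `|u l / D l|) => [|m].
  by rewrite -addrA ltr_wpDl// ltr_pwDl.
rewrite -ler_pdivrMr// -{1}(gtr0_norm (D0 m)) -normf_div.
have [Mm|mM] := leqP M m.
  have := hM m Mm; have := ler_distD k (u m / D m) 0; rewrite /= !subr0 (distrC (u m / D m)).
  lra.
rewrite (bigD1 (Ordinal mM))//=.
have : 0 <= \sum_(i < M | i != Ordinal mM) `|u i / D i| by exact: sumr_ge0.
have := normr_ge0 k; lra.
Qed.

End power_increments.

Lemma cvg_ratioS {R : realType} : (n.+2%:R / n.+1%:R : R) @[n --> \oo] --> (1 : R).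
Proof.
apply: (@cvg_harmonic_bound _ _ _ 1) => n.
by rewrite -[n.+2%:R]natr1 mulrDl divff ?pnatr_eq0// addrC addKr ger0_norm.
Qed.

Section filter_partial_sums.
Context {R : realType} (a : nat -> R) (beta : R).
Hypothesis ha : (a n * n%:R `^ beta) @[n --> \oo] --> (1 : R).

Definition psum (m : nat) : R := series a m.+1.

Let D (h : R) (m : nat) : R := m.+1%:R `^ h.
Let D0 h m : 0 < D h m. Proof. by rewrite powR_gt0. Qed.

Lemma psumS m : psum m.+1 = psum m + a m.+1.
Proof. by rewrite /psum /series/= big_nat_recr. Qed.

Lemma filter_coef_bound : exists2 C, 0 < C & forall m, `|a m| <= C * m.+1%:R `^ (- beta).
Proof.
apply: (@bounded_ratio _ a (D (- beta)) 1); first exact: D0.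
have h1 : a m.+1 / D (- beta) m.+1 @[m --> \oo] --> (1 : R).
  have h2 := @cvg_powR_base R beta _ _ ltr01 (@cvg_ratioS R).
  rewrite powR1 in h2.
  rewrite -[X in _ --> X]mulr1.
  have ha1 : a m.+1 * m.+1%:R `^ beta @[m --> \oo] --> (1 : R).
    by move: ha; rewrite -(cvg_shiftS (fun n => a n * n%:R `^ beta)).
  rewrite (_ : (fun m => _) = (fun m => (a m.+1 * m.+1%:R `^ beta) * (m.+2%:R / m.+1%:R) `^ beta)).
    exact: cvgM.
  apply/funext => m.
  rewrite /D powRN invrK powRM ?invr_ge0// -powR_inv1// -powRrM mulN1r powRN -mulrA; congr (_ * _).
  by rewrite mulrCA mulfV ?mulr1// gt_eqF// powR_gt0.
by rewrite -(cvg_shiftS (fun m => a m / D (- beta) m)).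
Unshelve. all: by end_near. Qed.

(** Both the next coefficient and the increment of [m^h] divided by [h] are equivalent to
    [m^(- beta)]. The error is measured against the increment, in the form needed for either version
    of Stolz-Cesaro. *)
Lemma filter_increment (h : R) : beta = 1 - h -> h != 0 -> forall e, 0 < e ->
  \forall m \near \oo,
   `|(psum m.+1 - psum m) - h^-1 * (D h m.+1 - D h m)| <= e * `|D h m.+1 - D h m|.
Proof.
move=> bh h0 e e0.
pose p (m : nat) : R := m.+1%:R `^ (1 - h).
have p0 m : 0 < p m by rewrite powR_gt0.
have ha1 : a m.+1 * p m @[m --> \oo] --> (1 : R).
  by move: ha; rewrite bh -(cvg_shiftS (fun n => a n * n%:R `^ (1 - h))).
have hd := @cvg_powR_increment R h.
have h2 : (a m.+1 - h^-1 * (D h m.+1 - D h m)) * p m @[m --> \oo] --> (0 : R).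
  rewrite -[X in _ --> X](subrr 1) -[X in _ --> _ - X](mulVf h0).
  rewrite (_ : (fun m => _) = (fun m => a m.+1 * p m - h^-1 * ((m.+2%:R `^ h - m.+1%:R `^ h) * m.+1%:R `^ (1 - h)))).
    by apply: cvgB => //; apply: cvgM => //; exact: cvg_cst.
  by apply/funext => m; rewrite /D /p; ring.
have nh : 0 < `|h| / 2 by rewrite divr_gt0// normr_gt0.
have eh : 0 < e * (`|h| / 2) by rewrite mulr_gt0.
move/cvgrPdist_le/(_ _ eh) : h2 => h2; move/cvgrPdist_le/(_ _ nh) : hd => hd.
near=> m.
have A : `|0 - (a m.+1 - h^-1 * (D h m.+1 - D h m)) * p m| <= e * (`|h| / 2) by near: m.
have B : `|h - (D h m.+1 - D h m) * p m| <= `|h| / 2 by near: m.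
rewrite sub0r normrN normrM (gtr0_norm (p0 m)) in A.
rewrite psumS (addrC (psum m)) addrK -(ler_pM2r (p0 m)); apply: le_trans A _.
rewrite -mulrA ler_wpM2l ?(ltW e0)// -(gtr0_norm (p0 m)) -normrM.
have := ler_distD ((D h m.+1 - D h m) * p m) h 0; rewrite !subr0; lra.
Unshelve. all: by end_near. Qed.

Lemma psum_cvg_increasing : 1 / 2 < beta < 1 ->
  psum m / m.+1%:R `^ (1 - beta) @[m --> \oo] --> (1 - beta)^-1.
Proof.
move=> /andP[b1 b2]; have h0 : 0 < 1 - beta by rewrite subr_gt0.
apply: (@cvg_ratio_increasing _ psum (D (1 - beta))) => //.
- by move=> m; rewrite ge0_ler_powR ?nnegrE ?(ltW h0)// ler_nat.
- exact: cvg_powR_pinfty.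
- by apply: filter_increment; [ring|exact: lt0r_neq0].
Qed.

Lemma psum_is_cvg : 1 < beta -> psum @ \oo --> filter_sum a.
Proof.
move=> b1.
suff cs : cvgn (series a) by rewrite /psum (cvg_shiftS (series a)); exact: cs.
apply: normed_cvg; pose na (n : nat) : R := `|a n|.
have nd : nondecreasing_seq (series na).
  by apply/nondecreasing_seqP => n; rewrite seriesSr lerDl normr_ge0.
suff : cvgn (series na) by [].
apply: nondecreasing_is_cvgn => //.
pose h := 1 - beta.
have h0 : h < 0 by rewrite subr_lt0.
have bh : beta = 1 - h by rewrite /h; ring.
(* From the rank [M] on, the coefficients are dominated by the increments of [m^(1 - beta)], a
   convergent telescoping series; this gives absolute convergence. *)
have [M _ hM] := filter_increment bh (ltr0_neq0 h0) ltr01.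
have Dd m : D h m.+1 - D h m <= 0.
  rewrite subr_le0 /D -(opprK h) !(powRN _ (- h)) lef_pV2 ?posrE ?powR_gt0//.
  by rewrite ge0_ler_powR ?nnegrE ?oppr_ge0 ?(ltW h0)// ler_nat.
pose C : R := `|h^-1| + 1.
have T : forall m j, (M <= m)%N ->
   `|series na (m + j).+1 - series na m.+1| <= C * (-1 * (D h (m + j)%N - D h m)).
  apply: (@telescoping_bound _ (fun m => series na m.+1)) => m Mm.
  rewrite [in X in X - _]seriesSr (addrC (series na _)) addrK normr_id mulN1r.
  have := hM m Mm; rewrite /= psumS (addrC (psum m)) addrK mul1r (ler0_norm (Dd m)) => hm.
  have := ler_distD (h^-1 * (D h m.+1 - D h m)) (a m.+1) 0; rewrite !subr0 normrM (ler0_norm (Dd m)).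
  by rewrite /C mulrDl mul1r; lra.
exists (series na M.+1 + C * D h M) => _ [n _ <-].
apply: (@le_trans _ _ (series na (M + n).+1)).
  by apply: nd; rewrite (leq_trans (leq_addl M n)).
have := T M n (leqnn _); rewrite ler_norml => /andP[_].
have : C * D h (M + n)%N >= 0 by rewrite mulr_ge0 ?powR_ge0// addr_ge0.
rewrite mulN1r opprB mulrBr; lra.
Qed.

(** When the total sum is 0 a partial sum is minus a tail. The limit has the same expression as for
    [beta < 1], now negative, so types (i) and (iii) share one description. *)
Lemma psum_cvg_decreasing : 1 < beta < 3 / 2 -> filter_sum a = 0 ->
  psum m / m.+1%:R `^ (1 - beta) @[m --> \oo] --> (1 - beta)^-1.
Proof.
move=> /andP[b1 b2] S0; have h0 : 1 - beta < 0 by rewrite subr_lt0.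
apply: (@cvg_ratio_decreasing _ psum (D (1 - beta))) => //.
- move=> m; rewrite /D -opprB !powRN lef_pV2 ?posrE ?powR_gt0//.
  by rewrite ge0_ler_powR ?nnegrE ?subr_ge0 ?(ltW b1)// ler_nat.
- exact: cvg_powR_0.
- by have := psum_is_cvg b1; rewrite S0.
- by apply: filter_increment; [ring|exact: ltr0_neq0].
Qed.

Lemma psum_block C : (forall m, `|a m| <= C * m.+1%:R `^ (- beta)) -> 0 < beta ->
  forall m N, `|psum (m + N) - psum m| <= C * N%:R * m.+1%:R `^ (- beta).
Proof.
move=> aC b0 m N; have C0 : 0 <= C.
  by have := aC 0%N; rewrite powR1 mulr1; exact: le_trans.
elim: N => [|N IH]; first by rewrite addn0 subrr normr0 mulr0 mul0r.
rewrite addnS psumS -natr1 mulrDr mulr1 mulrDl.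
have h : `|a (m + N).+1| <= C * m.+1%:R `^ (- beta).
  apply: le_trans (aC _) _; rewrite ler_wpM2l// !powRN lef_pV2 ?posrE ?powR_gt0//.
  rewrite ge0_ler_powR ?nnegrE ?(ltW b0)// ler_nat.
  by rewrite ltnS (leq_trans (leq_addr N m)).
rewrite addrAC; apply: le_trans (ler_normD _ _) _; lra.
Qed.

End filter_partial_sums.

(** * Step functions on the line *)

Section power_integrals.
Context {R : realType}.
Local Notation mu := (@lebesgue_measure R).
Implicit Types (q a b y : R).

Lemma powR_cvgy q : q < 0 -> x `^ q @[x --> +oo%R] --> (0 : R).
Proof.
move=> q0; have nq : 0 < - q by rewrite oppr_gt0.
apply/cvgrPdist_le => e e0; near=> x.
have x0 : 0 < x by near: x; exact: nbhs_pinfty_gt.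
rewrite sub0r normrN ger0_norm ?powR_ge0// -[q]opprK (powRN _ (- q)).
rewrite invf_ple ?posrE ?powR_gt0//.
have -> : e^-1 = (e^-1 `^ (- q)^-1) `^ (- q).
  by rewrite -powRrM mulVf ?lt0r_neq0// powRr1// invr_ge0 ltW.
rewrite ge0_ler_powR ?nnegrE ?powR_ge0 ?(ltW x0) ?(ltW nq)//.
Unshelve. all: by end_near. Qed.

Lemma is_derive_powR_shift q y (x : R) : q != -1 -> 0 < x + y ->
  is_derive x (1 : R) (fun t => (t + y) `^ (q + 1) / (q + 1)) ((x + y) `^ q).
Proof.
move=> q1 xy0; have q10 : q + 1 != 0 by rewrite addr_eq0.
have d2 : is_derive x (1 : R) (fun t : R => t + y) 1.
  by apply: is_derive_eq; rewrite addr0.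
have d1 := @is_derive1_powR R (q + 1) (x + y) xy0.
have d3 := @is_derive1_comp _ ((@powR R)^~ (q + 1)) (fun t => t + y) x _ _ d1 d2.
have d4 : is_derive x (1 : R) ((q + 1)^-1 \*: (((@powR R)^~ (q + 1)) \o (fun t => t + y)))
    ((q + 1)^-1 *: ((q + 1) * (x + y) `^ (q + 1 - 1) * 1)).
  exact: is_deriveZ.
rewrite mulr1 addrK in d4.
rewrite (_ : (fun t => _) = (q + 1)^-1 \*: (((@powR R)^~ (q + 1)) \o (fun t => t + y))).
  by apply: is_derive_eq; rewrite /GRing.scale/= mulrA mulVf// mul1r.
by apply/funext => t /=; rewrite mulrC.
Qed.

Let antiderivative q y (t : R) : R := (t + y) `^ (q + 1) / (q + 1).

Let cont_antiderivative q y (x : R) : q != -1 -> 0 < x + y -> {for x, continuous (antiderivative q y)}.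
Proof.
move=> q1 xy; apply: differentiable_continuous; apply/derivable1_diffP.
by have [] := is_derive_powR_shift q1 xy.
Qed.

Lemma continuous_powR_shift q y (x : R) : 0 < x + y -> {for x, continuous (fun t : R => (t + y) `^ q)}.
Proof.
move=> xy0; apply: (@cvg_comp _ _ _ (fun t : R => t + y) (fun t => t `^ q) _ (nbhs (x + y))).
  by apply: cvgD; [exact: cvg_id|exact: cvg_cst].
have : {for x + y, continuous (fun t : R => t `^ q)}.
  apply: differentiable_continuous; apply/derivable1_diffP.
  by apply: derivable_powR; rewrite in_itv/= xy0.
by [].
Qed.

Lemma integral_powR_shift q y a b : q != -1 -> 0 < a + y -> a <= b ->
  (\int[mu]_(x in `[a, b]) ((x + y) `^ q)%:E =
   (((b + y) `^ (q + 1) - (a + y) `^ (q + 1)) / (q + 1))%:E)%E.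
Proof.
move=> q1 ay; rewrite le_eqVlt => /predU1P[<-|ab].
  by rewrite subrr mul0r set_itv1 integral_set1.
have pos (x : R) : a <= x -> 0 < x + y by move=> ax; lra.
rewrite (@continuous_FTC2 _ _ (antiderivative q y))//.
- by rewrite -EFinB /antiderivative mulrBl.
- apply: continuous_in_subspaceT => x; rewrite inE/= in_itv/= => /andP[ax xb].
  exact: continuous_powR_shift (pos _ ax).
- split => [x|| ].
  + rewrite in_itv/= => /andP[ax _].
    by have [] := is_derive_powR_shift q1 (pos _ (ltW ax)).
  + exact/cvg_at_right_filter/cont_antiderivative.
  + by apply/cvg_at_left_filter/cont_antiderivative => //; apply: pos; exact: ltW.
- move=> x; rewrite in_itv/= => /andP[ax _]; rewrite derive1E.
  by have [_ ->] := is_derive_powR_shift q1 (pos _ (ltW ax)).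
Qed.

Lemma integral_powR0 q b : -1 < q -> 0 <= b ->
  (\int[mu]_(x in `[0%R, b]) (x `^ q)%:E = (b `^ (q + 1) / (q + 1))%:E)%E.
Proof.
move=> q1; have q10 : 0 < q + 1 by lra.
rewrite le_eqVlt => /predU1P[<-|b0].
  by rewrite set_itv1 integral_set1 powR0 ?mul0r// lt0r_neq0.
have mq (D : set R) : measurable_fun D (EFin \o (fun x : R => x `^ q)).
  by apply/measurable_EFinP; apply: measurable_funTS; exact: measurable_powR.
rewrite -integral_itv_obnd_cbnd; last exact: mq.
have := @ge0_nondecreasing_set_cvg_integral _ (measurableTypeR R) R
  (fun n => `[(0 + n.+1%:R^-1)%R, b]%classic) (EFin \o (fun x : R => x `^ q)) (@lebesgue_measure R).
rewrite -itv_open_bnd_bigcup => h; apply: cvg_unique (h _ _ _ _) _ => //.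
- apply/nondecreasing_seqP => m; rewrite subsetEset => x /=; rewrite !in_itv/= !add0r => /andP[h1 ->].
  by rewrite andbT (le_trans _ h1)// lef_pV2 ?posrE// ler_nat.
- by move=> m; exact: mq.
- by move=> m x _; rewrite lee_fin powR_ge0.
apply: (@cvg_trans _ ((((b `^ (q + 1) - m.+1%:R `^ (- (q + 1))) / (q + 1))%:E) @[m --> \oo])).
  apply: near_eq_cvg; near=> m.
  have mb : m.+1%:R^-1 <= b by apply/ltW; near: m; exact: (near_infty_natSinv_lt (PosNum b0)).
  rewrite add0r; under eq_integral do rewrite /= -[x in x `^ q]addr0.
  rewrite integral_powR_shift ?addr0 ?invr_gt0//; last by rewrite gt_eqF.
  by rewrite -[_^-1 in RHS]powR_inv1// -powRrM mulN1r.
apply: cvg_EFin; first exact: nearW.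
rewrite -[X in X / _](subr0 (b `^ (q + 1))); apply: cvgMl; apply: cvgB; first exact: cvg_cst.
by apply: cvg_powR_0; rewrite oppr_lt0.
Unshelve. all: by end_near. Qed.

Lemma integral_powRy q a : q < -1 -> 0 < a ->
  (\int[mu]_(x in `[a, +oo[) (x `^ q)%:E = (- (a `^ (q + 1) / (q + 1)))%:E)%E.
Proof.
move=> q1 a0; have q10 : q + 1 < 0 by lra.
have qN1 : q != -1 by rewrite lt_eqF.
have pos (x : R) : a <= x -> 0 < x + 0 by move=> ax; rewrite addr0; exact: lt_le_trans ax.
under eq_integral do rewrite -[x in x `^ q]addr0.
rewrite (@ge0_continuous_FTC2y _ _ (antiderivative q 0) _ 0)//.
- by rewrite sub0e /antiderivative addr0.
- by move=> x _; rewrite powR_ge0.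
- apply: continuous_in_subspaceT => x; rewrite inE/= in_itv/= andbT => ax.
  exact: continuous_powR_shift (pos _ ax).
- rewrite -[X in _ --> X](mul0r (q + 1)^-1); apply: cvgMl.
  rewrite (_ : (fun t => _) = (fun t : R => t `^ (q + 1))); first exact: powR_cvgy.
  by apply/funext => t; rewrite addr0.
- by move=> x ax; have [] := is_derive_powR_shift qN1 (pos _ (ltW ax)).
- by apply/cvg_at_right_filter/cont_antiderivative => //; exact: pos.
- move=> x; rewrite in_itv/= andbT => ax; rewrite derive1E.
  by have [_ ->] := is_derive_powR_shift qN1 (pos _ (ltW ax)).
Qed.

End power_integrals.

Lemma scaled_pushforward {R : realType} d d' (T1 : measurableType d) (T2 : measurableType d')
    (m : {measure set T1 -> \bar R}) (k : {nonneg R}) (phi : T1 -> T2) :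
  measurable_fun setT phi ->
  exists nu : {measure set T2 -> \bar R}, (forall A, nu A = k%:num%:E * m (phi @^-1` A))%E /\
  forall f : T2 -> \bar R, measurable_fun setT f -> (forall x, 0 <= f x)%E ->
    (\int[nu]_x f x = k%:num%:E * \int[m]_x f (phi x))%E.
Proof.
move=> mphi.
unshelve eexists (mscale k (pushforward m phi)); first exact: mphi.
split => // f mf f0.
rewrite ge0_integral_mscale//.
by rewrite ge0_integral_pushforward//= => x _; exact: f0.
Qed.

Section affine_change.
Context {R : realType}.
Local Notation mu := (@lebesgue_measure R).

Let mu_oc (a b : R) : mu `]a, b] = (if a < b then b - a else 0)%:E.
Proof. by rewrite lebesgue_measure_itv/= lte_fin; case: ifP => // _; rewrite -EFinB. Qed.

Let mu_co (a b : R) : mu `[a, b[ = (if a < b then b - a else 0)%:E.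
Proof. by rewrite lebesgue_measure_itv/= lte_fin; case: ifP => // _; rewrite -EFinB. Qed.

(** The scaled image of Lebesgue measure gives half-open intervals their length, hence is Lebesgue
    measure. For [c < 0] the preimage is closed on the other side, which does not change its
    length. *)
Lemma ge0_integral_affine (c e : R) (f : R -> R) : c != 0 ->
  measurable_fun setT f -> (forall x, 0 <= f x) ->
  (\int[mu]_x (f (c * x + e))%:E = (`|c|^-1)%:E * \int[mu]_x (f x)%:E)%E.
Proof.
move=> c0 mf f0.
have nc : 0 < `|c| by rewrite normr_gt0.
pose phi : measurableTypeR R -> measurableTypeR R := fun x => c * x + e.
have mphi : measurable_fun setT phi by apply: measurable_funD => //; exact: measurable_funM.
pose k : {nonneg R} := (NngNum (ltW nc)).
have [m2 [m2E im2]] := scaled_pushforward (@lebesgue_measure R) k mphi.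
have mE (A : set R) : measurable A -> mu A = m2 A.
  apply: lebesgue_measure_unique => _ [[a b] /= ab <-].
  rewrite m2E.
  have [cp|cn|c00] := ltgtP 0 c; last by rewrite c00 eqxx in c0.
  - rewrite (_ : phi @^-1` _ = `](a - e) / c, (b - e) / c]%classic); last first.
      apply/seteqP; split => x /=; rewrite !in_itv/= /phi ltr_pdivrMr// ler_pdivlMr// ltrBlDr lerBrDr (mulrC x)//.
    rewrite [LHS]mu_oc [X in _ = (_ * X)%E]mu_oc -EFinM ltr_pM2r ?invr_gt0// ltrD2r/= gtr0_norm//; congr EFin.
    by case: ifPn => _; rewrite ?mulr0//; field; rewrite lt0r_neq0.
  - rewrite (_ : phi @^-1` _ = `[(b - e) / c, (a - e) / c[%classic); last first.
      apply/seteqP; split => x /=; rewrite !in_itv/= /phi ltr_ndivlMr// ler_ndivrMr// ltrBlDr lerBrDr (mulrC x) andbC//.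
    rewrite [LHS]mu_oc [X in _ = (_ * X)%E]mu_co -EFinM ltr_nM2r ?invr_lt0// ltrD2r/= ltr0_norm//; congr EFin.
    by case: ifPn => _; rewrite ?mulr0//; field; rewrite ltr0_neq0.
have -> : (\int[mu]_x (f x)%:E = \int[m2]_x (f x)%:E)%E by apply: eq_measure_integral => A mA _; exact: mE.
rewrite im2; [|exact/measurable_EFinP|by move=> x; rewrite lee_fin].
by rewrite muleA -EFinM mulVf ?lt0r_neq0// mul1e.
Qed.

End affine_change.

Section step_functions.
Context {R : realType}.
Local Notation mu := (@lebesgue_measure R).
Variables (n : nat) (s : seq int).
Hypotheses (n0 : (0 < n)%N) (us : uniq s).

Let nr : 0 < n%:R :> R. Proof. by rewrite ltr0n. Qed.
Let cell (k : int) : set R := `](k%:~R - 1) / n%:R, k%:~R / n%:R]%classic.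

Let cellE (y : R) k : (y \in cell k) = (Num.ceil (n%:R * y) == k).
Proof.
apply/idP/eqP.
  rewrite inE /cell/= in_itv/= ltr_pdivrMr// ler_pdivlMr// => h; apply: ceil_def.
  by rewrite intrB mulrC.
move=> <-; rewrite inE /cell/= in_itv/= ltr_pdivrMr// ler_pdivlMr// mulrC.
by have := ceil_itv (y * n%:R : R); rewrite intrB.
Qed.

Let step_sum (G : int -> R) (y : R) : (forall k, k \notin s -> G k = 0) ->
  G (Num.ceil (n%:R * y)) = \sum_(k <- s) G k * \1_(cell k) y.
Proof.
move=> G0; set c := Num.ceil _.
have e k : k != c -> G k * \1_(cell k) y = 0.
  by move=> kc; rewrite indicE cellE eq_sym (negbTE kc) mulr0.
have [cs|cs] := boolP (c \in s).
  rewrite (bigD1_seq c)//= indicE cellE eqxx mulr1 big1 ?addr0//.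
rewrite G0// big_seq big1// => k ks; apply: e; apply: contra cs => /eqP <-//.
Qed.

Lemma measurable_step (G : int -> R) : (forall k, k \notin s -> G k = 0) ->
  measurable_fun setT (fun y : R => G (Num.ceil (n%:R * y))).
Proof.
move=> G0; rewrite (_ : (fun y => _) = (fun y => \sum_(k <- s) G k * \1_(cell k) y)).
  apply: measurable_sum => k; apply: measurable_funM => //.
  by apply: measurable_indic; exact: measurable_itv.
by apply/funext => y; exact: step_sum.
Qed.

Lemma integral_step (G : int -> R) : (forall k, k \notin s -> G k = 0) -> (forall k, 0 <= G k) ->
  (\int[mu]_y (G (Num.ceil (n%:R * y)))%:E = (\sum_(k <- s) G k / n%:R)%:E)%E.
Proof.
move=> G0 Gp.
under eq_integral do rewrite step_sum// -sumEFin.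
have mI k : measurable_fun setT (fun x : R => (\1_(cell k) x : R)).
  by apply: measurable_indic; exact: measurable_itv.
rewrite ge0_integral_sum//; last 2 first.
- by move=> k; apply/measurable_EFinP; apply: measurable_funM => //; exact: mI.
- by move=> k y _; rewrite lee_fin mulr_ge0.
rewrite -sumEFin; apply: eq_bigr => k _.
under eq_integral do rewrite EFinM.
rewrite ge0_integralZl//; [|by apply/measurable_EFinP; exact: mI|by rewrite lee_fin].
rewrite integral_indic// ?setIT; last exact: measurable_itv.
transitivity ((G k)%:E * mu (cell k))%E => //.
rewrite /cell lebesgue_measure_itv/= lte_fin ltr_pM2r ?invr_gt0// ltrBlDr ltrDl ltr01.
by rewrite -EFinB -EFinM; congr EFin; field; rewrite lt0r_neq0.
Qed.

End step_functions.

(** * Dominated convergence for weights read as step functions *)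

Section step_limit.
Context {R : realType}.
Local Notation mu := (@lebesgue_measure R).
Variables (s : nat -> seq int) (G : nat -> int -> R) (f D : R -> R).
Hypothesis us : forall n, uniq (s n).
Hypothesis Gs : forall n k, k \notin s n -> G n k = 0.
Hypothesis mf : measurable_fun setT f.
Hypothesis mD : measurable_fun setT D.
Hypothesis iD : mu.-integrable setT (EFin \o (fun y => D y ^+ 2)).
Variable E : set R.
Hypotheses (mE : measurable E) (E0 : mu E = 0).
Hypothesis Gf : forall y, ~ E y -> G n (Num.ceil (n%:R * y)) @[n --> \oo] --> f y.
Hypothesis GD : \forall n \near \oo, forall y, ~ E y -> `|G n (Num.ceil (n%:R * y))| <= D y.

Lemma cvg_step_sqr : mu.-integrable setT (EFin \o (fun y => f y ^+ 2)) /\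
  \sum_(k <- s n) G n k ^+ 2 / n%:R @[n --> \oo] --> \int[mu]_y f y ^+ 2.
Proof.
have [N _ hN] := GD.
(* The shift by [N.+1] makes the index positive, so that cells make sense, and places it in the
   range where the domination holds. *)
pose F n (y : R) := G (n + N.+1)%N (Num.ceil ((n + N.+1)%N%:R * y)).
have n0 n : (0 < n + N.+1)%N by rewrite addnS.
have mF n : measurable_fun setT (F n) by apply: (measurable_step (n0 n) (us _)); exact: Gs.
have [||||||i1 i2] := @Rdominated_cvg_ae R _ _ mu setT (fun n y => F n y ^+ 2)
    (fun y => f y ^+ 2) (fun y => D y ^+ 2).
- by [].
- by move=> n; exact: (measurable_funX 2 (mF n)).
- exact: (measurable_funX 2 mf).
- exists E; split => // y; apply: contra_notP => /Gf hy _.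
  have h : F n y @[n --> \oo] --> f y.
    by have := hy; rewrite -(cvg_shiftn N.+1 (fun n => G n (Num.ceil (n%:R * y)))).
  exact: cvgM.
- exact: iD.
- exists E; split => // y; apply: contra_notP => Ey n _.
  have h : `|F n y| <= D y by apply: hN => //=; rewrite addnS leqW// leq_addl.
  by rewrite normrX ler_pXn2r ?nnegrE// (le_trans _ h).
split => //; rewrite -(cvg_shiftn N.+1 (fun n => \sum_(k <- s n) G n k ^+ 2 / n%:R)).
apply: cvg_trans i2; apply: near_eq_cvg; apply: nearW => n.
rewrite /Rintegral (@integral_step _ (n + N.+1)%N (s (n + N.+1)%N) (n0 n) (us _) (fun k => G (n + N.+1)%N k ^+ 2))//.
- by move=> k ks; rewrite Gs// expr0n.
- by move=> k; exact: sqr_ge0.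
Qed.

(** The squares are dominated by the single function [D^2], so the part above [M] is at most the
    integral of [D^2] where [D^2 > M], which vanishes as [M] grows. *)
Lemma step_sqr_unif_integrable (e : R) : 0 < e -> exists2 M : R, 0 < M &
  \forall n \near \oo, \sum_(k <- s n | M < G n k ^+ 2) G n k ^+ 2 / n%:R <= e.
Proof.
move=> e0.
have [||||||_ h] := @Rdominated_cvg_ae R _ _ mu setT
    (fun m y => if m.+1%:R < D y ^+ 2 then D y ^+ 2 else 0) (cst 0) (fun y => D y ^+ 2).
- by [].
- move=> m; apply: measurable_fun_ifT => //; last exact: measurable_funX.
  by apply: measurable_fun_ltr; [exact: measurable_cst|exact: measurable_funX].
- exact: measurable_cst.
- apply: aeW => y _; apply: cvg_near_cst; exists (Num.truncn (D y ^+ 2)) => // m /= hm.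
  by rewrite ltNge (le_trans (ltW (truncnS_gt _)))// ler_nat ltnS.
- exact: iD.
- by apply: aeW => y m _; case: ifP => _; rewrite ?normr0 ?sqr_ge0// ger0_norm ?sqr_ge0.
have z : \int[mu]_x cst (0 : R) x = 0 by rewrite /Rintegral integral0.
rewrite z in h; move/cvgrPdist_le/(_ _ e0) : h => [m _ /(_ m (leqnn _))] /=.
set J := (X in X m); rewrite sub0r normrN => Je.
exists m.+1%:R => //; have [N _ hN] := GD.
exists N.+1 => // n /= Nn.
pose H k := if m.+1%:R < G n k ^+ 2 then G n k ^+ 2 else 0.
have H0 k : 0 <= H k by rewrite /H; case: ifP => // _; exact: sqr_ge0.
have -> : \sum_(k <- s n | m.+1%:R < G n k ^+ 2) G n k ^+ 2 / n%:R = \sum_(k <- s n) H k / n%:R.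
  by rewrite big_mkcond; apply: eq_bigr => k _; rewrite /H; case: ifP => //; rewrite mul0r.
have Hs k : k \notin s n -> H k = 0 by move=> ks; rewrite /H Gs// expr0n/= ltNge ler0n.
have n0 : (0 < n)%N by exact: leq_trans Nn.
apply: le_trans Je; rewrite ger0_norm; last first.
  by apply: Rintegral_ge0 => y _; case: ifP => // _; exact: sqr_ge0.
have mT : measurable_fun setT (fun y => if m.+1%:R < D y ^+ 2 then D y ^+ 2 else 0).
  apply: measurable_fun_ifT => //; last exact: measurable_funX.
  by apply: measurable_fun_ltr; [exact: measurable_cst|exact: measurable_funX].
have iT : mu.-integrable setT (EFin \o (fun y => if m.+1%:R < D y ^+ 2 then D y ^+ 2 else 0)).
  apply: le_integrable iD => //; first exact/measurable_EFinP.
  by move=> y _; rewrite /= lee_fin; case: ifP => _; rewrite ?normr0.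
rewrite -lee_fin /J /Rintegral fineK; last exact: integrable_fin_num.
rewrite -(integral_step n0 (us _) Hs H0); apply: ae_ge0_le_integral => //.
- by move=> y _; rewrite lee_fin.
- apply/measurable_EFinP; exact: (measurable_step n0 (us _) Hs).
- by move=> y _; rewrite lee_fin; case: ifP => // _; exact: sqr_ge0.
- exact/measurable_EFinP.
exists E; split => // y; apply: contra_notP => Ey _.
have hy := hN _ (ltnW Nn) _ Ey.
rewrite lee_fin /H.
have hy2 : G n (Num.ceil (n%:R * y)) ^+ 2 <= D y ^+ 2.
  by rewrite -[leLHS]real_normK ?num_real// ler_pXn2r ?nnegrE// (le_trans _ hy).
case: ifP => [h1|_]; first by rewrite (lt_le_trans h1).
by case: ifP => // _; exact: sqr_ge0.
Qed.

End step_limit.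

(** * Weights of the innovations *)

Section tapered_filter.
Context {R : realType}.
Implicit Types (a b : nat -> R) (L N : nat) (k q : int).
Context d (T : measurableType d).

(** Partial sums of the tapered filter: dropping the coefficients beyond [L] freezes them at [b L],
    and they are 0 before time 0. *)
Definition tapered b L q : R := if q is Posz m then b (minn m L) else 0.

Lemma tapered_ge0 b L q : 0 <= q -> tapered b L q = b (minn `|q|%N L).
Proof. by case: q. Qed.

Lemma tapered_lt0 b L q : q < 0 -> tapered b L q = 0.
Proof. by case: q. Qed.

(* The coefficient of [xi_k] in the sum of the linear process over [1..N], when [b] is
   the sequence of partial sums of the filter. *)
Definition tapered_block b L N k : R := tapered b L (N%:Z - k) - tapered b L (- k).

Definition taper_support N L : seq int := [seq N%:Z - l%:Z | l <- iota 0 (N + L.+1)].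

Lemma uniq_taper_support N L : uniq (taper_support N L).
Proof. by rewrite map_inj_uniq ?iota_uniq// => x y /(congr1 (fun z => N%:Z - z)); rewrite !subKr => -[]. Qed.

Lemma taper_support_vanish b N N0 L k : (N <= N0)%N -> k \notin taper_support N0 L ->
  tapered_block b L N k = 0.
Proof.
move=> NN0 kS; rewrite /tapered_block.
have [kN|Nk] := ltP N0%:Z k.
  rewrite !tapered_lt0 ?subrr//; lia.
have kL : (L%:Z < - k).
  rewrite ltNge; apply: contra kS => kL; apply/mapP; exists `|N0%:Z - k|%N; last by lia.
  by rewrite mem_iota; lia.
rewrite !tapered_ge0; [|lia..].
by rewrite !(minn_idPr _) ?subrr//; lia.
Qed.

Lemma tapered_psumS a L q :
  tapered (psum a) L q - tapered (psum a) L (q - 1) =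
  if q is Posz m then (if (m <= L)%N then a m else 0) else 0.
Proof.
case: q => [[|m]|m].
- by rewrite /= min0n subr0 /psum /series/= big_nat1.
- have -> : m.+1%:Z - 1 = m%:Z by lia.
  rewrite /=; case: ltnP => h.
    by rewrite (minn_idPl h) psumS addrAC subrr add0r.
  by rewrite (minn_idPr (leqW h)) subrr.
- by rewrite !tapered_lt0 ?subrr//; lia.
Qed.

Lemma linear_processE a (l : R) (X : int -> T -> R) k w : 0 <= l ->
  linear_process a l X k w = \sum_(i < (Num.truncn l).+1) a i * X (k - i%:Z) w.
Proof.
move=> l0; rewrite /linear_process; apply/cvg_lim => //; apply: cvg_near_cst.
exists (Num.truncn l).+1 => // n /= Ln.
rewrite /series/= (@big_cat_nat _ _ _ (Num.truncn l).+1)//= [X in _ + X]big_nat_cond [X in _ + X]big1 ?addr0.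
  rewrite big_mkord; apply: eq_bigr => i _.
  by rewrite -truncn_ge_nat// -ltnS ltn_ord.
move=> i /andP[/andP[Li _] _].
by rewrite -truncn_ge_nat// leqNgt Li/= mul0r.
Qed.

(** A bound [N0] larger than [N] is allowed so that several times can be written over one index set.
    For each [k] the coefficients telescope in [N]. *)
Lemma sum_linear_process a (l : R) (X : int -> T -> R) N N0 w : 0 <= l -> (N <= N0)%N ->
  \sum_(1 <= k < N.+1) linear_process a l X k%:Z w =
  \sum_(k <- taper_support N0 (Num.truncn l)) tapered_block (psum a) (Num.truncn l) N k * X k w.
Proof.
move=> l0 NN0; set L := Num.truncn l; set S := taper_support N0 L.
pose ta q : R := if q is Posz m then (if (m <= L)%N then a m else 0) else 0.
have e1 m : (m <= N0)%N -> linear_process a l X m%:Z w = \sum_(k <- S) ta (m%:Z - k) * X k w.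
  move=> mN; rewrite linear_processE// -/L big_map.
  have [M EM] : exists M, M = L.+1 by exists L.+1.
  rewrite -EM.
  (* Three blocks of innovations: those later than [m], the window from [m] down to [m - L], and
     those too old to be reached by the filter. Only the window contributes. *)
  have -> : (N0 + M = (N0 - m) + (M + m))%N by lia.
  rewrite iotaD big_cat/= [X in X + _]big1_seq ?add0r; last first.
    move=> q /=; rewrite mem_iota add0n => /andP[_ h].
    rewrite (_ : m%:Z - _ = - ((N0 - m)%N - q)%N%:Z)//; last by lia.
    by case: (N0 - m - q)%N (subn_gt0 q (N0 - m)) => [|x _]; [rewrite h|rewrite mul0r].
  rewrite add0n iotaD big_cat/= [X in _ + X]big1_seq ?addr0; last first.
    move=> q /=; rewrite mem_iota => /andP[h _].
    rewrite (_ : m%:Z - _ = (q - (N0 - m))%N%:Z)//; last by lia.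
    by rewrite /ta (_ : (_ <= L)%N = false) ?mul0r//; lia.
  rewrite -[in RHS](addn0 (N0 - m)%N) iotaDl big_map -[in RHS](subn0 M) -/(index_iota 0 M).
  rewrite big_mkord; apply: eq_bigr => i _.
  have -> : m%:Z - (N0%:Z - (N0 - m + i)%N%:Z) = i%:Z by lia.
  have -> : N0%:Z - (N0 - m + i)%N%:Z = m%:Z - i%:Z by lia.
  by rewrite /ta -ltnS -EM ltn_ord.
under eq_big_nat => m /andP[_ mN] do rewrite e1 ?(leq_trans _ NN0)//.
rewrite exchange_big/=; apply: eq_bigr => k _; rewrite -mulr_suml; congr (_ * _).
rewrite /tapered_block; elim: N {NN0} => [|N IH]; first by rewrite big_geq// sub0r subrr.
rewrite big_nat_recr//= IH.
have := tapered_psumS a L (N.+1%:Z - k); rewrite -/(ta (N.+1%:Z - k)).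
have -> : N.+1%:Z - k - 1 = N%:Z - k by lia.
by move=> <-; ring.
Qed.

End tapered_filter.

Section square_integrable.
Context {R : realType}.
Local Notation mu := (@lebesgue_measure R).

Definition sqint (f : R -> R) : Prop := measurable_fun setT f /\
  mu.-integrable setT (EFin \o (fun y => f y ^+ 2)).

Implicit Types f g : R -> R.

Lemma sqintD f g : sqint f -> sqint g -> sqint (fun x => f x + g x).
Proof.
move=> [mf i_f] [mg ig]; have mfg := measurable_funD mf mg; split => //.
have : mu.-integrable setT (EFin \o (fun x => 2 * f x ^+ 2 + 2 * g x ^+ 2)).
  by apply: integrableD_EFin => //; exact: integrableZl_EFin.
apply: le_integrable => //; first by apply/measurable_EFinP; exact: (measurable_funX 2 mfg).
move=> x _; rewrite lee_fin ger0_norm ?sqr_ge0// (le_trans _ (ler_norm _))//.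
have := sqr_ge0 (f x - g x); rewrite sqrrB sqrrD !mulr2n; lra.
Qed.

Lemma sqintZ c f : sqint f -> sqint (fun x => c * f x).
Proof.
move=> [mf i_f]; split; first exact: measurable_funM.
have := integrableZl_EFin measurableT (c ^+ 2) i_f.
by apply: eq_integrable => // x _ /=; rewrite exprMn.
Qed.

Lemma sqint_sum (I : Type) (r : seq I) (f : I -> R -> R) :
  (forall i, sqint (f i)) -> sqint (fun x => \sum_(i <- r) f i x).
Proof.
move=> sf; elim: r => [|i r IH].
  have e : (fun x : R => \sum_(i <- [::]) f i x) = cst 0 by apply/funext => x; rewrite big_nil.
  rewrite e; split; first exact: measurable_cst.
  rewrite (_ : _ \o _ = cst 0%E); first exact: integrable0.
  by apply/funext => x /=; rewrite expr0n.
have -> : (fun x : R => \sum_(i <- i :: r) f i x) = (fun x => f i x + \sum_(i <- r) f i x).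
  by apply/funext => x; rewrite big_cons.
exact: sqintD.
Qed.

Lemma sqint_affine c e f : c != 0 -> sqint f -> sqint (fun x => f (c * x + e)).
Proof.
move=> c0 [mf i_f].
have ma : measurable_fun setT (fun x : R => c * x + e) by apply: measurable_funD => //; exact: measurable_funM.
have mfa : measurable_fun setT (fun x => f (c * x + e)) by exact: measurableT_comp mf ma.
split => //; apply/integrableP; split; first by apply/measurable_EFinP; exact: (measurable_funX 2 mfa).
under eq_integral do rewrite /= ger0_norm ?sqr_ge0//.
rewrite (@ge0_integral_affine _ c e (fun x => f x ^+ 2))//; last first.
- by move=> x; exact: sqr_ge0.
- exact: (measurable_funX 2 mf).
move/integrableP : i_f => [_]; under eq_integral do rewrite /= ger0_norm ?sqr_ge0//.
move=> h; rewrite lte_mul_pinfty// ?lee_fin//.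
Qed.

Definition powR_on (q : R) (i : interval R) (y : R) : R := \1_[set` i] y * y `^ q.

Lemma measurable_powR_on q i : measurable_fun setT (powR_on q i).
Proof.
apply: measurable_funM; first by apply: measurable_indic; exact: measurable_itv.
exact: measurable_powR.
Qed.

Let integral_powR_on_sqr q i :
  (\int[mu]_y (powR_on q i y ^+ 2)%:E = \int[mu]_(y in [set` i]) (y `^ (2 * q))%:E)%E.
Proof.
rewrite [RHS]integral_mkcond; apply: eq_integral => y _; rewrite patchE /powR_on indicE.
case: ifP => _; last by rewrite mul0r expr0n.
by rewrite mul1r mulrC powRrM powR_mulrn ?powR_ge0.
Qed.

Lemma sqint_powR0 q Y : -1 < 2 * q -> 0 <= Y -> sqint (powR_on q `[0, Y]).
Proof.
move=> q1 Y0; split; first exact: measurable_powR_on.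
apply/integrableP; split.
  by apply/measurable_EFinP; exact: (measurable_funX 2 (measurable_powR_on q _)).
under eq_integral do rewrite /= ger0_norm ?sqr_ge0//.
by rewrite integral_powR_on_sqr integral_powR0// ltry.
Qed.

Lemma sqint_powRy q Y : 2 * q < -1 -> 0 < Y -> sqint (powR_on q `[Y, +oo[).
Proof.
move=> q1 Y0; split; first exact: measurable_powR_on.
apply/integrableP; split.
  by apply/measurable_EFinP; exact: (measurable_funX 2 (measurable_powR_on q _)).
under eq_integral do rewrite /= ger0_norm ?sqr_ge0//.
by rewrite integral_powR_on_sqr integral_powRy// ltry.
Qed.

End square_integrable.

Lemma intNpos (k : int) : k <= 0 -> exists m : nat, k = - m%:Z.
Proof. by move=> k0; exists `|k|%N; lia. Qed.

Lemma minn_addn m N l : (m <= l)%N -> exists N', minn (m + N) l = (m + N')%N /\ (N' <= N)%N.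
Proof. by move=> ml; exists (minn (m + N) l - m)%N; split; lia. Qed.

(** * Pointwise limit and domination of the rescaled weights *)

Section weights_limit.
Context {R : realType}.
Local Notation mu := (@lebesgue_measure R).
Variables (b : nat -> R) (L : nat -> nat) (r : nat -> R) (rho : R -> R) (kappa h beta C0 : R).
Hypothesis hb : b m / m.+1%:R `^ h @[m --> \oo] --> kappa.
Hypothesis C00 : 0 <= C0.
Hypothesis b_bound : forall m, `|b m| <= C0 * m.+1%:R `^ h.
Hypothesis b_block : forall m N, `|b (m + N)%N - b m| <= C0 * N%:R * m.+1%:R `^ (- beta).
Hypothesis beta2 : 1 < 2 * beta.
Hypothesis h2 : -1 < 2 * h.
Hypothesis hbeta : 1 - beta <= h.
Hypothesis r0 : forall n, (0 < n)%N -> 0 < r n.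
Hypothesis ry : r @ \oo --> +oo.
Hypothesis rho0 : forall x, 0 < x -> 0 < rho x.
Hypothesis mrho : measurable_fun setT rho.
Hypothesis taper_cvg : forall (x : R) (p : nat -> nat), 0 < x ->
  (p n)%:R / n%:R @[n --> \oo] --> x ->
  (minn (p n) (L n)).+1%:R / r n @[n --> \oo] --> rho x.
Hypothesis taper_bound : forall K : R, 0 < K -> exists2 C : R, 0 < C &
  \forall n \near \oo, forall m, m.+1%:R <= K * n%:R ->
    C^-1 * Num.min 1 (m.+1%:R / n%:R) <= (minn m (L n)).+1%:R / r n <= C.
Hypothesis taper_tail : (\forall n \near \oo, forall m, n%:R <= m.+1%:R :> R -> (L n <= m)%N) \/
  (forall n, r n = n%:R).

(** The profile of the rescaled partial sums; it vanishes for [x <= 0] because an innovation does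
    not act before its own time. *)
Definition limit_step (x : R) : R := if 0 < x then kappa * rho x `^ h else 0.

Let sc n := r n `^ h.

Let sc0 n : (0 < n)%N -> 0 < sc n. Proof. by move=> n0; rewrite powR_gt0// r0. Qed.

Lemma measurable_limit_step : measurable_fun setT limit_step.
Proof.
apply: measurable_fun_ifT; [exact: measurable_fun_ltr| |exact: measurable_cst].
by apply: measurable_funM => //; exact: (measurableT_comp (measurable_powR h)).
Qed.

Let cvg_invn : (n%:R^-1 : R) @[n --> \oo] --> (0 : R).
Proof. by rewrite -(cvg_shiftS (fun n => n%:R^-1 : R)); exact: cvg_harmonic. Qed.

Let cvg_bounded_div (u : nat -> R) (c : R) : (forall n, `|u n| <= c) ->
  u n / n%:R @[n --> \oo] --> (0 : R).
Proof.
move=> uc; apply/norm_cvg0P; apply: (@squeeze_cvgr _ _ _ _ (cst 0) (fun n => c * n%:R^-1)).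
- by apply: nearW => n /=; rewrite normr_ge0/= normrM normfV (ger0_norm (ler0n _ _)) ler_wpM2r ?invr_ge0.
- exact: cvg_cst.
- by rewrite -[X in _ --> X](mulr0 c); apply: cvgM; [exact: cvg_cst|exact: cvg_invn].
Qed.

(** The index is [n x] up to a bounded error, so [minn (p n) (L n)] is equivalent to [rho x] times
    [r n] and the asymptotics of [b] apply. At [x = 0] the sign of the index would be
    undetermined. *)
Lemma tapered_cvg (x : R) (q : nat -> int) (c : R) : x != 0 ->
  (forall n, `|(q n)%:~R - n%:R * x| <= c) ->
  tapered b (L n) (q n) / sc n @[n --> \oo] --> limit_step x.
Proof.
move=> x0 qc; rewrite /limit_step; case: ltP => [xp|xn]; last first.
  have {x0} {}xn : x < 0 by rewrite lt_neqAle x0.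
  apply: cvg_near_cst; near=> n; rewrite tapered_lt0 ?mul0r// -(ltr_int R).
  have hn : c / - x < n%:R.
    near: n; exists (Num.truncn `|c / - x|).+1 => // n /= hn.
    by rewrite (le_lt_trans (ler_norm _))// (lt_le_trans (truncnS_gt _))// ler_nat.
  rewrite ltr_pdivrMr ?oppr_gt0// in hn.
  by have := qc n; rewrite ler_norml => /andP[_]; lra.
pose p n := `|q n|%N.
have qp : \forall n \near \oo, 0 <= q n.
  near=> n; rewrite -(ler_int R).
  have hn : c / x < n%:R.
    near: n; exists (Num.truncn `|c / x|).+1 => // n /= hn.
    by rewrite (le_lt_trans (ler_norm _))// (lt_le_trans (truncnS_gt _))// ler_nat.
  rewrite ltr_pdivrMr// in hn.
  by have := qc n; rewrite ler_norml => /andP[+ _]; lra.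
have px : (p n)%:R / n%:R @[n --> \oo] --> x.
  have hx : x + ((q n)%:~R - n%:R * x) / n%:R @[n --> \oo] --> x.
    by rewrite -[X in _ --> X]addr0; apply: cvgD; [exact: cvg_cst|exact: cvg_bounded_div qc].
  apply: cvg_trans hx; apply: near_eq_cvg; near=> n.
  have n0 : (0 < n)%N by near: n; exists 1%N.
  have : 0 <= q n by near: n.
  rewrite /p; case: (q n) => // m _ /=; rewrite -pmulrn; field.
  by rewrite pnatr_eq0 -lt0n.
have hr := taper_cvg xp px.
pose u n := minn (p n) (L n).
have uy : u @ \oo --> \oo.
  apply/cvgnyPge => A; near=> n.
  have rx2 : rho x / 2 <= (u n).+1%:R / r n.
    near: n; apply: (cvgr_ge _ hr); rewrite ltr_pdivrMr// ltr_pMr ?rho0// ltr1n//.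
  have n0 : (0 < n)%N by near: n; exists 1%N.
  have rA : A.+1%:R / (rho x / 2) <= r n by near: n; move/cvgryPge: ry; exact.
  rewrite ler_pdivrMr ?divr_gt0 ?rho0// in rA.
  rewrite ler_pdivlMr ?r0// mulrC in rx2.
  by have := le_trans rA rx2; rewrite ler_nat.
have h1 : b (u n) / (u n).+1%:R `^ h @[n --> \oo] --> kappa.
  exact: (cvg_comp u _ uy hb).
have h3 := @cvg_powR_base R h _ _ (rho0 xp) hr.
have h4 : b (u n) / (u n).+1%:R `^ h * ((u n).+1%:R / r n) `^ h @[n --> \oo] --> kappa * rho x `^ h.
  exact: cvgM.
apply: cvg_trans h4; apply: near_eq_cvg; near=> n.
have q0 : 0 <= q n by near: n.
have n0 : (0 < n)%N by near: n; exists 1%N.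
rewrite tapered_ge0// -/(u n) /sc -mulrA; congr (_ * _).
rewrite powRM ?invr_ge0 ?(ltW (r0 _))// -[(r n)^-1]powR_inv1 ?(ltW (r0 _))// -powRrM mulN1r powRN.
by rewrite mulrA mulVf ?mul1r// gt_eqF// powR_gt0.
Unshelve. all: by end_near. Qed.

(** The exponent of the possible singularity: the rescaled partial sums stay bounded for [h >= 0]
    and blow up like [x^h] at 0 for [h < 0]. *)
Let h0 := Num.min h 0.

Let powR_base_le (x y q : R) : 0 < x -> x <= y -> q <= 0 -> y `^ q <= x `^ q.
Proof.
move=> x0 xy q0; have y0 : 0 < y by exact: lt_le_trans xy.
rewrite -(opprK q) !(powRN _ (- q)) lef_pV2 ?posrE ?powR_gt0//.
by rewrite ge0_ler_powR ?nnegrE ?oppr_ge0 ?(ltW x0) ?(ltW y0).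
Qed.

(** The upper half of [taper_bound] is used when [h >= 0] and the lower half when [h < 0]; the sum
    of the two powers of [C] covers both signs. *)
Lemma tapered_bound (K : R) : 0 < K -> exists2 C : R, 0 < C &
  \forall n \near \oo, forall m, m.+1%:R <= K * n%:R ->
    `|b (minn m (L n))| / sc n <= C * (1 + (m.+1%:R / n%:R) `^ h0).
Proof.
move=> K0; have [C Cp hC] := taper_bound K0.
have CC : 0 < C `^ h + C^-1 `^ h by rewrite addr_gt0// powR_gt0// invr_gt0.
exists ((C0 + 1) * (C `^ h + C^-1 `^ h)); first by rewrite mulr_gt0// ltr_pwDr.
near=> n => m mK.
have n0 : (0 < n)%N by near: n; exists 1%N.
have nr : 0 < n%:R :> R by rewrite ltr0n.
have /andP[lo hi] : C^-1 * Num.min 1 (m.+1%:R / n%:R) <= (minn m (L n)).+1%:R / r n <= C.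
  by move: m mK; near: n.
set u := minn m (L n) in lo hi *.
apply: (@le_trans _ _ (C0 * (u.+1%:R / r n) `^ h)).
  rewrite ler_pdivrMr ?sc0// (le_trans (b_bound u))// -mulrA ler_wpM2l//.
  by rewrite -powRM ?divfK ?gt_eqF ?r0// ?divr_ge0 ?(ltW (r0 _)).
rewrite -mulrA; apply: (@le_trans _ _ (C0 * ((C `^ h + C^-1 `^ h) * (1 + (m.+1%:R / n%:R) `^ h0)))); last first.
  by rewrite ler_wpM2r// ?lerDl// mulr_ge0 ?(ltW CC)// addr_ge0 ?powR_ge0.
rewrite ler_wpM2l//.
have u0 : 0 < u.+1%:R / r n by rewrite divr_gt0// r0.
have mn0 : 0 < m.+1%:R / n%:R :> R by rewrite divr_gt0.
have [hp|hn] := leP 0 h.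
  apply: (@le_trans _ _ (C `^ h * 1)).
    by rewrite mulr1 ge0_ler_powR ?nnegrE ?(ltW u0) ?(ltW Cp).
  by rewrite ler_pM ?powR_ge0// ?lerDl ?powR_ge0// ler_wpDr ?powR_ge0.
have -> : h0 = h by rewrite /h0 min_l// ltW.
apply: (@le_trans _ _ (C^-1 `^ h * (1 + (m.+1%:R / n%:R) `^ h))); last first.
  by rewrite ler_wpM2r ?addr_ge0 ?powR_ge0// lerDr powR_ge0.
have ci : 0 <= C^-1 by rewrite invr_ge0 ltW.
have mi : 0 < Num.min 1 (m.+1%:R / n%:R) :> R by rewrite lt_min ltr01.
apply: (le_trans (powR_base_le _ lo (ltW hn))); first by rewrite mulr_gt0 ?invr_gt0.
rewrite powRM ?(ltW mi)// ler_wpM2l ?powR_ge0//.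
by case: (leP 1 (m.+1%:R / n%:R)) => _; rewrite ?powR1 ?lerDl ?lerDr ?powR_ge0.
Unshelve. all: by end_near. Qed.

(** Under a strong taper both indices lie beyond [L], and the difference is 0. Otherwise [r n = n],
    and [N] coefficients of size [m^(- beta)] divided by [n^h] give the bound, since
    [1 - beta <= h]. *)
Lemma tapered_tail (K : R) : 0 < K -> \forall n \near \oo, forall m N, n%:R <= m.+1%:R :> R -> N%:R <= K * n%:R ->
  `|b (minn (m + N) (L n)) - b (minn m (L n))| / sc n <= C0 * K * (m.+1%:R / n%:R) `^ (- beta).
Proof.
move=> K0; have rhs0 n m : 0 <= C0 * K * (m.+1%:R / n%:R) `^ (- beta).
  by rewrite mulr_ge0 ?powR_ge0// mulr_ge0// ltW.
case: taper_tail => [hL|hr].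
  near=> n => m N mn NK.
  have Lm : (L n <= m)%N by move: m mn {NK}; near: n.
  by rewrite !(minn_idPr _) ?subrr ?normr0 ?mul0r// (leq_trans Lm)// leq_addr.
exists 1%N => // n n0 m N mn NK.
have nr : 0 < n%:R :> R by rewrite ltr0n.
have [Lm|mL] := leqP (L n) m.
  by rewrite !(minn_idPr _) ?subrr ?normr0 ?mul0r// (leq_trans Lm)// leq_addr.
have [N' [e N'N]] := minn_addn N (ltnW mL).
rewrite e ler_pdivrMr ?sc0//; apply: le_trans (b_block _ _) _.
rewrite -!mulrA ler_wpM2l// /sc hr.
apply: (@le_trans _ _ (K * n%:R * m.+1%:R `^ (- beta))).
  by rewrite ler_wpM2r ?powR_ge0// (le_trans _ NK)// ler_nat.
rewrite -mulrA ler_wpM2l ?(ltW K0)//.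
rewrite powRM ?invr_ge0// mulrC -[leRHS]mulrA ler_wpM2l ?powR_ge0//.
rewrite -[n%:R^-1]powR_inv1// -powRrM mulN1r opprK -powRD; last by rewrite (gt_eqF nr) implybT.
by rewrite -[leLHS]powRr1//; apply: ler_powR; [rewrite ler1n|rewrite -lerBlDl].
Unshelve. all: by end_near. Qed.

Definition rescaled n (t : R) k := tapered_block b (L n) (Num.truncn (n%:R * t)) k / sc n.

Definition limit_kernel (t y : R) : R := limit_step (t - y) - limit_step (- y).

Lemma measurable_limit_kernel t : measurable_fun setT (limit_kernel t).
Proof.
apply: measurable_funB; apply: (measurableT_comp measurable_limit_step).
  exact: measurable_funB.
exact: oppr_measurable.
Qed.

Let trunc_itv n (t : R) : 0 <= t ->
  (Num.truncn (n%:R * t))%:R <= n%:R * t < (Num.truncn (n%:R * t))%:R + 1.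
Proof.
move=> t0; have := truncn_itv (mulr_ge0 (ler0n R n) t0).
by rewrite natr1.
Qed.

Lemma rescaled_cvg (t y : R) : 0 <= t -> y != 0 -> y != t ->
  rescaled n t (Num.ceil (n%:R * y)) @[n --> \oo] --> limit_kernel t y.
Proof.
move=> t0 y0 yt; rewrite /rescaled /tapered_block /limit_kernel.
rewrite (_ : (fun n => _) = (fun n =>
  tapered b (L n) ((Num.truncn (n%:R * t))%:Z - Num.ceil (n%:R * y)) / sc n -
  tapered b (L n) (- Num.ceil (n%:R * y)) / sc n)); last by apply/funext => n; rewrite mulrBl.
apply: cvgB.
- apply: (@tapered_cvg _ _ 2); first by rewrite subr_eq0 eq_sym.
  move=> n; have /andP[h1 h2'] := trunc_itv n t0; have /andP[h3 h4] := ceil_itv (n%:R * y).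
  rewrite intrB -pmulrn mulrBr ler_norml; rewrite intrB in h3; apply/andP; split; lra.
- apply: (@tapered_cvg _ _ 2); first by rewrite oppr_eq0.
  move=> n; have /andP[h3 h4] := ceil_itv (n%:R * y).
  rewrite intrN mulrN ler_norml; rewrite intrB in h3; apply/andP; split; lra.
Qed.

Let tapered_near (C Y : R) n : 0 < C -> 0 <= Y -> (0 < n)%N ->
  (forall m, m.+1%:R <= (Y + 1) * n%:R ->
    `|b (minn m (L n))| / sc n <= C * (1 + (m.+1%:R / n%:R) `^ h0)) ->
  forall (q : int) (x : R), q%:~R <= n%:R * x -> n%:R * x < q%:~R + 2 -> x != 0 -> x <= Y ->
  `|tapered b (L n) q| / sc n <= C * (powR_on 0 `[0, Y] x + powR_on h0 `[0, Y] (2^-1 * x)).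
Proof.
move=> Cp Y0 n0 bC q x.
have nr : 0 < n%:R :> R by rewrite ltr0n.
have pos p i (v : R) : 0 <= powR_on p i v by rewrite mulr_ge0 ?powR_ge0// indicE; case: (_ \in _).
have rhs : 0 <= C * (powR_on 0 `[0, Y] x + powR_on h0 `[0, Y] (2^-1 * x)).
  by rewrite mulr_ge0 ?addr_ge0 ?pos// ltW.
case: q => [m|m] qx xq x00 xY; last by rewrite tapered_lt0// normr0 mul0r.
rewrite /= -pmulrn in qx xq *.
have x0 : 0 <= x by rewrite -(pmulr_rge0 _ nr) (le_trans _ qx).
have xp : 0 < x by rewrite lt_neqAle eq_sym x00.
have m0 : 0 <= m%:R :> R by [].
(* The two roundings cost at most 2, which is recovered by halving [x]: if [n x <= 2] the left side
   is at most 1, otherwise [n x - 1 >= n x / 2]. As [h0 <= 0], the singular power is then bounded at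
   [x / 2]. *)
have nm : n%:R * (2^-1 * x) <= m.+1%:R.
  have [nx|nx] := leP (n%:R * x) 2; last by rewrite -[m.+1%:R]natr1; lra.
  by apply: (@le_trans _ _ 1); [lra|rewrite ler1n].
have mK : m.+1%:R <= (Y + 1) * n%:R.
  rewrite -natr1 mulrDl mul1r mulrC; apply: lerD; last by rewrite ler1n.
  by rewrite (le_trans qx)// ler_wpM2l.
apply: (le_trans (bC _ mK)); rewrite ler_wpM2l ?(ltW Cp)//; apply: lerD.
  by rewrite /powR_on powRr0 mulr1 indicE mem_set//= in_itv/= x0.
rewrite /powR_on indicE mem_set ?mul1r; last by rewrite /= in_itv/=; apply/andP; split; lra.
apply: powR_base_le; [lra| |by rewrite /h0; case: (leP h 0)].
by rewrite ler_pdivlMr// mulrC.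
Qed.

(** For [y >= -1] each of the two partial sums is bounded on its own, with singularities of exponent
    [h0 > -1/2] at [t] and at 0. For [y < -1] the partial sums themselves need not decay, and the
    bound is on their difference. *)
Lemma rescaled_dominated (t : R) : 0 <= t -> exists D : R -> R, sqint D /\
  \forall n \near \oo, forall y, y != 0 -> y != t -> `|rescaled n t (Num.ceil (n%:R * y))| <= D y.
Proof.
move=> t0; pose Y := t + 1; pose K := Y + 1; have K0 : 0 < K by rewrite /K /Y; lra.
have [C Cp hC] := tapered_bound K0.
have hT := tapered_tail K0.
pose D (y : R) := C * (powR_on 0 `[0, Y] (- 1 * y + t) + powR_on h0 `[0, Y] (2^-1 * (- 1 * y + t)))
   + C * (powR_on 0 `[0, Y] (- 1 * y + 0) + powR_on h0 `[0, Y] (2^-1 * (- 1 * y + 0)))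
   + C0 * K * powR_on (- beta) `[1, +oo[ (- 1 * y + 0).
have Y0 : 0 <= Y by rewrite /Y; lra.
have h00 : -1 < 2 * h0 by have := h2; rewrite /h0; case: (leP h 0) => _; lra.
have N10 : (-1 : R) != 0 by rewrite oppr_eq0 oner_eq0.
have s0 : sqint (powR_on 0 `[0, Y]) by apply: sqint_powR0 => //; lra.
have s1 : sqint (powR_on h0 `[0, Y]) by exact: sqint_powR0.
have s2 : sqint (powR_on (- beta) `[1, +oo[).
  by apply: sqint_powRy => //; have := beta2; lra.
exists D; split.
  apply: sqintD; last by apply: sqintZ; exact: sqint_affine.
  apply: sqintD; apply: sqintZ; apply: sqintD; try exact: sqint_affine.
    rewrite (_ : (fun x => _) = (fun x => powR_on h0 `[0, Y] ((- 2^-1) * x + t / 2))).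
      by apply: sqint_affine => //; rewrite oppr_eq0 invr_eq0.
    by apply/funext => x; congr powR_on; field.
  rewrite (_ : (fun x => _) = (fun x => powR_on h0 `[0, Y] ((- 2^-1) * x + 0))).
    by apply: sqint_affine => //; rewrite oppr_eq0 invr_eq0.
  by apply/funext => x; congr powR_on; field.
near=> n => y y0 yt.
have n0 : (0 < n)%N by near: n; exists 1%N.
have nr : 0 < n%:R :> R by rewrite ltr0n.
have n1 : 1 <= n%:R :> R by rewrite ler1n.
have bC : forall m, m.+1%:R <= K * n%:R ->
    `|b (minn m (L n))| / sc n <= C * (1 + (m.+1%:R / n%:R) `^ h0) by near: n.
have bT : forall m N, n%:R <= m.+1%:R :> R -> N%:R <= K * n%:R ->
  `|b (minn (m + N) (L n)) - b (minn m (L n))| / sc n <= C0 * K * (m.+1%:R / n%:R) `^ (- beta).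
  by near: n.
rewrite /rescaled /tapered_block; set N := Num.truncn _; set k := Num.ceil _.
have /andP[N1 N2] : N%:R <= n%:R * t < N%:R + 1 := trunc_itv n t0.
have /andP[k1 k2] : (k - 1)%:~R < n%:R * y <= k%:~R := ceil_itv (n%:R * y).
rewrite intrB in k1.
rewrite normrM normfV (gtr0_norm (sc0 n0)).
rewrite /D; set P1 := powR_on _ _ _; set P2 := powR_on _ _ _; set P3 := powR_on _ _ _.
set P4 := powR_on _ _ _; set P5 := powR_on _ _ _.
have pos q i (x : R) : 0 <= powR_on q i x by rewrite mulr_ge0 ?powR_ge0// indicE; case: (_ \in _).
have Q1 : 0 <= C * (P1 + P2) by rewrite mulr_ge0 ?addr_ge0 ?pos// ltW.
have Q2 : 0 <= C * (P3 + P4) by rewrite mulr_ge0 ?addr_ge0 ?pos// ltW.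
have Q3 : 0 <= C0 * K * P5 by rewrite mulr_ge0 ?pos// mulr_ge0// ltW.
have [yb|yb] := ltP y (- 1).
  (* far from the origin the increment of the partial sums decays like [y^-beta] *)
  have kn : k <= 0.
    rewrite -ltzD1 -(ltr_int R) intrD; have : n%:R * y < 0 by rewrite nmulr_llt0 //; lra.
    lra.
  have [m mk] := intNpos kn.
  rewrite mk !opprK in k1 k2 *.
  rewrite (_ : N%:Z + m%:Z = (m + N)%N%:Z); last by rewrite addrC -PoszD.
  rewrite intrN -pmulrn in k1 k2.
  have nm : n%:R * - y <= m.+1%:R by rewrite -natr1; lra.
  have nm1 : n%:R <= m.+1%:R :> R by rewrite (le_trans _ nm)// ler_peMr//; lra.
  have NK : N%:R <= K * n%:R by rewrite (le_trans N1)// mulrC ler_wpM2r// /K /Y; lra.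
  apply: (le_trans (bT _ _ nm1 NK)); apply: (@le_trans _ _ (C0 * K * P5)); last by lra.
  rewrite ler_wpM2l ?mulr_ge0 ?(ltW K0)//.
  rewrite /P5 /powR_on indicE mem_set ?mul1r; last by rewrite /= in_itv/= andbT; lra.
  apply: powR_base_le; rewrite ?mulN1r ?addr0; [lra| |by have := beta2; lra].
  by rewrite ler_pdivlMr// mulrC.
apply: (@le_trans _ _ (C * (P1 + P2) + C * (P3 + P4))); last by lra.
rewrite (le_trans (ler_wpM2r _ (ler_normB _ _)))// ?invr_ge0 ?(ltW (sc0 n0))// mulrDl.
have one := tapered_near Cp Y0 n0 bC.
apply: lerD; apply: one.
- by rewrite intrB -pmulrn mulN1r; lra.
- by rewrite intrB -pmulrn mulN1r; lra.
- by rewrite mulN1r addrC subr_eq0 eq_sym.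
- by rewrite /Y; lra.
- by rewrite intrN mulN1r addr0; lra.
- by rewrite intrN mulN1r addr0; lra.
- by rewrite mulN1r addr0 oppr_eq0.
- by rewrite /Y; lra.
Unshelve. all: by end_near. Qed.

Section linear_combination.
Variables (m : nat) (t c : 'I_m -> R).
Hypothesis t0 : forall i, 0 <= t i.

(** Any common upper bound of the truncated times serves; a sum is easier to handle than a
    maximum. *)
Let N0 n : nat := \sum_(i < m) Num.truncn (n%:R * t i).
Definition comb_support n := taper_support (N0 n) (L n).
Definition rescaled_comb n k := \sum_(i < m) c i * rescaled n (t i) k.
Definition limit_comb y := \sum_(i < m) c i * limit_kernel (t i) y.

(** The points where the kernels may jump or be singular; pointwise convergence is only claimed off
    this finite set. *)
Let E : set R := [set y | y \in (0 : R) :: [seq t i | i <- enum 'I_m]].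

Let cE : countable E. Proof. exact/finite_set_countable/finite_seq. Qed.

Lemma trunc_le_comb n i : (Num.truncn (n%:R * t i) <= N0 n)%N.
Proof. by rewrite /N0 (bigD1 i)//= leq_addr. Qed.

Lemma rescaled_comb_vanish n k : k \notin comb_support n -> rescaled_comb n k = 0.
Proof.
move=> ks; rewrite /rescaled_comb big1// => i _; rewrite /rescaled.
by rewrite (taper_support_vanish b (trunc_le_comb n i) ks) mul0r mulr0.
Qed.

Let dominated : exists D : R -> R, sqint D /\
  \forall n \near \oo, forall y, ~ E y -> `|rescaled_comb n (Num.ceil (n%:R * y))| <= D y.
Proof.
have [D hD] := choice (fun i => rescaled_dominated (t0 i)).
exists (fun y => \sum_(i < m) `|c i| * D i y); split.
  by apply: sqint_sum => i; apply: sqintZ; have [] := hD i.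
have H : \forall n \near \oo, forall i, forall y, y != 0 -> y != t i ->
    `|rescaled n (t i) (Num.ceil (n%:R * y))| <= D i y.
  by apply: filter_forall => i; have [] := hD i.
apply: filterS H => n hn y Ey; rewrite /rescaled_comb (le_trans (ler_norm_sum _ _ _))//.
apply: ler_sum => i _; rewrite normrM ler_wpM2l//; apply: hn.
- by apply/eqP => y0; apply: Ey; rewrite /E/= inE y0 eqxx.
- by apply/eqP => y0; apply: Ey; rewrite /E/= inE y0 map_f ?orbT// mem_enum.
Qed.

Let pointwise y : ~ E y ->
  rescaled_comb n (Num.ceil (n%:R * y)) @[n --> \oo] --> limit_comb y.
Proof.
move=> Ey; apply: cvg_sumr => i; apply: cvgM; first exact: cvg_cst.
apply: rescaled_cvg => //.
- by apply/eqP => y0; apply: Ey; rewrite /E/= inE y0 eqxx.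
- by apply/eqP => y0; apply: Ey; rewrite /E/= inE y0 map_f ?orbT// mem_enum.
Qed.

Let mlim : measurable_fun setT limit_comb.
Proof. by apply: measurable_sum => i; apply: measurable_funM => //; exact: measurable_limit_kernel. Qed.

Let mE : measurable E. Proof. exact: countable_measurable. Qed.
Let muE : mu E = 0%E. Proof. exact: countable_lebesgue_measure0. Qed.

Theorem comb_sqr_cvg : mu.-integrable setT (EFin \o (fun y => limit_comb y ^+ 2)) /\
  \sum_(k <- comb_support n) rescaled_comb n k ^+ 2 / n%:R @[n --> \oo] --> \int[mu]_y limit_comb y ^+ 2.
Proof.
have [D [[mD iD] hD]] := dominated.
exact: (cvg_step_sqr (fun n => uniq_taper_support (N0 n) (L n)) rescaled_comb_vanish mlim iD mE muE pointwise hD).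
Qed.

Theorem comb_unif_integrable (e : R) : 0 < e -> exists2 M : R, 0 < M &
  \forall n \near \oo,
    \sum_(k <- comb_support n | M < rescaled_comb n k ^+ 2) rescaled_comb n k ^+ 2 / n%:R <= e.
Proof.
have [D [[mD iD] hD]] := dominated.
exact: (step_sqr_unif_integrable (fun n => uniq_taper_support (N0 n) (L n)) rescaled_comb_vanish mD iD mE muE hD).
Qed.

End linear_combination.

End weights_limit.

(** * Growth of the taper *)

Section taper_regimes.
Context {R : realType}.
Implicit Types (gamma c x K : R) (p : nat -> nat).

Lemma cvg_powR_nat_pinfty gamma : 0 < gamma -> (n%:R : R) `^ gamma @[n --> \oo] --> +oo.
Proof.
by move=> g0; rewrite -(cvg_shiftS (fun n => (n%:R : R) `^ gamma)); exact: cvg_powR_pinfty.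
Qed.

Let L gamma n := Num.truncn (n%:R `^ gamma : R).

Let L_itv (l : R) : 0 <= l -> (Num.truncn l)%:R <= l < (Num.truncn l).+1%:R.
Proof. exact: truncn_itv. Qed.


Let powR_sub_small gamma e : 0 < gamma < 1 -> 0 < e ->
  \forall n \near \oo, (n%:R : R) `^ gamma <= e * n%:R.
Proof.
move=> /andP[g0 g1] e0; have g10 : 0 < 1 - gamma by rewrite subr_gt0.
near=> n; have n0 : (0 < n)%N by near: n; exists 1%N.
have nr : 0 < n%:R :> R by rewrite ltr0n.
have h : e^-1 <= n%:R `^ (1 - gamma) by near: n; move/cvgryPge: (cvg_powR_nat_pinfty g10); exact.
rewrite -ler_pdivrMl// mulrC -ler_pdivlMl ?powR_gt0//.
apply: (le_trans h); rewrite powRB ?(gt_eqF nr) ?implybT// powRr1//.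
by rewrite mulrC.
Unshelve. all: by end_near. Qed.

Let powR_super_large gamma K : 1 < gamma ->
  \forall n \near \oo, K * n%:R <= (n%:R : R) `^ gamma.
Proof.
move=> g1; have g10 : 0 < gamma - 1 by rewrite subr_gt0.
near=> n; have n0 : (0 < n)%N by near: n; exists 1%N.
have nr : 0 < n%:R :> R by rewrite ltr0n.
have h : K <= n%:R `^ (gamma - 1) by near: n; move/cvgryPge: (cvg_powR_nat_pinfty g10); exact.
by move: h; rewrite powRB ?(gt_eqF nr) ?implybT// powRr1// ler_pdivlMr.
Unshelve. all: by end_near. Qed.

(** The cut-off [n^gamma] is negligible against [n], so every index of order [n] lies beyond it and
    the limit does not depend on [x]. *)
Lemma strong_taper_cvg gamma x p : 0 < gamma < 1 -> 0 < x ->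
  (p n)%:R / n%:R @[n --> \oo] --> x ->
  (minn (p n) (L gamma n)).+1%:R / n%:R `^ gamma @[n --> \oo] --> (1 : R).
Proof.
move=> g x0 px; have x20 : 0 < x / 2 by rewrite divr_gt0.
apply: (@squeeze_cvgr _ _ _ _ (cst 1) (fun n => 1 + (n%:R `^ gamma)^-1)).
- near=> n; have n0 : (0 < n)%N by near: n; exists 1%N.
  have nr : 0 < n%:R :> R by rewrite ltr0n.
  have h1 : n%:R `^ gamma <= x / 2 * n%:R by near: n; exact: powR_sub_small.
  have h2 : x / 2 <= (p n)%:R / n%:R.
    by near: n; apply: (cvgr_ge _ px); rewrite ltr_pdivrMr// ltr_pMr// ltr1n.
  rewrite ler_pdivlMr// in h2.
  have /andP[l1 l2] := L_itv (powR_ge0 n%:R gamma).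
  have -> : minn (p n) (L gamma n) = L gamma n.
    by apply/minn_idPr; rewrite -(ler_nat R) (le_trans l1)// (le_trans h1).
  have rp : 0 < n%:R `^ gamma :> R by rewrite powR_gt0.
  rewrite /= ler_pdivlMr// mul1r (ltW l2)/= ler_pdivrMr// mulrDl mul1r mulVf ?gt_eqF//.
  by rewrite -natr1 lerD2r.
- exact: cvg_cst.
- rewrite -[X in _ --> X]addr0; apply: cvgD; first exact: cvg_cst.
  rewrite (_ : (fun n => _) = (fun n => n%:R `^ (- gamma))); last first.
    by apply/funext => n; rewrite powRN.
  rewrite -(cvg_shiftS (fun n => n%:R `^ (- gamma) : R)); apply: cvg_powR_0.
  by rewrite oppr_lt0; case/andP: g.
Unshelve. all: by end_near. Qed.

Lemma strong_taper_bound gamma K : 0 < gamma < 1 -> 0 < K -> exists2 C : R, 0 < C &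
  \forall n \near \oo, forall m, m.+1%:R <= K * n%:R ->
    C^-1 * Num.min 1 (m.+1%:R / n%:R) <= (minn m (L gamma n)).+1%:R / n%:R `^ gamma <= C.
Proof.
move=> g K0; exists 2 => //; near=> n => m mK.
have n0 : (0 < n)%N by near: n; exists 1%N.
have nr : 0 < n%:R :> R by rewrite ltr0n.
have rp : 0 < n%:R `^ gamma :> R by rewrite powR_gt0.
have r1 : 1 <= n%:R `^ gamma :> R.
  by rewrite -[leLHS](powRr0 n%:R) ler_powR ?ler1n//; case/andP: g => /ltW.
have rn : n%:R `^ gamma <= n%:R :> R.
  by rewrite -[leRHS]powRr1// ler_powR ?ler1n//; case/andP: g => _ /ltW.
have /andP[l1 l2] := L_itv (powR_ge0 n%:R gamma).
have Lr : (L gamma n).+1%:R <= 2 * n%:R `^ gamma :> R.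
  by rewrite -natr1 mulr_natl mulr2n lerD.
have i2 : 2^-1 <= 1 :> R by rewrite invf_le1// ler1n.
have m0 : 0 <= Num.min 1 (m.+1%:R / n%:R) :> R by rewrite le_min ler01 divr_ge0.
apply/andP; split; last first.
  by rewrite ler_pdivrMr// (le_trans _ Lr)// ler_nat ltnS geq_minr.
rewrite (le_trans (ler_wpM2r m0 i2))// mul1r.
have [mL|mL] := leqP m (L gamma n).
  by rewrite ge_min; apply/orP; right; rewrite ler_wpM2l// lef_pV2.
by rewrite ge_min ler_pdivlMr// mul1r (ltW l2).
Unshelve. all: by end_near. Qed.

Lemma strong_taper_tail gamma : 0 < gamma < 1 ->
  \forall n \near \oo, forall m, n%:R <= m.+1%:R :> R -> (L gamma n <= m)%N.
Proof.
move=> g; near=> n => m; rewrite ler_nat => nm.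
have n2 : (2 <= n)%N by near: n; exists 2%N.
have h1 : n%:R `^ gamma <= 2^-1 * n%:R :> R by near: n; apply: powR_sub_small.
have /andP[l1 l2] := L_itv (powR_ge0 n%:R gamma).
have : (2 <= n%:R :> R) by rewrite ler_nat.
have : n%:R <= m%:R + 1 :> R by rewrite natr1 ler_nat.
by rewrite -(ler_nat R); lra.
Unshelve. all: by end_near. Qed.

Let cvg_succ_ratio p x : (p n)%:R / n%:R @[n --> \oo] --> x ->
  (p n).+1%:R / n%:R @[n --> \oo] --> x.
Proof.
move=> px; rewrite (_ : (fun n => _) = (fun n => (p n)%:R / n%:R + n%:R^-1)).
  rewrite -[X in _ --> X]addr0; apply: cvgD => //.
  by rewrite -(cvg_shiftS (fun n => n%:R^-1 : R)); exact: cvg_harmonic.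
by apply/funext => n; rewrite -natr1 mulrDl mul1r.
Qed.

Lemma weak_taper_cvg gamma x p : 1 < gamma -> 0 < x ->
  (p n)%:R / n%:R @[n --> \oo] --> x ->
  (minn (p n) (L gamma n)).+1%:R / n%:R @[n --> \oo] --> x.
Proof.
move=> g x0 px; apply: cvg_trans (cvg_succ_ratio px); apply: near_eq_cvg; near=> n.
have n0 : (0 < n)%N by near: n; exists 1%N.
have nr : 0 < n%:R :> R by rewrite ltr0n.
have h1 : (x + 1) * n%:R <= n%:R `^ gamma :> R by near: n; exact: powR_super_large.
have h2 : (p n)%:R / n%:R <= x + 1 by near: n; apply: (cvgr_le _ px); rewrite ltrDl.
rewrite ler_pdivrMr// in h2.
have /andP[l1 l2] := L_itv (powR_ge0 n%:R gamma).
rewrite (minn_idPl _)// -ltnS -(ltr_nat R).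
exact: le_lt_trans (le_trans h2 h1) l2.
Unshelve. all: by end_near. Qed.

Lemma weak_taper_bound gamma K : 1 < gamma -> 0 < K -> exists2 C : R, 0 < C &
  \forall n \near \oo, forall m, m.+1%:R <= K * n%:R ->
    C^-1 * Num.min 1 (m.+1%:R / n%:R) <= (minn m (L gamma n)).+1%:R / n%:R <= C.
Proof.
move=> g K0; exists (K + 1); first by rewrite addr_gt0.
near=> n => m mK.
have n0 : (0 < n)%N by near: n; exists 1%N.
have nr : 0 < n%:R :> R by rewrite ltr0n.
have h1 : K * n%:R <= n%:R `^ gamma :> R by near: n; exact: powR_super_large.
have /andP[l1 l2] := L_itv (powR_ge0 n%:R gamma).
rewrite (minn_idPl _); last first.
  by rewrite -ltnS -(ltr_nat R) (le_lt_trans _ l2)// (le_trans _ h1)// (le_trans _ mK)// ler_nat.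
have m0 : 0 <= Num.min 1 (m.+1%:R / n%:R) :> R by rewrite le_min ler01 divr_ge0.
have i2 : (K + 1)^-1 <= 1 by rewrite invf_le1 ?lerDr ?(ltW K0)// addr_gt0.
rewrite (le_trans (ler_wpM2r m0 i2))/=; last by rewrite mul1r ge_min lexx orbT.
by rewrite ler_pdivrMr// (le_trans mK)// ler_wpM2r// lerDl.
Unshelve. all: by end_near. Qed.

Lemma moderate_taper_cvg c x p : 0 < c -> 0 < x ->
  (p n)%:R / n%:R @[n --> \oo] --> x ->
  (minn (p n) (Num.truncn (c * n%:R))).+1%:R / n%:R @[n --> \oo] --> Num.min x c.
Proof.
move=> c0 x0 px.
have hL : (Num.truncn (c * n%:R)).+1%:R / n%:R @[n --> \oo] --> c.
  apply: (@squeeze_cvgr _ _ _ _ (cst c) (fun n => c + n%:R^-1)).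
  - near=> n; have n0 : (0 < n)%N by near: n; exists 1%N.
    have nr : 0 < n%:R :> R by rewrite ltr0n.
    have /andP[l1 l2] := L_itv (mulr_ge0 (ltW c0) (ltW nr)).
    rewrite /= ler_pdivlMr// (ltW l2)/= ler_pdivrMr// mulrDl mulVf ?gt_eqF//.
    by rewrite -natr1 lerD2r.
  - exact: cvg_cst.
  - rewrite -[X in _ --> X]addr0; apply: cvgD; first exact: cvg_cst.
    by rewrite -(cvg_shiftS (fun n => n%:R^-1 : R)); exact: cvg_harmonic.
have := cvg_succ_ratio px => {}px.
apply/cvgrPdist_le => e e0.
move/cvgrPdist_le/(_ _ e0) : px => px; move/cvgrPdist_le/(_ _ e0) : hL => hL.
near=> n; have n0 : (0 < n)%N by near: n; exists 1%N.
have nr : 0 < n%:R :> R by rewrite ltr0n.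
have h1 : `|x - (p n).+1%:R / n%:R| <= e by near: n.
have h2 : `|c - (Num.truncn (c * n%:R)).+1%:R / n%:R| <= e by near: n.
have -> : (minn (p n) (Num.truncn (c * n%:R))).+1%:R / n%:R =
    Num.min ((p n).+1%:R / n%:R) ((Num.truncn (c * n%:R)).+1%:R / n%:R) :> R.
  case: (leqP (p n) (Num.truncn (c * n%:R))) => pl.
    by rewrite min_l// ler_wpM2r ?invr_ge0// ler_nat ltnS.
  by rewrite min_r// ler_wpM2r ?invr_ge0// ler_nat ltnS ltnW.
move: h1 h2; set u := _ / _; set v := _ / _; rewrite !ler_norml => /andP[? ?] /andP[? ?].
by case: (leP x c); case: (leP u v) => *; apply/andP; split; lra.
Unshelve. all: by end_near. Qed.

Lemma moderate_taper_bound c K : 0 < c -> 0 < K -> exists2 C : R, 0 < C &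
  \forall n \near \oo, forall m, m.+1%:R <= K * n%:R ->
    C^-1 * Num.min 1 (m.+1%:R / n%:R) <= (minn m (Num.truncn (c * n%:R))).+1%:R / n%:R <= C.
Proof.
move=> c0 K0; have c10 : 0 < c^-1 by rewrite invr_gt0.
have C0 : 0 < K + 1 + c^-1 by lra.
exists (K + 1 + c^-1) => //.
near=> n => m mK.
have n0 : (0 < n)%N by near: n; exists 1%N.
have nr : 0 < n%:R :> R by rewrite ltr0n.
have /andP[l1 l2] := L_itv (mulr_ge0 (ltW c0) (ltW nr)).
have m0 : 0 <= Num.min 1 (m.+1%:R / n%:R) :> R by rewrite le_min ler01 divr_ge0.
apply/andP; split; last first.
  rewrite ler_pdivrMr// (le_trans (y := m.+1%:R))// ?ler_nat ?ltnS ?geq_minl//.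
  by rewrite (le_trans mK)// ler_wpM2r//; lra.
case: (leqP m (Num.truncn (c * n%:R))) => pl.
  have i2 : (K + 1 + c^-1)^-1 <= 1 by rewrite invf_le1//; lra.
  by rewrite (le_trans (ler_wpM2r m0 i2))// mul1r ge_min lexx orbT.
have i3 : (K + 1 + c^-1)^-1 <= c by rewrite invf_ple ?posrE//; lra.
have m1 : Num.min 1 (m.+1%:R / n%:R) <= 1 :> R by rewrite ge_min lexx.
apply: (@le_trans _ _ (c * 1)); first by rewrite ler_pM ?invr_ge0// ltW.
by rewrite mulr1 ler_pdivlMr// ltW.
Unshelve. all: by end_near. Qed.

End taper_regimes.

(** * Limit variances *)

Section affine_Rintegral.
Context {R : realType}.
Local Notation mu := (@lebesgue_measure R).
Implicit Types (f : R -> R) (c e : R).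

Lemma Rintegral_affine c e f : c != 0 -> measurable_fun setT f -> (forall x, 0 <= f x) ->
  \int[mu]_x f (c * x + e) = `|c|^-1 * \int[mu]_x f x.
Proof.
move=> c0 mf f0; have nc : 0 < `|c|^-1 by rewrite invr_gt0 normr_gt0.
rewrite /Rintegral (ge0_integral_affine e c0 mf f0).
have : (0 <= \int[mu]_x (f x)%:E)%E by apply: integral_ge0 => x _; rewrite lee_fin.
by case: (\int[mu]_x _)%E => [r _||]//=; rewrite ?gt0_muley ?lte_fin//= mulr0.
Qed.

Lemma integrable_affine c e f : c != 0 -> measurable_fun setT f -> (forall x, 0 <= f x) ->
  mu.-integrable setT (EFin \o f) -> mu.-integrable setT (EFin \o (fun x => f (c * x + e))).
Proof.
move=> c0 mf f0 /integrableP[_ i_f].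
have ma : measurable_fun setT (fun x : R => c * x + e) by apply: measurable_funD => //; exact: measurable_funM.
apply/integrableP; split; first by apply/measurable_EFinP; exact: (measurableT_comp mf ma).
move: i_f; under eq_integral do rewrite /= ger0_norm//.
move=> i_f; under eq_integral do rewrite /= ger0_norm//.
move: i_f; rewrite (ge0_integral_affine e c0 mf f0) => h; rewrite lte_mul_pinfty// ?lee_fin// invr_ge0.
Qed.

End affine_Rintegral.

Section energy.
Context {R : realType}.
Local Notation mu := (@lebesgue_measure R).
Variable Phi : R -> R.
Hypothesis mPhi : measurable_fun setT Phi.
Hypothesis Phi0 : forall x, x <= 0 -> Phi x = 0.

(** When [Phi] is a power this is the Mandelbrot-Van Ness kernel of fractional Brownian motion. *)
Definition increment_kernel (t y : R) : R := Phi (t - y) - Phi (- y).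

Definition energy (t : R) : R := \int[mu]_y increment_kernel t y ^+ 2.

Let mPhi_affine (c e : R) : measurable_fun setT (fun y => Phi (c * y + e)).
Proof. by apply: (measurableT_comp mPhi); apply: measurable_funD => //; exact: measurable_funM. Qed.

Lemma measurable_increment_kernel t : measurable_fun setT (increment_kernel t).
Proof.
apply: measurable_funB.
  have := mPhi_affine (-1) t; apply: eq_measurable_fun => y _; congr Phi; ring.
have := mPhi_affine (-1) 0; apply: eq_measurable_fun => y _; congr Phi; ring.
Qed.

Lemma energy0 : energy 0 = 0.
Proof.
rewrite /energy /increment_kernel; under eq_Rintegral do rewrite sub0r subrr expr0n/=.
by rewrite /Rintegral integral0.
Qed.

(** Substituting [t y] for [y] separates the innovations inside the summation range, the first
    integral, from those of the past, the second integral after a reflection. Beyond [t] both terms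
    of the kernel vanish. The constants of the statement have the same two parts. *)
Lemma energy_split t : 0 < t ->
  mu.-integrable setT (EFin \o (fun y => increment_kernel t y ^+ 2)) ->
  [/\ mu.-integrable `[0, 1] (EFin \o (fun y => Phi (t * (1 - y)) ^+ 2)),
      mu.-integrable `[0, +oo[ (EFin \o (fun y => (Phi (t * (1 + y)) - Phi (t * y)) ^+ 2)) &
      energy t = t * (\int[mu]_(y in `[0, 1]) Phi (t * (1 - y)) ^+ 2 +
        \int[mu]_(y in `[0, +oo[) (Phi (t * (1 + y)) - Phi (t * y)) ^+ 2)].
Proof.
move=> t0 ik; have tn0 : t != 0 by rewrite gt_eqF.
pose phi (y : R) := (Phi (t * (1 - y)) - Phi (- (t * y))) ^+ 2.
have phiE y : phi y = increment_kernel t (t * y + 0) ^+ 2.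
  by rewrite /phi /increment_kernel; congr ((Phi _ - Phi _) ^+ 2); ring.
have mk2 : measurable_fun setT (fun y => increment_kernel t y ^+ 2).
  exact: (measurable_funX 2 (measurable_increment_kernel t)).
have mphi : measurable_fun setT phi.
  rewrite (_ : phi = (fun y => increment_kernel t (t * y + 0) ^+ 2)); last exact/funext.
  apply: (measurableT_comp mk2); apply: measurable_funD => //; exact: measurable_funM.
have phi0 y : 0 <= phi y by exact: sqr_ge0.
have iphi : mu.-integrable setT (EFin \o phi).
  rewrite (_ : phi = (fun y => increment_kernel t (t * y + 0) ^+ 2)); last exact/funext.
  apply: (@integrable_affine _ t 0 (fun y => increment_kernel t y ^+ 2)) => //.
  by move=> y; exact: sqr_ge0.
have eE : energy t = t * \int[mu]_y phi y.
  rewrite (_ : phi = (fun y => increment_kernel t (t * y + 0) ^+ 2)); last exact/funext.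
  rewrite (@Rintegral_affine _ t 0 (fun y => increment_kernel t y ^+ 2))//.
    by rewrite gtr0_norm// mulrA divff// mul1r.
  by move=> y; exact: sqr_ge0.
have iS (A : set R) : measurable A -> mu.-integrable A (EFin \o phi).
  by move=> mA; apply: integrableS iphi.
have i1 : mu.-integrable `[0, 1] (EFin \o (fun y => Phi (t * (1 - y)) ^+ 2)).
  have := iS _ (measurable_itv `[0, 1]); apply: eq_integrable => // y.
  rewrite inE/= in_itv/= => /andP[y0 y1]; rewrite /phi (Phi0 (x := - (t * y))) ?subr0//.
  by rewrite oppr_le0 mulr_ge0// ltW.
pose psi (y : R) := (Phi (t * (1 + y)) - Phi (t * y)) ^+ 2.
have psiE y : psi y = phi (- 1 * y + 0).
  by rewrite /phi /psi; congr ((Phi _ - Phi _) ^+ 2); ring.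
have i2 : mu.-integrable `[0, +oo[ (EFin \o psi).
  rewrite (_ : psi = (fun y => phi (- 1 * y + 0))); last exact/funext.
  have : mu.-integrable setT (EFin \o (fun y => phi (- 1 * y + 0))).
    by apply: integrable_affine => //; rewrite oppr_eq0 oner_eq0.
  by apply: integrableS.
split => //; rewrite eE; congr (_ * _).
have -> : \int[mu]_y phi y = \int[mu]_(y in `]-oo, 0]) phi y + (\int[mu]_(y in `]0, 1]) phi y + \int[mu]_(y in `]1, +oo[) phi y).
  have h1 := @Rintegral_itvB R phi -oo%O +oo%O 0; have h2 := @Rintegral_itvB R phi (BRight 0) +oo%O 1.
  rewrite set_itvNyy in h1.
  by rewrite -h2 ?bnd_simp// ?subrKC -?h1 ?subrKC//; exact: iS.
have -> : \int[mu]_(y in `]1, +oo[) phi y = 0.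
  rewrite (@eq_Rintegral _ _ _ _ _ (cst 0)); first by rewrite /Rintegral integral0.
  move=> y; rewrite inE/= in_itv/= andbT => y1; rewrite /phi !Phi0 ?subrr ?expr0n//.
    by rewrite oppr_le0 mulr_ge0// ?(ltW t0)//; lra.
  by rewrite pmulr_rle0//; lra.
rewrite addr0 addrC; congr (_ + _).
  rewrite Rintegral_itv_obnd_cbnd; last exact: iS.
  apply: eq_Rintegral => y; rewrite inE/= in_itv/= => /andP[y0 y1].
  by rewrite /phi (Phi0 (x := - (t * y))) ?subr0// oppr_le0 mulr_ge0// ltW.
rewrite Rintegral_mkcond [RHS]Rintegral_mkcond.
have N10 : (-1 : R) != 0 by rewrite oppr_eq0 oner_eq0.
transitivity (\int[mu]_x (phi \_ `]-oo, 0]) (-1 * x + 0)).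
  rewrite (@Rintegral_affine _ (-1) 0 (phi \_ `]-oo, 0]))//.
  - by rewrite normrN normr1 invr1 mul1r.
  - rewrite (_ : phi \_ _ = (fun y : R => if y <= 0 then phi y else 0)).
      by apply: measurable_fun_ifT => //; exact: measurable_fun_ler.
    by apply/funext => y; rewrite patchE; congr (if _ then _ else _); apply/idP/idP; rewrite inE/= in_itv.
  - by move=> y; rewrite patchE; case: ifP.
apply: eq_Rintegral => y _; rewrite !patchE -/(psi y) psiE.
suff -> : (-1 * y + 0 \in `]-oo, (0 : R)]%classic) = (y \in `[(0 : R), +oo[%classic) by [].
by apply/idP/idP; rewrite !inE/= !in_itv/= andbT; lra.
Qed.

Hypothesis ik : forall t, 0 <= t -> mu.-integrable setT (EFin \o (fun y => increment_kernel t y ^+ 2)).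

Lemma energy_diff s t : 0 <= s -> 0 <= t ->
  \int[mu]_y (increment_kernel t y - increment_kernel s y) ^+ 2 = energy `|t - s|.
Proof.
wlog st : s t / s <= t => [h s0 t0|s0 _].
  have [st|/ltW ts] := leP s t; first exact: h.
  rewrite distrC -(h t s)//; apply: eq_Rintegral => y _.
  by rewrite -sqrrN opprB.
rewrite ger0_norm ?subr_ge0// /energy.
rewrite -[RHS]mul1r -[in RHS]invr1 -[in RHS](normr1 R) -(@Rintegral_affine _ 1 (- s) (fun y => increment_kernel (t - s) y ^+ 2))//.
- apply: eq_Rintegral => y _; rewrite /increment_kernel; congr (_ ^+ 2).
  have -> : t - s - (1 * y - s) = t - y by ring.
  have -> : - (1 * y - s) = s - y by ring.
  ring.
- exact: (measurable_funX 2 (measurable_increment_kernel (t - s))).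
- by move=> y; exact: sqr_ge0.
Qed.

Lemma energy_gram (m : nat) (t c : 'I_m -> R) : (forall i, 0 <= t i) ->
  \int[mu]_y (\sum_(i < m) c i * increment_kernel (t i) y) ^+ 2 =
  \sum_(i < m) \sum_(k < m) c i * c k *
    (2^-1 * (energy (t i) + energy (t k) - energy `|t i - t k|)).
Proof.
move=> t0.
have ikk i k : mu.-integrable setT (EFin \o (fun y => (increment_kernel (t i) y - increment_kernel (t k) y) ^+ 2)).
  have [_] : sqint (fun y => increment_kernel (t i) y + (-1) * increment_kernel (t k) y).
    apply: sqintD; first by split; [exact: measurable_increment_kernel|exact: ik].
    by apply: sqintZ; split; [exact: measurable_increment_kernel|exact: ik].
  by apply: eq_integrable => // y _ /=; rewrite mulN1r.
pose g i k y := 2^-1 * (increment_kernel (t i) y ^+ 2 + (increment_kernel (t k) y ^+ 2 +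
  (-1) * (increment_kernel (t i) y - increment_kernel (t k) y) ^+ 2)).
have iN i k : mu.-integrable setT (EFin \o (fun y => (-1) * (increment_kernel (t i) y - increment_kernel (t k) y) ^+ 2)).
  exact: integrableZl_EFin.
have i2 i k : mu.-integrable setT (EFin \o (fun y => increment_kernel (t k) y ^+ 2 +
  (-1) * (increment_kernel (t i) y - increment_kernel (t k) y) ^+ 2)).
  by apply: integrableD_EFin => //; exact: ik.
have i3 i k : mu.-integrable setT (EFin \o (fun y => increment_kernel (t i) y ^+ 2 + (increment_kernel (t k) y ^+ 2 +
  (-1) * (increment_kernel (t i) y - increment_kernel (t k) y) ^+ 2))).
  by apply: integrableD_EFin => //; exact: ik.
have ig i k : mu.-integrable setT (EFin \o g i k) by exact: integrableZl_EFin.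
have gE i k : \int[mu]_y g i k y = 2^-1 * (energy (t i) + energy (t k) - energy `|t i - t k|).
  rewrite /g (RintegralZl _ measurableT (i3 i k)); congr (_ * _).
  rewrite (RintegralD measurableT (ik (t0 i)) (i2 i k)) -addrA; congr (_ + _).
  rewrite (RintegralD measurableT (ik (t0 k)) (iN i k)); congr (_ + _).
  by rewrite (RintegralZl _ measurableT (ikk i k)) energy_diff// mulN1r.
have E y : (\sum_(i < m) c i * increment_kernel (t i) y) ^+ 2 =
    \sum_(i < m) \sum_(k < m) c i * c k * g i k y.
  rewrite expr2 mulr_suml; apply: eq_bigr => i _; rewrite mulr_sumr; apply: eq_bigr => k _.
  by rewrite /g; field.
under eq_Rintegral do rewrite E.
have icg i k : mu.-integrable setT (EFin \o (fun y => c i * c k * g i k y)) by exact: integrableZl_EFin.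
have hs i := Rintegral_sum (index_enum 'I_m) measurableT (icg i).
have [_ ->] := Rintegral_sum (index_enum 'I_m) measurableT (fun i => (hs i).1).
apply: eq_bigr => i _; rewrite (hs i).2; apply: eq_bigr => k _.
by rewrite (RintegralZl _ measurableT (ig i k)) gE.
Qed.

End energy.

Section inner_integrals.
Context {R : realType}.
Local Notation mu := (@lebesgue_measure R).
Variables (beta : R).
Local Notation h := (1 - beta).

Lemma Rintegral_powR_shift01 (y b : R) : beta != 1 -> 0 < y -> 0 <= b ->
  \int[mu]_(x in `[0, b]) (x + y) `^ (- beta) = ((b + y) `^ h - y `^ h) / h.
Proof.
move=> b1 y0 b0; rewrite /Rintegral integral_powR_shift ?add0r//; last by rewrite eqr_opp.
by rewrite /= (addrC (- beta)).
Qed.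

Lemma Rintegral_powR0 (b : R) : beta < 1 -> 0 <= b ->
  \int[mu]_(x in `[0, b]) x `^ (- beta) = b `^ h / h.
Proof. by move=> b1 b0; rewrite /Rintegral integral_powR0 ?ltrN2//= addrC. Qed.

Lemma Rintegral_powRy (b : R) : 1 < beta -> 0 < b ->
  \int[mu]_(x in `[b, +oo[) x `^ (- beta) = - (b `^ h / h).
Proof. by move=> b1 b0; rewrite /Rintegral integral_powRy ?ltrN2//= addrC. Qed.

(** End points are left out of the hypothesis because inner integrals may diverge there, in which
    case [Rintegral] returns a default value. *)
Lemma eq_Rintegral_itvoo (p q : R) (f g : R -> R) : measurable_fun setT g ->
  (forall y, p < y < q -> f y = g y) ->
  \int[mu]_(y in `[p, q]) f y = \int[mu]_(y in `[p, q]) g y.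
Proof.
move=> mg fg; have fg' : {in `]p, q[, f =1 g} by move=> y; rewrite in_itv/=; exact: fg.
rewrite /Rintegral; congr fine; apply: eq_integral_itv_bounded fg'.
  apply: (eq_measurable_fun g); last exact: measurable_funTS.
  by move=> y; rewrite inE/= in_itv/= => /fg ->.
exact: measurable_funTS.
Qed.

Lemma eq_Rintegral_itvoy (p : R) (f g : R -> R) : measurable_fun setT g ->
  (forall y, p < y -> f y = g y) ->
  \int[mu]_(y in `[p, +oo[) f y = \int[mu]_(y in `[p, +oo[) g y.
Proof.
move=> mg fg.
have mf : measurable_fun `]p, +oo[ f.
  apply: (eq_measurable_fun g); last exact: measurable_funTS.
  by move=> y; rewrite inE/= in_itv/= andbT => /fg.
rewrite /Rintegral; congr fine.
rewrite -integral_itv_obnd_cbnd; last exact/measurable_EFinP.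
rewrite -[RHS]integral_itv_obnd_cbnd; last by apply/measurable_EFinP; exact: measurable_funTS.
by apply: eq_integral => y; rewrite inE/= in_itv/= andbT => /fg ->.
Qed.

End inner_integrals.

(** * Comparison of energies with the constants of the statement *)

Section energy_constants.
Context {R : realType}.
Local Notation mu := (@lebesgue_measure R).

(** With [u = t^(1 - beta)] this produces the factor [t^(3 - 2 beta)]. Letting [Psi] differ from
    [Phi] accounts for a moderate taper, whose level [c] becomes [c / t] under the scaling. *)
Lemma energy_scale (Phi Psi : R -> R) (t u : R) : 0 < t -> measurable_fun setT Phi ->
  (forall x, Phi (t * x) = u * Psi x) -> energy Phi t = t * u ^+ 2 * energy Psi 1 /\
  (mu.-integrable setT (EFin \o (fun y => increment_kernel Phi t y ^+ 2)) -> u != 0 ->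
   mu.-integrable setT (EFin \o (fun y => increment_kernel Psi 1 y ^+ 2))).
Proof.
move=> t0 mPhi PP; have tn0 : t != 0 by rewrite gt_eqF.
have mk2 : measurable_fun setT (fun y => increment_kernel Phi t y ^+ 2).
  exact: (measurable_funX 2 (measurable_increment_kernel mPhi t)).
have e y : increment_kernel Phi t (t * y + 0) ^+ 2 = u ^+ 2 * increment_kernel Psi 1 y ^+ 2.
  rewrite -exprMn /increment_kernel mulrBr -!PP; congr ((Phi _ - Phi _) ^+ 2); ring.
have k0 y : 0 <= increment_kernel Phi t y ^+ 2 by exact: sqr_ge0.
split.
  have := Rintegral_affine 0 tn0 mk2 k0; rewrite gtr0_norm// => hE.
  have -> : energy Phi t = t * (t^-1 * energy Phi t) by rewrite mulrA divff// mul1r.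
  rewrite {2}/energy -hE -mulrA; congr (_ * _); rewrite /energy.
  under eq_Rintegral do rewrite e.
  have [->|u0] := eqVneq u 0.
    by rewrite expr0n/= mul0r; under eq_Rintegral do rewrite mul0r; rewrite /Rintegral integral0.
  rewrite /Rintegral; under eq_integral do rewrite EFinM.
  rewrite ge0_integralZl//.
  - have : (0 <= \int[mu]_x (increment_kernel Psi 1 x ^+ 2)%:E)%E.
      by apply: integral_ge0 => x _; rewrite lee_fin sqr_ge0.
    case: (\int[mu]_x _)%E => [r _||]//=; rewrite ?gt0_muley ?lte_fin ?exprn_even_gt0//= mulr0//.
  - have -> : (fun x : R => (increment_kernel Psi 1 x ^+ 2)%:E) =
        EFin \o (fun y => u ^- 2 * increment_kernel Phi t (t * y + 0) ^+ 2).
      by apply/funext => y /=; rewrite e mulrA mulVf ?mul1r// expf_neq0.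
    apply/measurable_EFinP/measurable_funM => //; apply: (measurableT_comp mk2).
    by apply: measurable_funD => //; exact: measurable_funM.
  - by move=> y _; rewrite lee_fin sqr_ge0.
  - by rewrite lee_fin sqr_ge0.
move=> ik u0; have := @integrable_affine R t 0 _ tn0 mk2 k0 ik.
move=> /(integrableZl_EFin measurableT (u ^- 2)); apply: eq_integrable => // y _ /=.
by rewrite e mulrA mulVf ?mul1r// expf_neq0.
Qed.

Variables (beta : R).
Hypotheses (beta1 : beta != 1).
Local Notation h := (1 - beta).

Let h0 : h != 0. Proof. by rewrite subr_eq0 eq_sym. Qed.

Definition truncated_power (z x : R) : R := if 0 < x then h^-1 * Num.min x z `^ h else 0.

Let mtp z : measurable_fun setT (truncated_power z).
Proof.
apply: measurable_fun_ifT => //; first exact: measurable_fun_ltr.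
apply: measurable_funM => //; apply: (measurableT_comp (measurable_powR h)).
exact: measurable_minr.
Qed.

Let tp0 z x : x <= 0 -> truncated_power z x = 0.
Proof. by rewrite /truncated_power ltNge => ->. Qed.

Let mR (z : R) : measurable_fun setT (fun y : R => (truncated_power z (1 * (1 + y)) - truncated_power z (1 * y)) ^+ 2).
Proof.
apply: (measurable_funX 2); apply: measurable_funB; apply: (measurableT_comp (mtp z)).
  by apply: measurable_funM => //; exact: measurable_funD.
exact: measurable_funM.
Qed.

Let mL (z : R) : measurable_fun setT (fun y : R => truncated_power z (1 * (1 - y)) ^+ 2).
Proof.
apply: (measurable_funX 2); apply: (measurableT_comp (mtp z)).
by apply: measurable_funM => //; exact: measurable_funB.
Qed.

Variables (c t : R).
Hypotheses (c0 : 0 < c) (t0 : 0 < t).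
Local Notation z := (c / t).
Hypothesis ik : mu.-integrable setT (EFin \o (fun y => increment_kernel (truncated_power z) 1 y ^+ 2)).

Let z0 : 0 < z. Proof. by rewrite divr_gt0. Qed.

(** For [y >= z] both arguments are truncated and the difference is 0. Below [z] only [1 + y] may be
    truncated, which happens for [y >= z - 1]; hence the two ranges of [Pint] when [z >= 1] and the
    single one when [z < 1]. *)
Lemma Pint_energy :
  \int[mu]_(y in `[0, +oo[) (truncated_power z (1 * (1 + y)) - truncated_power z (1 * y)) ^+ 2 = Pint t beta c.
Proof.
have [_ i2 _] := energy_split (mtp z) (@tp0 z) ltr01 ik.
have zz := z0.
have split1 (p : R) : 0 <= p -> 
  \int[mu]_(y in `[0, +oo[) (truncated_power z (1 * (1 + y)) - truncated_power z (1 * y)) ^+ 2 =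
  \int[mu]_(y in `[0, p]) (truncated_power z (1 * (1 + y)) - truncated_power z (1 * y)) ^+ 2 +
  \int[mu]_(y in `[p, +oo[) (truncated_power z (1 * (1 + y)) - truncated_power z (1 * y)) ^+ 2.
  move=> p0; rewrite -(@Rintegral_itv_obnd_cbnd _ p); last first.
    by apply: integrableS i2 => //; apply: subset_itvr; rewrite bnd_simp.
  by rewrite -(Rintegral_itvB i2) ?bnd_simp// subrKC.
have tail : \int[mu]_(y in `[z, +oo[) (truncated_power z (1 * (1 + y)) - truncated_power z (1 * y)) ^+ 2 = 0.
  rewrite (@eq_Rintegral _ _ _ _ _ (cst 0)); first by rewrite /Rintegral integral0.
  move=> y; rewrite inE/= in_itv/= andbT => zy; rewrite /truncated_power !mul1r.
  by rewrite !ifT ?min_r ?subrr ?expr0n//; lra.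
have sqrE (y u v : R) : (h^-1 * u - h^-1 * v) ^+ 2 = ((u - v) / h) ^+ 2.
  by congr (_ ^+ 2); rewrite -mulrBr mulrC.
rewrite /Pint; case: ifP => tc.
  have z1 : 1 <= z by rewrite ler_pdivlMr// mul1r.
  rewrite (split1 z (ltW zz)) tail addr0.
  have i3 : mu.-integrable `[0, z] (EFin \o (fun y => (truncated_power z (1 * (1 + y)) - truncated_power z (1 * y)) ^+ 2)).
    by apply: integrableS i2 => //; apply: subset_itvl.
  have -> : \int[mu]_(y in `[0, z]) (truncated_power z (1 * (1 + y)) - truncated_power z (1 * y)) ^+ 2 =
    \int[mu]_(y in `[0, z - 1]) (truncated_power z (1 * (1 + y)) - truncated_power z (1 * y)) ^+ 2 +
    \int[mu]_(y in `[z - 1, z]) (truncated_power z (1 * (1 + y)) - truncated_power z (1 * y)) ^+ 2.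
    rewrite -(@Rintegral_itv_obnd_cbnd _ (z - 1)); last first.
      by apply: integrableS i3 => //; apply: subset_itvr; rewrite bnd_simp; lra.
    by rewrite -(Rintegral_itvB i3) ?bnd_simp ?subrKC//; lra.
  congr (_ + _); apply: esym; apply: eq_Rintegral_itvoo => // y /andP[y1 y2].
    rewrite Rintegral_powR_shift01//; try lra.
    rewrite /truncated_power !mul1r !ifT; try lra.
    by rewrite !min_l ?sqrE//; lra.
  rewrite Rintegral_powR_shift01//; try lra.
  rewrite /truncated_power !mul1r !ifT; try lra.
  by rewrite min_r ?min_l ?sqrE ?subrK//; lra.
have z1 : z < 1 by rewrite ltr_pdivrMr// mul1r ltNge tc.
rewrite (split1 z (ltW zz)) tail addr0.
apply: esym; apply: eq_Rintegral_itvoo => // y /andP[y1 y2].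
rewrite Rintegral_powR_shift01//; try lra.
rewrite /truncated_power !mul1r !ifT; try lra.
by rewrite min_r ?min_l ?sqrE ?subrK//; lra.
Qed.

(** The inner integral [g] is prescribed up to sign: it equals [b^h / h] for [beta < 1] and its
    opposite, an integral to infinity, for [beta > 1]. *)
Lemma energy_left (g : R -> R) : (forall b, 0 < b -> g b ^+ 2 = (b `^ h / h) ^+ 2) ->
  \int[mu]_(y in `[0, 1]) truncated_power z (1 * (1 - y)) ^+ 2 =
  if t <= c then \int[mu]_(y in `[0, 1]) g (1 - y) ^+ 2 else
    \int[mu]_(y in `[0, 1 - z]) g z ^+ 2 + \int[mu]_(y in `[1 - z, 1]) g (1 - y) ^+ 2.
Proof.
move=> gE; have zz := z0.
have [i1 _ _] := energy_split (mtp z) (@tp0 z) ltr01 ik.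
case: ifP => tc.
  have z1 : 1 <= z by rewrite ler_pdivlMr// mul1r.
  apply: esym; apply: eq_Rintegral_itvoo => // y /andP[y0 y1].
  rewrite gE; last by lra.
  rewrite /truncated_power mul1r ifT; last by lra.
  by rewrite min_l; [rewrite mulrC|lra].
have z1 : z < 1 by rewrite ltr_pdivrMr// mul1r ltNge tc.
have -> : \int[mu]_(y in `[0, 1]) truncated_power z (1 * (1 - y)) ^+ 2 =
  \int[mu]_(y in `[0, 1 - z]) truncated_power z (1 * (1 - y)) ^+ 2 +
  \int[mu]_(y in `[1 - z, 1]) truncated_power z (1 * (1 - y)) ^+ 2.
  rewrite -(@Rintegral_itv_obnd_cbnd _ (1 - z)); last first.
    by apply: integrableS i1 => //; apply: subset_itvr; rewrite bnd_simp; lra.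
  by rewrite -(Rintegral_itvB i1) ?bnd_simp ?subrKC//; lra.
congr (_ + _); apply: esym; apply: eq_Rintegral_itvoo => // y /andP[y0 y1]; rewrite gE; try lra.
  rewrite /truncated_power mul1r ifT; last by lra.
  by rewrite min_r; [rewrite mulrC|lra].
rewrite /truncated_power mul1r ifT; last by lra.
by rewrite min_l; [rewrite mulrC|lra].
Qed.

Lemma K7_energy : beta < 1 -> energy (truncated_power z) 1 = K7 t beta c.
Proof.
move=> b1; have [_ _ ->] := energy_split (mtp z) (@tp0 z) ltr01 ik.
rewrite mul1r Pint_energy addrC /K7; congr (_ + _).
rewrite (energy_left (g := fun b => \int[mu]_(x in `[0, b]) x `^ (- beta)))//.
by move=> b b0; rewrite Rintegral_powR0// ltW.
Qed.

Lemma K9_energy : 1 < beta -> energy (truncated_power z) 1 = K9 t beta c.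
Proof.
move=> b1; have [_ _ ->] := energy_split (mtp z) (@tp0 z) ltr01 ik.
rewrite mul1r Pint_energy addrC /K9; congr (_ + _).
rewrite (energy_left (g := fun b => \int[mu]_(x in `[b, +oo[) x `^ (- beta)))//.
by move=> b b0; rewrite Rintegral_powRy// sqrrN.
Qed.

End energy_constants.

Section untruncated_energy.
Context {R : realType}.
Local Notation mu := (@lebesgue_measure R).

Lemma energy_gt0 (Phi : R -> R) (m : R) : measurable_fun setT Phi -> (forall x, x <= 0 -> Phi x = 0) ->
  mu.-integrable setT (EFin \o (fun y => increment_kernel Phi 1 y ^+ 2)) ->
  0 < m -> (forall x, 2^-1 <= x <= 1 -> m <= Phi x ^+ 2) -> 0 < energy Phi 1.
Proof.
move=> mPhi Phi0 ik m0 hm; have [i1 _ ->] := energy_split mPhi Phi0 ltr01 ik.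
rewrite mul1r ltr_pwDl//; last by apply: Rintegral_ge0 => y _; exact: sqr_ge0.
have i2 : mu.-integrable `[0, 2^-1] (EFin \o (fun y => Phi (1 * (1 - y)) ^+ 2)).
  by apply: integrableS i1 => //; apply: subset_itvl; rewrite bnd_simp invf_le1// ler1n.
apply: (@lt_le_trans _ _ (\int[mu]_(y in `[0, 2^-1]) Phi (1 * (1 - y)) ^+ 2)); last first.
  rewrite -[leRHS](subrKC (\int[mu]_(y in `[0, 2^-1]) Phi (1 * (1 - y)) ^+ 2)).
  rewrite (Rintegral_itvB i1) ?bnd_simp ?invr_ge0// ?invf_le1 ?ler1n// lerDl.
  by apply: Rintegral_ge0 => y _; exact: sqr_ge0.
apply: (@lt_le_trans _ _ (\int[mu]_(y in `[0, 2^-1]) m)).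
  rewrite Rintegral_cst//= lebesgue_measure_itv/= lte_fin invr_gt0 ltr0n/= subr0.
  by rewrite mulr_gt0// invr_gt0.
apply: le_Rintegral => //.
- apply/integrableP; split; first exact: measurable_cst.
  rewrite integral_cst//= lebesgue_measure_itv/= lte_fin invr_gt0 ltr0n/= -EFinB -EFinM.
  exact: ltry.
- move=> y; rewrite /= in_itv/= => /andP[y0 y1]; apply: hm; rewrite mul1r; lra.
Qed.

Lemma energy_jump (kappa t : R) (Phi : R -> R) : 0 < t -> measurable_fun setT Phi ->
  (forall x, Phi x = if 0 < x then kappa else 0) ->
  mu.-integrable setT (EFin \o (fun y => increment_kernel Phi t y ^+ 2)) ->
  energy Phi t = kappa ^+ 2 * t.
Proof.
move=> t0 mPhi PhiE ik.
have Phi0 (x : R) : x <= 0 -> Phi x = 0 by rewrite PhiE ltNge => ->.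
have [_ _ ->] := energy_split mPhi Phi0 t0 ik.
rewrite (@eq_Rintegral_itvoo _ 0 1 _ (cst (kappa ^+ 2)))//; last first.
  by move=> y /andP[y0 y1]; rewrite PhiE mulr_gt0// subr_gt0.
rewrite (@eq_Rintegral_itvoy _ 0 _ (cst 0))//; last first.
  move=> y y0; rewrite !PhiE !mulr_gt0// ?subrr ?expr0n//.
  by rewrite addr_gt0.
rewrite Rintegral_cst//= lebesgue_measure_itv/= lte_fin ltr01/= subr0.
by rewrite /Rintegral integral0/= addr0 mulr1 mulrC.
Qed.

Variables (beta : R).
Hypotheses (beta1 : beta != 1) (beta32 : beta < 3 / 2).
Local Notation h := (1 - beta).

Let h0 : h != 0. Proof. by rewrite subr_eq0 eq_sym. Qed.

Definition power_step (x : R) : R := if 0 < x then h^-1 * x `^ h else 0.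

Let mps : measurable_fun setT power_step.
Proof.
apply: measurable_fun_ifT => //; first exact: measurable_fun_ltr.
by apply: measurable_funM => //; exact: measurable_powR.
Qed.

Let ps0 x : x <= 0 -> power_step x = 0.
Proof. by rewrite /power_step ltNge => ->. Qed.

Hypothesis ik : mu.-integrable setT (EFin \o (fun y => increment_kernel power_step 1 y ^+ 2)).

Let mps_affine (u v : R) : measurable_fun setT (fun y => power_step (u * y + v)).
Proof. by apply: (measurableT_comp mps); apply: measurable_funD => //; exact: measurable_funM. Qed.

Let C1_energy : \int[mu]_(y in `[0, +oo[) (power_step (1 * (1 + y)) - power_step (1 * y)) ^+ 2 = C1 beta.
Proof.
apply: esym; apply: eq_Rintegral_itvoy.
  apply: (measurable_funX 2); apply: measurable_funB; last first.
    by have := mps_affine 1 0; apply: eq_measurable_fun => y _; rewrite addr0.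
  by have := mps_affine 1 1; apply: eq_measurable_fun => y _; rewrite mulrDr mulr1 addrC.
move=> y y0; rewrite Rintegral_powR_shift01// /power_step !mul1r y0 ifT; last by rewrite addr_gt0.
by congr (_ ^+ 2); rewrite -mulrBr mulrC.
Qed.

Let left_measurable : measurable_fun setT (fun y : R => power_step (1 * (1 - y)) ^+ 2).
Proof.
apply: (measurable_funX 2).
by have := mps_affine (-1) 1; apply: eq_measurable_fun => y _; rewrite mul1r mulN1r addrC.
Qed.

Lemma power_step_energy : energy power_step 1 = ((1 - beta) ^+ 2 * (3 - 2 * beta))^-1 + C1 beta.
Proof.
have b32 := beta32; have [_ _ ->] := energy_split mps (@ps0) ltr01 ik.
rewrite mul1r C1_energy; congr (_ + _).
(* Reflecting [1 - y] to [y] leaves the integral of [y^(2 h)] over [0, 1], which is [1 / (2 h + 1)],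
   that is [1 / (3 - 2 beta)]. *)
pose k (y : R) := (y `^ (2 * h)) * \1_`[0, 1] y.
have mk : measurable_fun setT k.
  by apply: measurable_funM; [exact: measurable_powR|exact: measurable_indic].
have k0 y : 0 <= k y by rewrite mulr_ge0 ?powR_ge0// indicE; case: (_ \in _).
have e2 : \int[mu]_y k y = (3 - 2 * beta)^-1.
  transitivity (\int[mu]_(y in `[0, 1]) y `^ (2 * h)).
    rewrite [RHS]Rintegral_mkcond; apply: eq_Rintegral => y _; rewrite patchE /k indicE.
    by case: ifP => _; rewrite ?mulr1 ?mulr0.
  rewrite /Rintegral integral_powR0//=; last by lra.
  by rewrite powR1 mul1r; congr (_^-1); ring.
transitivity (\int[mu]_(y in `[0, 1]) (h ^- 2 * k (-1 * y + 1))).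
  apply: eq_Rintegral_itvoo.
    apply: measurable_funM => //; apply: (measurableT_comp mk).
    by apply: measurable_funD => //; exact: measurable_funM.
  move=> y /andP[y0 y1]; rewrite /power_step mul1r ifT; last by lra.
  rewrite /k indicE mem_set; last by rewrite /= in_itv/=; apply/andP; split; lra.
  rewrite mulr1 exprMn exprVn mulN1r (addrC _ 1); congr (_ * _).
  by rewrite mulrC powRrM powR_mulrn ?powR_ge0.
rewrite Rintegral_mkcond.
transitivity (\int[mu]_y (h ^- 2 * k (-1 * y + 1))).
  apply: eq_Rintegral => y _; rewrite patchE; case: ifPn => //.
  rewrite notin_setE/= in_itv/= => yn; rewrite /k indicE memNset ?mulr0//=.
  by move=> /=; rewrite in_itv/= => yi; apply: yn; move: yi; lra.
have N10 : (-1 : R) != 0 by rewrite oppr_eq0 oner_eq0.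
rewrite (@Rintegral_affine _ (-1) 1 (fun y => h ^- 2 * k y))//.
- rewrite normrN normr1 invr1 mul1r.
  rewrite (_ : \int[mu]_x (h ^- 2 * k x) = h ^- 2 * \int[mu]_x k x); last first.
    rewrite RintegralZl//; apply/integrableP; split; first exact/measurable_EFinP.
    under eq_integral do rewrite /= ger0_norm//.
    rewrite (_ : (\int[mu]_x (k x)%:E = \int[mu]_(x in `[0%R, 1%R]) (x `^ (2 * h))%:E)%E).
      by rewrite integral_powR0 ?ltry//; lra.
    rewrite [RHS]integral_mkcond; apply: eq_integral => y _; rewrite patchE /k indicE.
    by case: ifP => _; rewrite ?mulr1 ?mulr0.
  by rewrite [RHS]invfM; congr (_ * _); exact: e2.
- exact: measurable_funM.
- by move=> y; rewrite mulr_ge0// invr_ge0 sqr_ge0.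
Qed.

Lemma power_step_energy_tail : 1 < beta ->
  energy power_step 1 = \int[mu]_(v in `[0, 1]) (\int[mu]_(u in `[1 - v, +oo[) u `^ (- beta)) ^+ 2 + C1 beta.
Proof.
move=> b1; have [_ _ ->] := energy_split mps (@ps0) ltr01 ik.
rewrite mul1r C1_energy; congr (_ + _).
apply: esym; apply: eq_Rintegral_itvoo => // y /andP[y0 y1].
rewrite Rintegral_powRy//; last by lra.
by rewrite sqrrN /power_step mul1r ifT; [rewrite mulrC|lra].
Qed.

Lemma power_step_energy_gt0 : 0 < energy power_step 1.
Proof.
(* The minimum covers both signs of [h]: on [1/2, 1] the power [x^h] is at least [2^(- h)] if
   [h >= 0] and at least 1 if [h < 0]. *)
apply: (@energy_gt0 power_step (h^-1 ^+ 2 * (Num.min 1 (2^-1 `^ h)) ^+ 2)) => //.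
  by rewrite mulr_gt0// exprn_even_gt0//= ?invr_neq0// gt_eqF// lt_min ltr01 powR_gt0 ?invr_gt0.
move=> x /andP[x1 x2]; have x0 : 0 < x by lra.
rewrite /power_step x0 exprMn ler_wpM2l ?sqr_ge0//.
have m0 : 0 <= Num.min 1 (2^-1 `^ h) :> R by rewrite le_min ler01 powR_ge0.
rewrite ler_pXn2r ?nnegrE ?powR_ge0//.
have [hp|hn] := leP 0 h.
  by rewrite ge_min; apply/orP; right; rewrite ge0_ler_powR ?nnegrE ?(ltW x0) ?invr_ge0.
rewrite ge_min; apply/orP; left.
rewrite -[leLHS](powRr0 x) ; apply: ger_powR; last exact: ltW.
by rewrite x0.
Qed.

End untruncated_energy.

Section truncated_energy.
Context {R : realType}.
Local Notation mu := (@lebesgue_measure R).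

Lemma truncated_power_energy_gt0 (beta z : R) : beta != 1 -> 0 < z ->
  mu.-integrable setT (EFin \o (fun y => increment_kernel (truncated_power beta z) 1 y ^+ 2)) ->
  0 < energy (truncated_power beta z) 1.
Proof.
move=> b1 z0 ik; set h := 1 - beta.
have hn0 : h != 0 by rewrite subr_eq0 eq_sym.
have mz : 0 < Num.min 2^-1 z by rewrite lt_min invr_gt0 ltr0n.
apply: (@energy_gt0 _ _ (h^-1 ^+ 2 * (Num.min 1 (Num.min 2^-1 z `^ h)) ^+ 2)) => //.
- apply: measurable_fun_ifT => //; first exact: measurable_fun_ltr.
  apply: measurable_funM => //; apply: (measurableT_comp (measurable_powR _)).
  exact: measurable_minr.
- by move=> x; rewrite /truncated_power ltNge => ->.
- by rewrite mulr_gt0// exprn_even_gt0//= ?invr_neq0// gt_eqF// lt_min ltr01 powR_gt0.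
move=> x /andP[x1 x2]; have x0 : 0 < x by lra.
rewrite /truncated_power x0 -/h exprMn ler_wpM2l ?sqr_ge0//.
have m0 : 0 <= Num.min 1 (Num.min 2^-1 z `^ h) :> R by rewrite le_min ler01 powR_ge0.
have xz0 : 0 < Num.min x z by rewrite lt_min x0.
have xz1 : Num.min x z <= 1 by rewrite ge_min x2.
have xzl : Num.min 2^-1 z <= Num.min x z.
  by rewrite le_min !ge_min x1 lexx orbT.
rewrite ler_pXn2r ?nnegrE ?powR_ge0//.
have [hp|hn] := leP 0 h.
  by rewrite ge_min; apply/orP; right; rewrite ge0_ler_powR ?nnegrE ?(ltW mz) ?(ltW xz0).
rewrite ge_min; apply/orP; left.
rewrite -[leLHS](powRr0 (Num.min x z)); apply: ger_powR; last exact: ltW.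
by rewrite xz0.
Qed.

End truncated_energy.

(** * Limits of the weights in the nine cases *)

Section normalized_weights.
Context {R : realType}.
Local Notation mu := (@lebesgue_measure R).

(* [L n] is the cut-off, [r n] the scale at which the partial sums of the filter are seen
   by the sum of [n] terms; [rho] is constant, the identity or [min x c] for a strong, weak or
   moderate taper. *)
Record taper_regime (L : nat -> nat) (r : nat -> R) (rho : R -> R) : Prop := TaperRegime {
  regime_gt0 : forall n, (0 < n)%N -> 0 < r n;
  regime_pinfty : r @ \oo --> +oo;
  regime_rho_gt0 : forall x, 0 < x -> 0 < rho x;
  regime_rho_measurable : measurable_fun setT rho;
  regime_cvg : forall (x : R) (p : nat -> nat), 0 < x ->
    (p n)%:R / n%:R @[n --> \oo] --> x ->
    (minn (p n) (L n)).+1%:R / r n @[n --> \oo] --> rho x;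
  regime_bound : forall K : R, 0 < K -> exists2 C : R, 0 < C &
    \forall n \near \oo, forall m, m.+1%:R <= K * n%:R ->
      C^-1 * Num.min 1 (m.+1%:R / n%:R) <= (minn m (L n)).+1%:R / r n <= C;
  regime_tail : (\forall n \near \oo, forall m, n%:R <= m.+1%:R :> R -> (L n <= m)%N) \/
    (forall n, r n = n%:R) }.

(** The exponent [h] is [1 - beta] for types (i) and (iii) and 0 for type (ii). Differences get
    their own bound in [growth_block]: square integrability at infinity relies on their being
    smaller than the partial sums. *)
Record filter_growth (b : nat -> R) (kappa h beta C : R) : Prop := FilterGrowth {
  growth_cvg : b m / m.+1%:R `^ h @[m --> \oo] --> kappa;
  growth_ge0 : 0 <= C;
  growth_bound : forall m, `|b m| <= C * m.+1%:R `^ h;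
  growth_block : forall m N, `|b (m + N)%N - b m| <= C * N%:R * m.+1%:R `^ (- beta);
  growth_beta : 1 < 2 * beta;
  growth_h : -1 < 2 * h;
  growth_h_beta : 1 - beta <= h }.

Variables (b : nat -> R) (L : nat -> nat) (r : nat -> R) (rho : R -> R) (kappa h beta C0 : R).
Hypotheses (tr : taper_regime L r rho) (fg : filter_growth b kappa h beta C0).
Local Notation Phi := (limit_step rho kappa h).

Let ssq m (t c : 'I_m -> R) (t0 : forall i, 0 <= t i) :=
  let: TaperRegime r1 r2 r3 r4 r5 r6 r7 := tr in
  let: FilterGrowth g1 g2 g3 g4 g5 g6 g7 := fg in
  comb_sqr_cvg g1 g2 g3 g4 g5 g6 g7 r1 r2 r3 r4 r5 r6 r7 c t0.

Let sui m (t c : 'I_m -> R) (t0 : forall i, 0 <= t i) (e : R) : 0 < e -> exists2 M : R, 0 < M &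
  \forall n \near \oo,
    \sum_(k <- comb_support L t n | M < rescaled_comb b L r h t c n k ^+ 2)
      rescaled_comb b L r h t c n k ^+ 2 / n%:R <= e.
Proof.
case: tr => r1 r2 r3 r4 r5 r6 r7; case: fg => g1 g2 g3 g4 g5 g6 g7.
by apply: comb_unif_integrable; eassumption.
Qed.

Lemma measurable_Phi : measurable_fun setT Phi.
Proof. exact: measurable_limit_step (regime_rho_measurable tr). Qed.

Lemma integrable_increment t : 0 <= t ->
  mu.-integrable setT (EFin \o (fun y => increment_kernel Phi t y ^+ 2)).
Proof.
move=> t0; have [i1 _] := @ssq 1 (fun=> t) (fun=> 1) (fun=> t0).
move: i1; apply: eq_integrable => // y _; congr EFin.
by rewrite /limit_comb big_ord1 mul1r.
Qed.

Variables (Asq : nat -> R) (A : R) (W : R -> R).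
Hypotheses (A0 : 0 < A) (AsqE : forall n, (0 < n)%N -> Asq n = A * (n%:R * (r n `^ h) ^+ 2)).
Hypothesis WE : forall t, 0 <= t -> energy Phi t = A * W t.

Definition block_weight n (t : R) k := tapered_block b (L n) (Num.truncn (n%:R * t)) k / Num.sqrt (Asq n).

Let comb_weight m (t c : 'I_m -> R) n k : R := \sum_(i < m) c i * block_weight n (t i) k.

Let comb_weight_sqr m (t c : 'I_m -> R) n k : (0 < n)%N ->
  comb_weight t c n k ^+ 2 = A^-1 * (rescaled_comb b L r h t c n k ^+ 2 / n%:R).
Proof.
move=> n0; have nr : 0 < n%:R :> R by rewrite ltr0n.
have rn := regime_gt0 tr n0; have sn : 0 < r n `^ h by rewrite powR_gt0.
have -> : comb_weight t c n k = rescaled_comb b L r h t c n k * (r n `^ h / Num.sqrt (Asq n)).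
  rewrite /comb_weight /rescaled_comb mulr_suml; apply: eq_bigr => i _.
  by rewrite /block_weight /rescaled -!mulrA; congr (_ * (_ * _)); rewrite mulKf// gt_eqF.
rewrite exprMn expr_div_n sqr_sqrtr; last by rewrite AsqE// !mulr_ge0 ?sqr_ge0// ltW.
rewrite AsqE//; field.
by rewrite !gt_eqF.
Qed.

(** The constant [A] occurs both in the normalization and in the energy, and cancels. *)
Theorem block_weight_sqr_cvg m (t c : 'I_m -> R) : (forall i, 0 <= t i) ->
  \sum_(k <- comb_support L t n) (\sum_(i < m) c i * block_weight n (t i) k) ^+ 2 @[n --> \oo] -->
  \sum_(i < m) \sum_(k < m) c i * c k * (2^-1 * (W (t i) + W (t k) - W `|t i - t k|)).
Proof.
move=> t0; have [_ h1] := ssq c t0.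
have -> : \sum_(i < m) \sum_(k < m) c i * c k * (2^-1 * (W (t i) + W (t k) - W `|t i - t k|)) =
   A^-1 * \int[mu]_y limit_comb rho kappa h t c y ^+ 2.
  rewrite [X in _ * X](energy_gram measurable_Phi integrable_increment c t0) mulr_sumr.
  apply: eq_bigr => i _; rewrite mulr_sumr; apply: eq_bigr => k _.
  by rewrite !WE//; field; rewrite gt_eqF.
have h2 : A^-1 * \sum_(k <- comb_support L t n) rescaled_comb b L r h t c n k ^+ 2 / n%:R @[n --> \oo] -->
    A^-1 * \int[mu]_y limit_comb rho kappa h t c y ^+ 2.
  by apply: cvgM => //; exact: cvg_cst.
apply: cvg_trans h2; apply: near_eq_cvg; near=> n.
have n0 : (0 < n)%N by near: n; exists 1%N.
by rewrite mulr_sumr; apply: eq_bigr => k _; rewrite -comb_weight_sqr.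
Unshelve. all: by end_near. Qed.

Theorem block_weight_unif_integrable m (t c : 'I_m -> R) (e : R) : (forall i, 0 <= t i) -> 0 < e ->
  exists2 M : R, 0 < M & \forall n \near \oo,
    \sum_(k <- comb_support L t n | M < n%:R * (\sum_(i < m) c i * block_weight n (t i) k) ^+ 2)
      (\sum_(i < m) c i * block_weight n (t i) k) ^+ 2 <= e.
Proof.
move=> t0 e0; have Ae : 0 < A * e by rewrite mulr_gt0.
have [M M0 h1] := sui c t0 Ae; exists (M / A); first by rewrite divr_gt0.
near=> n; have n0 : (0 < n)%N by near: n; exists 1%N.
have nr : 0 < n%:R :> R by rewrite ltr0n.
have : \sum_(k <- comb_support L t n | M < rescaled_comb b L r h t c n k ^+ 2)
    rescaled_comb b L r h t c n k ^+ 2 / n%:R <= A * e by near: n.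
rewrite -ler_pdivrMl//; apply: le_trans; rewrite mulr_sumr le_eqVlt; apply/orP; left; apply/eqP.
apply: eq_big => k => [|_]; last exact: comb_weight_sqr.
have e1 := comb_weight_sqr t c k n0; rewrite /comb_weight in e1; rewrite {}e1.
rewrite ltr_pdivrMr//; congr (_ < _); field.
by rewrite !gt_eqF.
Unshelve. all: by end_near. Qed.

End normalized_weights.

Section regimes.
Context {R : realType}.
Implicit Types (gamma c t C : R) (r : nat -> R).

Lemma strong_regime gamma : 0 < gamma < 1 ->
  taper_regime (fun n => Num.truncn (n%:R `^ gamma : R)) (fun n => n%:R `^ gamma) (fun=> 1).
Proof.
move=> g; split.
- by move=> n n0; rewrite powR_gt0// ltr0n.
- by apply: cvg_powR_nat_pinfty; case/andP: g.
- by [].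
- exact: measurable_cst.
- by move=> x p x0 px; exact: (strong_taper_cvg g x0 px).
- by move=> K K0; exact: strong_taper_bound.
- by left; exact: strong_taper_tail.
Qed.

Let natr_pinfty : (n%:R : R) @[n --> \oo] --> +oo.
Proof. by apply/cvgryPge => A; near=> n; near: n; exact: nbhs_infty_ger. Unshelve. all: by end_near. Qed.

Lemma weak_regime gamma : 1 < gamma ->
  taper_regime (fun n => Num.truncn (n%:R `^ gamma : R)) (fun n => n%:R : R) idfun.
Proof.
move=> g; split => //.
- by move=> n n0; rewrite ltr0n.
- exact: (@measurable_id _ _ setT).
- by move=> x p x0 px; exact: (weak_taper_cvg g x0 px).
- by move=> K K0; exact: weak_taper_bound.
- by right.
Qed.

Lemma moderate_regime c : 0 < c ->
  taper_regime (fun n => Num.truncn (c * n%:R)) (fun n => n%:R) (fun x => Num.min x c).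
Proof.
move=> c0; split => //.
- by move=> n n0; rewrite ltr0n.
- by move=> x x0; rewrite lt_min x0.
- exact: measurable_minr.
- by move=> x p x0 px; exact: (moderate_taper_cvg c0 x0 px).
- by move=> K K0; exact: moderate_taper_bound.
- by right.
Qed.

Variables (a : nat -> R) (beta : R).
Hypothesis ha : (a n * n%:R `^ beta) @[n --> \oo] --> (1 : R).

Let growth kappa h : psum a m / m.+1%:R `^ h @[m --> \oo] --> kappa ->
  1 < 2 * beta -> -1 < 2 * h -> 1 - beta <= h -> exists C, filter_growth (psum a) kappa h beta C.
Proof.
move=> hc b2 h2 bh.
have [C1 C10 hC1] := bounded_ratio (fun m => powR_gt0 h (ltr0Sn R m)) hc.
have [C2 C20 hC2] := filter_coef_bound ha.
have b0 : 0 < beta by lra.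
exists (C1 + C2); split => //.
- by rewrite addr_ge0// ltW.
- by move=> m; apply: (le_trans (hC1 m)); rewrite ler_wpM2r ?powR_ge0// lerDl ltW.
- move=> m N; apply: (le_trans (psum_block hC2 b0 m N)).
  by rewrite ler_wpM2r ?powR_ge0// ler_wpM2r// lerDr ltW.
Qed.

Lemma growth_increasing : 1 / 2 < beta < 1 ->
  exists C, filter_growth (psum a) (1 - beta)^-1 (1 - beta) beta C.
Proof.
move=> b; apply: growth; first exact: psum_cvg_increasing.
all: by case/andP: b => *; lra.
Qed.

Lemma growth_constant : 1 < beta -> exists C, filter_growth (psum a) (filter_sum a) 0 beta C.
Proof.
move=> b; apply: growth; try lra.
under eq_fun do rewrite powRr0 divr1.
exact: psum_is_cvg ha b.
Qed.

Lemma growth_decreasing : 1 < beta < 3 / 2 -> filter_sum a = 0 ->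
  exists C, filter_growth (psum a) (1 - beta)^-1 (1 - beta) beta C.
Proof.
move=> b s0; apply: growth; first exact: psum_cvg_decreasing.
all: by case/andP: b => *; lra.
Qed.

Lemma powR_normalize (x gamma h : R) : 0 < x ->
  x `^ (1 + 2 * gamma * h) = x * ((x `^ gamma) `^ h) ^+ 2.
Proof.
move=> x0; rewrite powRD ?(gt_eqF x0) ?implybT// powRr1 ?(ltW x0)//; congr (_ * _).
by rewrite -powR_mulrn ?powR_ge0// -!powRrM; congr powR; ring.
Qed.

Lemma powR_normalize1 (x h : R) : 0 < x -> x `^ (3 - 2 * h) = x * (x `^ (1 - h)) ^+ 2.
Proof.
move=> x0; have := powR_normalize 1 (1 - h) x0; rewrite powRr1 ?(ltW x0)// => <-.
by congr powR; ring.
Qed.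

(** The profile is a pure jump for two different reasons: [rho] is constant under a strong taper,
    and [h = 0] for a filter with nonzero sum. Both lead to Brownian motion. *)
Lemma jump_energy (L : nat -> nat) r rho kappa h C t : (forall x, 0 < x -> rho x `^ h = 1) ->
  taper_regime L r rho -> filter_growth (psum a) kappa h beta C -> 0 < t ->
  energy (limit_step rho kappa h) t = kappa ^+ 2 * t.
Proof.
move=> rho1 tr fg t0; apply: energy_jump => //.
- exact: measurable_Phi tr.
- by move=> x; rewrite /limit_step; case: ifP => // x0; rewrite rho1// mulr1.
- exact: (integrable_increment tr fg (ltW t0)).
Qed.

Lemma weak_energy (L : nat -> nat) r C t : beta != 1 ->
  taper_regime L r idfun -> filter_growth (psum a) (1 - beta)^-1 (1 - beta) beta C -> 0 < t ->
  energy (limit_step idfun (1 - beta)^-1 (1 - beta)) t = t `^ (3 - 2 * beta) * energy (power_step beta) 1 /\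
  (@lebesgue_measure R).-integrable setT (EFin \o (fun y => increment_kernel (power_step beta) 1 y ^+ 2)).
Proof.
move=> b1 tr fg t0; rewrite powR_normalize1//; split; last exact: (integrable_increment tr fg ler01).
apply: (energy_scale (Psi := power_step beta) t0 (measurable_Phi _ _ tr) _).1 => x.
rewrite /limit_step /power_step pmulr_rgt0//; case: ifP => x0; last by rewrite mulr0.
by rewrite powRM ?ltW//= mulrCA.
Qed.

Lemma moderate_energy (L : nat -> nat) r C c t : beta != 1 -> 0 < c ->
  taper_regime L r (fun x => Num.min x c) -> filter_growth (psum a) (1 - beta)^-1 (1 - beta) beta C -> 0 < t ->
  energy (limit_step (fun x => Num.min x c) (1 - beta)^-1 (1 - beta)) t =
    t `^ (3 - 2 * beta) * energy (truncated_power beta (c / t)) 1 /\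
  (@lebesgue_measure R).-integrable setT (EFin \o (fun y => increment_kernel (truncated_power beta (c / t)) 1 y ^+ 2)).
Proof.
move=> b1 c0 tr fg t0; rewrite powR_normalize1//.
have e x : limit_step (fun x => Num.min x c) (1 - beta)^-1 (1 - beta) (t * x) =
    t `^ (1 - beta) * truncated_power beta (c / t) x.
  rewrite /limit_step /truncated_power pmulr_rgt0//; case: ifP => x0; last by rewrite mulr0.
  have -> : Num.min (t * x) c = t * Num.min x (c / t).
    by rewrite minr_pMr ?(ltW t0)// mulrCA divff ?mulr1// gt_eqF.
  by rewrite powRM ?ltW ?lt_min ?x0 ?divr_gt0//= mulrCA.
have [h1 h2] := energy_scale t0 (measurable_Phi _ _ tr) e; split => //.
apply: h2; first exact: (integrable_increment tr fg (ltW t0)).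
by rewrite gt_eqF// powR_gt0.
Qed.

End regimes.

Section weights_of_case.
Context {R : realType}.
Implicit Types (a : nat -> R) (beta c : R) (L : nat -> nat) (V : nat -> R).

(** The interface between the deterministic and the probabilistic parts: the central limit theorem
    draws its information on the case from these three properties. *)
Definition weight_asymptotics (b : nat -> R) L V (cov : R -> R -> R) : Prop :=
  [/\ forall n, (0 < n)%N -> 0 < V n,
      forall m (t u : 'I_m -> R), (forall i, 0 <= t i) ->
        \sum_(k <- comb_support L t n) (\sum_(i < m) u i * block_weight b L V n (t i) k) ^+ 2
          @[n --> \oo] -->
        \sum_(i < m) \sum_(k < m) u i * u k * cov (t k) (t i) &
      forall m (t u : 'I_m -> R) (e : R), (forall i, 0 <= t i) -> 0 < e ->
        exists2 M : R, 0 < M & \forall n \near \oo,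
          \sum_(k <- comb_support L t n |
              M < n%:R * (\sum_(i < m) u i * block_weight b L V n (t i) k) ^+ 2)
            (\sum_(i < m) u i * block_weight b L V n (t i) k) ^+ 2 <= e].

Lemma weight_asymptotics_intro j a beta (gamma1 : R) c L (r : nat -> R) (rho : R -> R) (kappa h C A : R) :
  taper_regime L r rho -> filter_growth (psum a) kappa h beta C -> 0 < A ->
  (forall n, (0 < n)%N -> Asq j a beta gamma1 c n = A * (n%:R * (r n `^ h) ^+ 2)) ->
  (forall t, 0 < t -> energy (limit_step rho kappa h) t = A * W j beta c t) ->
  weight_asymptotics (psum a) L (Asq j a beta gamma1 c) (limit_cov j beta c).
Proof.
move=> tr fg A0 AE eE.
have WE t : 0 <= t -> energy (limit_step rho kappa h) t = A * W j beta c t.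
  rewrite le_eqVlt => /predU1P[<-|]; last exact: eE.
  by rewrite energy0 /W eqxx mulr0.
split.
- move=> n n0; rewrite AE// mulr_gt0// mulr_gt0 ?ltr0n// exprn_gt0// powR_gt0//.
  exact: (regime_gt0 tr n0).
- by move=> m t u t0; exact: (block_weight_sqr_cvg tr fg A0 AE WE (c := u) t0).
- by move=> m t u e t0 e0; exact: (block_weight_unif_integrable tr fg A0 AE u t0 e0).
Qed.

(** Each case pairs a taper regime with a growth of partial sums. The constant [A] is
    [(1 - beta)^(-2)] in cases 1 and 3, the squared sum of the filter in cases 2, 5 and 8, and the
    energy of the kernel at time 1 in the others, where its positivity has to be proved. *)
Theorem case_weights j a beta (gamma1 : R) c : (1 <= j <= 9)%N ->
  (a n * n%:R `^ beta) @[n --> \oo] --> (1 : R) ->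
  filter_case j a beta -> taper_case j gamma1 c ->
  weight_asymptotics (psum a) (fun n => Num.truncn (lambda j gamma1 c n))
    (Asq j a beta gamma1 c) (limit_cov j beta c).
Proof.
move=> hj ha.
have jumpA (S : R) : S != 0 -> 0 < S ^+ 2 by move=> S0; rewrite exprn_even_gt0.
have h0 : 1 / 2 < beta < 1 -> beta != 1 by move=> /andP[_ b]; rewrite lt_eqF.
have h0' : 1 < beta < 3 / 2 -> beta != 1 by move=> /andP[b _]; rewrite gt_eqF.
have kinv : beta != 1 -> (1 - beta)^-1 != 0 by move=> b; rewrite invr_neq0// subr_eq0 eq_sym.
have n0r n : (0 < n)%N -> 0 < n%:R :> R by rewrite ltr0n.
have strongA n : (0 < n)%N -> (1 - beta) ^- 2 * n%:R `^ (1 + 2 * gamma1 * (1 - beta)) =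
    (1 - beta)^-1 ^+ 2 * (n%:R * ((n%:R `^ gamma1) `^ (1 - beta)) ^+ 2).
  by move=> n0; rewrite powR_normalize ?n0r// exprVn.
have weakA A n : (0 < n)%N -> A * n%:R `^ (3 - 2 * beta) = A * (n%:R * (n%:R `^ (1 - beta)) ^+ 2).
  by move=> n0; rewrite powR_normalize1 ?n0r.
have Wt (t : R) (x : R) : 0 < t -> (if t == 0 then 0 else x) = x by move=> t0; rewrite gt_eqF.
have rho1 (x h : R) : 0 < x -> (fun=> 1 : R) x `^ h = 1 by move=> _; rewrite powR1.
have rho0 (rho : R -> R) (x : R) : 0 < x -> rho x `^ 0 = 1 by move=> _; rewrite powRr0.
case: j hj => [|[|[|[|[|[|[|[|[|[|//]]]]]]]]]] //= _.
- move=> b g; have [C fg] := growth_increasing ha b; have tr := strong_regime g.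
  apply: (weight_asymptotics_intro tr fg (jumpA _ (kinv (h0 b)))) => // t t0.
  rewrite /W Wt//; exact: (jump_energy (fun x x0 => rho1 x _ x0) tr fg t0).
- move=> [b S0] g; have [C fg] := growth_constant ha b; have tr := strong_regime g.
  apply: (weight_asymptotics_intro tr fg (jumpA _ S0)) => [n _|t t0]; first by rewrite powRr0 expr1n mulr1 mulrC.
  rewrite /W Wt//; exact: (jump_energy (rho0 _) tr fg t0).
- move=> [b S0] g; have [C fg] := growth_decreasing ha b S0; have tr := strong_regime g.
  apply: (weight_asymptotics_intro tr fg (jumpA _ (kinv (h0' b)))) => // t t0.
  rewrite /W Wt//; exact: (jump_energy (fun x x0 => rho1 x _ x0) tr fg t0).
- move=> b g; have [C fg] := growth_increasing ha b; have tr := weak_regime g.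
  have [_ i1] := weak_energy (h0 b) tr fg ltr01.
  have b32 : beta < 3 / 2 by case/andP: b; lra.
  have e1 := power_step_energy (h0 b) b32 i1.
  have p1 := power_step_energy_gt0 (h0 b) i1; rewrite e1 in p1.
  apply: (weight_asymptotics_intro tr fg p1) => [n n0|t t0]; first exact: weakA.
  by rewrite /W Wt// (weak_energy (h0 b) tr fg t0).1 e1 mulrC.
- move=> [b S0] g; have [C fg] := growth_constant ha b; have tr := weak_regime g.
  apply: (weight_asymptotics_intro tr fg (jumpA _ S0)) => [n _|t t0]; first by rewrite powRr0 expr1n mulr1 mulrC.
  rewrite /W Wt//; exact: (jump_energy (rho0 _) tr fg t0).
- move=> [b S0] g; have [C fg] := growth_decreasing ha b S0; have tr := weak_regime g.
  have [_ i1] := weak_energy (h0' b) tr fg ltr01.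
  have b1 : 1 < beta by case/andP: b.
  have e1 := power_step_energy_tail (h0' b) i1 b1.
  have p1 := power_step_energy_gt0 (h0' b) i1; rewrite e1 in p1.
  apply: (weight_asymptotics_intro tr fg p1) => [n n0|t t0]; first exact: weakA.
  by rewrite /W Wt// (weak_energy (h0' b) tr fg t0).1 e1 mulrC.
- move=> b c0; have [C fg] := growth_increasing ha b; have tr := moderate_regime c0.
  have [_ i1] := moderate_energy (h0 b) c0 tr fg ltr01.
  have b1 : beta < 1 by case/andP: b.
  have p1 := truncated_power_energy_gt0 (h0 b) (divr_gt0 c0 ltr01) i1.
  have e1 := K7_energy (h0 b) c0 ltr01 i1 b1; rewrite e1 in p1.
  apply: (weight_asymptotics_intro tr fg p1) => [n n0|t t0]; first exact: weakA.
  have [e2 i2] := moderate_energy (h0 b) c0 tr fg t0.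
  rewrite /W Wt// e2 (K7_energy (h0 b) c0 t0 i2 b1); field.
  by rewrite gt_eqF.
- move=> [b S0] c0; have [C fg] := growth_constant ha b; have tr := moderate_regime c0.
  apply: (weight_asymptotics_intro tr fg (jumpA _ S0)) => [n _|t t0]; first by rewrite powRr0 expr1n mulr1 mulrC.
  rewrite /W Wt//; exact: (jump_energy (rho0 _) tr fg t0).
- move=> [b S0] c0; have [C fg] := growth_decreasing ha b S0; have tr := moderate_regime c0.
  have [_ i1] := moderate_energy (h0' b) c0 tr fg ltr01.
  have b1 : 1 < beta by case/andP: b.
  have p1 := truncated_power_energy_gt0 (h0' b) (divr_gt0 c0 ltr01) i1.
  have e1 := K9_energy (h0' b) c0 ltr01 i1 b1; rewrite e1 in p1.
  apply: (weight_asymptotics_intro tr fg p1) => [n n0|t t0]; first exact: weakA.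
  have [e2 i2] := moderate_energy (h0' b) c0 tr fg t0.
  rewrite /W Wt// e2 (K9_energy (h0' b) c0 t0 i2 b1); field.
  by rewrite gt_eqF.
Qed.

End weights_of_case.

(** * Central limit theorem *)

Section independent_sums.
Context {R : realType} d (T : measurableType d) (P : probability T R) (X : int -> {RV P >-> R}).
Variables (s2 K : R).
Hypothesis indX : mutually_independent X.
Hypothesis X2 : forall k, P.-integrable setT (EFin \o (fun w => X k w ^+ 2)).
Hypothesis X3 : forall k, P.-integrable setT (EFin \o (fun w => `|X k w| ^+ 3)).
Hypothesis X0 : forall k, \int[P]_w X k w = 0.
Hypothesis Xs2 : forall k, \int[P]_w (X k w ^+ 2) = s2.
Hypothesis s20 : 0 < s2.
Hypothesis X3K : forall k, \int[P]_w (`|X k w| ^+ 3) <= K * Num.sqrt s2 ^+ 3.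
Hypothesis K0 : 0 <= K.

Let sq0 : 0 < Num.sqrt s2. Proof. by rewrite sqrtr_gt0. Qed.

Variable w : int -> R.

Let u k := w k / Num.sqrt s2.

Let u2 k : u k ^+ 2 * s2 = w k ^+ 2.
Proof. by rewrite /u expr_div_n sqr_sqrtr ?(ltW s20)// divfK// gt_eqF. Qed.

Let r k := expR (- (w k ^+ 2 / 2)).

Let r01 k : 0 <= r k <= 1.
Proof. by rewrite expR_ge0/= expR_le1 oppr_le0 divr_ge0// sqr_ge0. Qed.

Let prod_r (s : seq int) : \prod_(k <- s) r k = expR (- ((\sum_(k <- s) w k ^+ 2) / 2)).
Proof.
elim: s => [|k s IH]; first by rewrite !big_nil mul0r oppr0 expR0.
by rewrite !big_cons IH /r -expRD mulrDl opprD.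
Qed.

Let bound_sqr k : `|\int[P]_v cos (u k * X k v) - r k| + `|\int[P]_v sin (u k * X k v)| <= 3 * w k ^+ 2.
Proof.
by have := cf_bound_sqr (measurable_funPT (X k)) (X2 k) (u k) (X0 k); rewrite Xs2 u2.
Qed.

(** The version for tail bounds: it is homogeneous in the weights, hence uniform over all multiples
    [del] of a given family. *)
Lemma independent_sum_cos_sqr (s : seq int) phi : uniq s ->
  `|\int[P]_v cos (\sum_(k <- s) u k * X k v + phi) - cos phi * expR (- ((\sum_(k <- s) w k ^+ 2) / 2))|
  <= 3 * \sum_(k <- s) w k ^+ 2.
Proof.
move=> us; rewrite -prod_r mulr_sumr.
exact: (independent_cos_bound indX r01 bound_sqr phi us).
Qed.

(** Weights with [N w^2 > M] are charged [3 w^2] each. For the others [|w| <= sqrt (M / N)], so the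
    cubic error is at most [w^2] times [2 K sqrt (M / N)] and the quartic one at most [w^2] times
    [M / N]. *)
Lemma independent_sum_cos (s : seq int) phi (M N : R) : uniq s -> 0 < M -> 0 < N ->
  `|\int[P]_v cos (\sum_(k <- s) u k * X k v + phi) - cos phi * expR (- ((\sum_(k <- s) w k ^+ 2) / 2))|
  <= 3 * \sum_(k <- s | M < N * w k ^+ 2) w k ^+ 2 +
     (\sum_(k <- s) w k ^+ 2) * (2 * K * Num.sqrt (M / N) + M / N).
Proof.
move=> us M0 N0; set q := 2 * K * _ + _.
have MN : 0 <= M / N by rewrite divr_ge0// ltW.
have q0 : 0 <= q by rewrite addr_ge0// mulr_ge0 ?sqrtr_ge0// mulr_ge0.
pose delta k := (if M < N * w k ^+ 2 then 3 * w k ^+ 2 else 0) + w k ^+ 2 * q.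
have hd k : `|\int[P]_v cos (u k * X k v) - r k| + `|\int[P]_v sin (u k * X k v)| <= delta k.
  rewrite /delta; case: ltP => big.
    by apply: (le_trans (bound_sqr k)); rewrite lerDl mulr_ge0 ?sqr_ge0.
  rewrite add0r.
  have := cf_bound_cube (measurable_funPT (X k)) (X2 k) (u k) (X0 k) (X3 k) (X3K k).
  rewrite Xs2 u2 => h; apply: (le_trans h).
  have wMN : w k ^+ 2 <= M / N by rewrite ler_pdivlMr// mulrC.
  have wsq : `|w k| <= Num.sqrt (M / N).
    by rewrite -sqrtr_sqr ler_sqrt.
  have -> : 2 * `|u k| ^+ 3 * (K * Num.sqrt s2 ^+ 3) = w k ^+ 2 * (2 * K * `|w k|).
    rewrite /u normrM normfV (gtr0_norm sq0) -[w k ^+ 2]real_normK ?num_real//; field.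
    by rewrite gt_eqF.
  rewrite /q mulrDr [X in _ + X <= _]expr2; apply: lerD; rewrite ler_wpM2l ?sqr_ge0//.
  by rewrite ler_wpM2l// mulr_ge0.
rewrite -prod_r; apply: (le_trans (independent_cos_bound indX r01 hd phi us)).
by rewrite /delta big_split/= -big_mkcond -mulr_sumr mulr_suml.
Qed.

End independent_sums.

Section gaussian_limit_side.
Context {R : realType} d (T : measurableType d) (Q : probability T R).
Variables (G : R -> R -> R) (U : R -> {RV Q >-> R}).
Hypothesis hU : centered_gaussian_process G U.
Hypothesis G0 : forall s, 0 <= s -> G s 0 = 0 /\ G 0 s = 0.

Let U0 : {ae Q, forall w, U 0 w = 0}. Proof. by have [] := hU. Qed.

Let mU2 s t : measurable_fun setT (fun w => U t w * U s w).
Proof. exact: measurable_funM. Qed.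

Let E_pos s t : 0 < s -> 0 < t -> (\int[Q]_w (U t w * U s w)%:E = (G s t)%:E)%E.
Proof. by move=> s0 t0; have [_ _ _ /(_ s t s0 t0)] := hU; rewrite unlock. Qed.

(** For [t > 0] the square is nonnegative and its expectation is prescribed as a real number, hence
    finite; at time 0 the process vanishes almost everywhere. *)
Lemma gaussian_process_sqr_integrable t : 0 <= t -> Q.-integrable setT (EFin \o (fun w => U t w ^+ 2)).
Proof.
rewrite le_eqVlt => /predU1P[<-|t0].
  apply: (ae_le_integrable (g := fun=> 0)).
  - exact: (measurable_funX 2 (measurable_funPT (U 0))).
  - exact: bmeas_integrable (bmeas_cst _ _).
  - by apply: filterS U0 => w ->; rewrite expr0n normr0.
apply/integrableP; split; first by apply/measurable_EFinP; exact: (measurable_funX 2 (measurable_funPT (U t))).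
under eq_integral do rewrite /= ger0_norm ?sqr_ge0// expr2.
by rewrite E_pos// ltry.
Qed.

Let iUU s t : 0 <= s -> 0 <= t -> Q.-integrable setT (EFin \o (fun w => U t w * U s w)).
Proof.
move=> s0 t0; have := integrableD_EFin measurableT (gaussian_process_sqr_integrable s0) (gaussian_process_sqr_integrable t0).
apply: le_integrable => //; first exact/measurable_EFinP.
move=> w _; rewrite lee_fin (le_trans _ (ler_norm _))// normrM.
rewrite -[U s w ^+ 2]real_normK ?num_real// -[U t w ^+ 2]real_normK ?num_real//.
have := sqr_ge0 (`|U t w| - `|U s w|); have := mulr_ge0 (normr_ge0 (U t w)) (normr_ge0 (U s w)).
rewrite sqrrB !mulr2n; lra.
Qed.

Let Rae0 (f : T -> R) : measurable_fun setT f -> {ae Q, forall w, f w = 0} -> \int[Q]_w f w = 0.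
Proof.
move=> mf f0; have if0 : Q.-integrable setT (EFin \o f).
  apply: (ae_le_integrable (g := fun=> 0)) => //; first exact: bmeas_integrable (bmeas_cst _ _).
  by apply: filterS f0 => w ->; rewrite normr0.
have i0 : Q.-integrable setT (EFin \o (fun=> 0 : R)) by exact: bmeas_integrable (bmeas_cst _ _).
have e := Rintegral_prob_cst Q 0; apply/le_anti/andP; split.
- by rewrite -[leRHS]e; apply: ae_le_Rintegral => //; apply: filterS f0 => w ->.
- by rewrite -[leLHS]e; apply: ae_le_Rintegral => //; apply: filterS f0 => w ->.
Qed.

(** The covariance is prescribed at positive times only; [G0] makes the formula persist at time
    0. *)
Lemma gaussian_process_covariance s t : 0 <= s -> 0 <= t -> \int[Q]_w (U t w * U s w) = G s t.
Proof.
rewrite le_eqVlt => /predU1P[<- t0|s0].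
  rewrite (G0 t0).2; apply: Rae0 => //.
  by apply: filterS U0 => w ->; rewrite mulr0.
rewrite le_eqVlt => /predU1P[<-|t0]; last by rewrite /Rintegral E_pos.
rewrite (G0 (ltW s0)).1; apply: Rae0 => //.
by apply: filterS U0 => w ->; rewrite mul0r.
Qed.

Variables (m : nat) (t : 'I_m -> R).
Hypothesis t0 : forall i, 0 <= t i.

Lemma gaussian_process_cos (u : 'I_m -> R) phi :
  \int[Q]_w cos (\sum_(i < m) u i * U (t i) w + phi) =
  cos phi * expR (- ((\sum_(i < m) \sum_(k < m) u i * u k * G (t k) (t i)) / 2)).
Proof.
have [gU meanU _ _] := hU.
have iU i : Q.-integrable setT (EFin \o U (t i)).
  exact: (integrable_sqr_id (measurable_funPT (U (t i))) (gaussian_process_sqr_integrable (t0 i))).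
have iuU i : Q.-integrable setT (EFin \o (fun w => u i * U (t i) w)) by exact: integrableZl_EFin.
have sqE w : (\sum_(i < m) u i * U (t i) w) ^+ 2 =
    \sum_(i < m) \sum_(k < m) u i * u k * (U (t i) w * U (t k) w).
  rewrite expr2 mulr_suml; apply: eq_bigr => i _; rewrite mulr_sumr; apply: eq_bigr => k _.
  by ring.
have iik i k : Q.-integrable setT (EFin \o (fun w => u i * u k * (U (t i) w * U (t k) w))).
  by apply: integrableZl_EFin => //; exact: iUU.
have hs i := Rintegral_sum (index_enum 'I_m) measurableT (iik i).
have [h1 h2] := Rintegral_sum (index_enum 'I_m) measurableT (fun i => (hs i).1).
apply: gaussian_centered_cosE.
- by apply: measurable_sum => i; exact: measurable_funM.
- exact: gU.
- by move: h1; apply: eq_integrable => // w _; rewrite /= sqE.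
- have [_ ->] := Rintegral_sum (index_enum 'I_m) measurableT iuU.
  apply: big1 => i _; rewrite (RintegralZl _ measurableT (iU i)).
  by have := meanU (t i) (t0 i); rewrite unlock /Rintegral => ->; rewrite mulr0.
- under eq_Rintegral do rewrite sqE.
  rewrite h2; apply: eq_bigr => i _; rewrite (hs i).2; apply: eq_bigr => k _.
  by rewrite (RintegralZl _ measurableT (iUU (t0 k) (t0 i))) gaussian_process_covariance.
Qed.

Lemma gaussian_process_cos_tail i : cos_tail Q (G (t i) (t i)) (U (t i)).
Proof.
move=> del; have mUi := measurable_funPT (U (t i)).
have h := Rintegral_cos_le mUi (gaussian_process_sqr_integrable (t0 i)) del.
have bc : bmeas (fun w => cos (del * U (t i) w)).
  by have := bmeas_comp (bmeas_cosD del 0) mUi; under eq_fun do rewrite addr0.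
rewrite RintegralB//; [|exact: bmeas_integrable (bmeas_cst _ _)|exact: bmeas_integrable].
rewrite (Rintegral_prob_cst Q 1); move: h; rewrite distrC => h; apply: (le_trans (ler_norm _)).
apply: (le_trans h); rewrite mulrC -gaussian_process_covariance//.
Qed.

End gaussian_limit_side.

Section linear_process_sums.
Context {R : realType} d (T : measurableType d) (P : probability T R).
Variables (a : nat -> R) (l A s2 : R) (X : int -> {RV P >-> R}).
Hypothesis l0 : 0 <= l.
Hypothesis s2E : fine 'E_P[fun v => (X 1 v ^+ 2)%R]%E = s2.
Local Notation L := (Num.truncn l).

Lemma Z_block n t N0 v : (Num.truncn (n%:R * t) <= N0)%N ->
  Z P a l A X n t v = \sum_(k <- taper_support N0 L)
    tapered_block (psum a) L (Num.truncn (n%:R * t)) k / A / Num.sqrt s2 * X k v.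
Proof.
move=> tN; rewrite /Z s2E (sum_linear_process a X v l0 tN) mulr_sumr.
by apply: eq_bigr => k _; rewrite invfM; ring.
Qed.

Lemma measurable_Z n t : measurable_fun setT (Z P a l A X n t).
Proof.
have -> : Z P a l A X n t = fun v => \sum_(k <- taper_support (Num.truncn (n%:R * t)) L)
    tapered_block (psum a) L (Num.truncn (n%:R * t)) k / A / Num.sqrt s2 * X k v.
  by apply/funext => v; exact: Z_block.
by apply: measurable_sum => k; exact: measurable_funM.
Qed.

End linear_process_sums.

Lemma lambda_ge0 {R : realType} j (gamma1 c : R) n : (1 <= j <= 9)%N -> taper_case j gamma1 c ->
  0 <= lambda j gamma1 c n.
Proof.
rewrite /lambda => hj htaper; case: ifPn => j6; first exact: powR_ge0.
suff c0 : 0 < c by rewrite mulr_ge0// ltW.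
move: hj htaper j6; rewrite /taper_case.
by case: j => [|[|[|[|[|[|[|[|[|[|//]]]]]]]]]].
Qed.

(** * Central limit theorem for the sums of the tapered linear process *)

Section main.
Context {R : realType}.
Variables (j : nat) (alpha gamma : R) (a : nat -> R) (beta gamma1 c : R).
Hypotheses (hj : (1 <= j <= 9)%N) (halpha : 0 < alpha < 2) (hgamma : 0 < gamma < alpha^-1).
Hypothesis ha : (a n * n%:R `^ beta) @[n --> \oo] --> (1 : R).
Hypotheses (hfilter : filter_case j a beta) (htaper : taper_case j gamma1 c).
Context (d0 : measure_display) (T0 : measurableType d0) (P0 : probability T0 R).
Variables (theta E : {RV P0 >-> R}).
Hypotheses (htheta : standard_pareto alpha theta) (hE : standard_exponential E)
  (hind : independent2 theta E).
Context (d : nat -> measure_display) (T : forall n, measurableType (d n))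
  (P : forall n, probability (T n) R) (xi : forall n, int -> {RV (P n) >-> R}).
Hypothesis hxi : forall n, (2 <= n)%N ->
  iid_copies (xi n) P0 (tapered_pareto P0 theta E (n%:R `^ gamma)).

Local Notation lam := (lambda j gamma1 c).
Local Notation L := (fun n => Num.truncn (lam n)).
Local Notation V := (Asq j a beta gamma1 c).
Local Notation cov := (limit_cov j beta c).
Local Notation ZZ n := (Z (P n) a (lam n) (Num.sqrt (V n)) (xi n) n).

Let weights := case_weights hj ha hfilter htaper.

Let lam_ge0 n : 0 <= lam n. Proof. exact: lambda_ge0. Qed.

Let s2 n := \int[P n]_v (xi n 1 v ^+ 2).

Let s2E n : fine 'E_(P n)[fun v => (xi n 1 v ^+ 2)%R]%E = s2 n.
Proof. by rewrite unlock. Qed.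

Let alpha0 : 0 < alpha. Proof. by case/andP: halpha. Qed.
Let gamma0 : 0 < gamma. Proof. by case/andP: hgamma. Qed.

Let ga1 : gamma * alpha < 1.
Proof. by have := alpha0; case/andP: hgamma => _ h a0; rewrite -ltr_pdivlMr// mul1r. Qed.

Lemma innovation_moments : exists2 K : R, 0 <= K & \forall n \near \oo,
  0 < s2 n /\ forall k,
  [/\ (P n).-integrable setT (EFin \o (fun w => xi n k w ^+ 2)),
      (P n).-integrable setT (EFin \o (fun w => `|xi n k w| ^+ 3)),
      \int[P n]_w xi n k w = 0,
      \int[P n]_w (xi n k w ^+ 2) = s2 n &
      \int[P n]_w (`|xi n k w| ^+ 3) <= K * n%:R `^ (gamma * alpha / 2) * Num.sqrt (s2 n) ^+ 3].
Proof.
have [C [b0 [C0 hC]]] := tapered_pareto_moments alpha0 htheta hE hind.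
exists C; first exact: ltW.
near=> n; have n2 : (2 <= n)%N by near: n; exists 2%N.
have nb : b0 <= n%:R `^ gamma by near: n; move/cvgryPge: (cvg_powR_nat_pinfty gamma0); exact.
have [i2 i3 m1 m2 m3] := hC _ nb.
have [_ law] := hxi n2.
set Y := tapered_pareto P0 theta E (n%:R `^ gamma) in i2 i3 m1 m2 m3 law.
have mY : measurable_fun setT Y by exact: measurable_tapered_pareto.
have lawk k A : measurable A -> P n (xi n k @^-1` A) = P0 (Y @^-1` A) by exact: law.
have msq : measurable_fun setT (fun x : R => x ^+ 2) by exact: exprn_measurable.
have mcb : measurable_fun setT (fun x : R => `|x| ^+ 3).
  by apply: (measurable_funX 3); exact: normr_measurable.
have mxi k := measurable_funPT (xi n k).
have i1 := integrable_sqr_id mY i2.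
have e2 k : \int[P n]_w (xi n k w ^+ 2) = \int[P0]_w Y w ^+ 2.
  exact: (same_law_Rintegral (mxi k) mY (lawk k) msq i2).
split; first by rewrite /s2 e2.
move=> k; split.
- exact: (same_law_integrable (mxi k) mY (lawk k) msq i2).
- exact: (same_law_integrable (mxi k) mY (lawk k) mcb i3).
- by rewrite (same_law_Rintegral (mxi k) mY (lawk k) (@measurable_id _ _ setT) i1).
- by rewrite /s2 !e2.
- rewrite (same_law_Rintegral (mxi k) mY (lawk k) mcb i3) /s2 e2.
  have -> : n%:R `^ (gamma * alpha / 2) = (n%:R `^ gamma) `^ (alpha / 2) :> R by rewrite -powRrM mulrA.
  exact: m3.
Unshelve. all: by end_near. Qed.

Let Z_comb n m (t u : 'I_m -> R) v :
  \sum_(i < m) u i * ZZ n (t i) v = \sum_(k <- comb_support L t n)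
    (\sum_(i < m) u i * block_weight (psum a) L V n (t i) k) / Num.sqrt (s2 n) * xi n k v.
Proof.
under eq_bigr => i _ do rewrite (Z_block a (Num.sqrt (V n)) (lam_ge0 n) (s2E n) v (trunc_le_comb t n i)) mulr_sumr.
rewrite exchange_big/=; apply: eq_bigr => k _; rewrite !mulr_suml; apply: eq_bigr => i _.
by rewrite /block_weight; ring.
Qed.

Let uS m (t : 'I_m -> R) n : uniq (comb_support L t n).
Proof. exact: uniq_taper_support. Qed.

Lemma sum_characteristic_function m (t u : 'I_m -> R) phi : (forall i, 0 <= t i) ->
  \int[P n]_v cos (\sum_(i < m) u i * ZZ n (t i) v + phi) @[n --> \oo] -->
  cos phi * expR (- ((\sum_(i < m) \sum_(k < m) u i * u k * cov (t k) (t i)) / 2)).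
Proof.
move=> t0; have [_ hV hUI] := weights; have {}hV := hV m t u t0; have {}hUI := hUI m t u.
have [K K0 hm] := innovation_moments.
set W2 := (X in expR (- (X / 2))).
pose w n k := \sum_(i < m) u i * block_weight (psum a) L V n (t i) k.
have hexp : cos phi * expR (- ((\sum_(k <- comb_support L t n) w n k ^+ 2) / 2)) @[n --> \oo] -->
    cos phi * expR (- (W2 / 2)).
  apply: cvgM; first exact: cvg_cst.
  apply: (@cvg_comp _ _ _ _ (@expR R) _ (nbhs (- (W2 / 2)))); last exact: continuous_expR.
  by apply: cvgN; apply: cvgM => //; exact: cvg_cst.
(* The large weights are charged with the factor 3, whence [e / 12]. They cost [e / 4], the small
   weights [e / 4], and the convergence of the variance [e / 2]. *)
apply/cvgrPdist_le => e e0; have e12 : 0 < e / 12 by rewrite divr_gt0.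
have [M M0 hM] := hUI _ t0 e12.
have V10 : 0 < `|W2| + 1 by rewrite ltr_wpDl.
have hq : (`|W2| + 1) * (2 * (K * n%:R `^ (gamma * alpha / 2)) * Num.sqrt (M / n%:R) + M / n%:R) @[n --> \oo] --> (0 : R).
  rewrite -[X in _ --> X](mulr0 (`|W2| + 1)); apply: cvgM; first exact: cvg_cst.
  rewrite -[X in _ --> X]addr0; apply: cvgD; last first.
    rewrite -[X in _ --> X](mulr0 M); apply: cvgM; first exact: cvg_cst.
    by rewrite -(cvg_shiftS (fun n => n%:R^-1 : R)); exact: cvg_harmonic.
  (* Third moments grow with exponent [gamma alpha / 2], and the square root of [M / n] supplies
     [- 1 / 2]. Hard tapering makes the total exponent negative. *)
  pose p := gamma * alpha / 2 - 2^-1.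
  have hp : (n%:R : R) `^ p @[n --> \oo] --> (0 : R).
    rewrite -(cvg_shiftS (fun n => (n%:R : R) `^ p)); apply: cvg_powR_0.
    by have := ga1; rewrite /p; lra.
  have h1 : 2 * K * Num.sqrt M * n%:R `^ p @[n --> \oo] --> (0 : R).
    by rewrite -[X in _ --> X](mulr0 (2 * K * Num.sqrt M)); apply: cvgM => //; exact: cvg_cst.
  apply: cvg_trans h1; apply: near_eq_cvg; near=> n.
  have n0 : 0 < n%:R :> R by rewrite ltr0n; near: n; exists 1%N.
  rewrite sqrtrM ?(ltW M0)// sqrtrV ?(ltW n0)// -[Num.sqrt n%:R]powR12_sqrt ?(ltW n0)//.
  rewrite /p powRB ?(gt_eqF n0) ?implybT//; field.
  by rewrite gt_eqF// powR_gt0.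
have e4 : 0 < e / 4 by rewrite divr_gt0.
have e2 : 0 < e / 2 by rewrite divr_gt0.
move/cvgrPdist_le/(_ _ e2) : hexp => hexp; move/cvgrPdist_le/(_ _ e4) : hq => hq.
move/cvgrPdist_le/(_ _ ltr01) : hV => hV.
near=> n.
have n2 : (2 <= n)%N by near: n; exists 2%N.
have n0 : 0 < n%:R :> R by rewrite ltr0n (leq_trans _ n2).
have [sp hk] : 0 < s2 n /\ forall k,
  [/\ (P n).-integrable setT (EFin \o (fun w => xi n k w ^+ 2)),
      (P n).-integrable setT (EFin \o (fun w => `|xi n k w| ^+ 3)),
      \int[P n]_w xi n k w = 0,
      \int[P n]_w (xi n k w ^+ 2) = s2 n &
      \int[P n]_w (`|xi n k w| ^+ 3) <= K * n%:R `^ (gamma * alpha / 2) * Num.sqrt (s2 n) ^+ 3].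
  by near: n.
have [indX _] := hxi n2.
have KK : 0 <= K * n%:R `^ (gamma * alpha / 2) by rewrite mulr_ge0// powR_ge0.
have B := @independent_sum_cos _ _ _ (P n) (xi n) (s2 n) (K * n%:R `^ (gamma * alpha / 2)) indX
  (fun k => let: And5 h _ _ _ _ := hk k in h) (fun k => let: And5 _ h _ _ _ := hk k in h)
  (fun k => let: And5 _ _ h _ _ := hk k in h) (fun k => let: And5 _ _ _ h _ := hk k in h) sp
  (fun k => let: And5 _ _ _ _ h := hk k in h) KK (w n) (comb_support L t n) phi M n%:R (uS t n) M0 n0.
under eq_Rintegral do rewrite Z_comb//.
have h1 : `|cos phi * expR (- (W2 / 2)) -
   cos phi * expR (- ((\sum_(k <- comb_support L t n) w n k ^+ 2) / 2))| <= e / 2 by near: n.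
have h2 : \sum_(k <- comb_support L t n | M < n%:R * w n k ^+ 2) w n k ^+ 2 <= e / 12 by near: n.
have h3 : `|0 - (`|W2| + 1) * (2 * (K * n%:R `^ (gamma * alpha / 2)) * Num.sqrt (M / n%:R) + M / n%:R)| <= e / 4.
  by near: n.
have h4 : `|W2 - \sum_(k <- comb_support L t n) w n k ^+ 2| <= 1 by near: n.
set q := 2 * _ * Num.sqrt _ + _ in h3 B.
have q0 : 0 <= q.
  by rewrite addr_ge0 ?divr_ge0 ?(ltW M0) ?(ltW n0)// mulr_ge0 ?sqrtr_ge0// mulr_ge0.
rewrite sub0r normrN ger0_norm in h3; last by rewrite mulr_ge0// ltW.
have h5 : (\sum_(k <- comb_support L t n) w n k ^+ 2) * q <= (`|W2| + 1) * q.
  rewrite ler_wpM2r//; move: h4; rewrite ler_norml => /andP[h4 _].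
  by have := ler_norm W2; lra.
rewrite distrC; apply: (le_trans (ler_distD (cos phi * expR (- ((\sum_(k <- comb_support L t n) w n k ^+ 2) / 2))) _ _)).
rewrite distrC in h1.
have {}B := le_trans B (lerD (ler_wpM2l (ler0n R 3) h2) (le_trans h5 h3)).
apply: (le_trans (lerD B h1)); lra.
Unshelve. all: by end_near. Qed.

(** The first order comparison with the Gaussian factor is proportional to the sum of the squared
    weights, which converges; this gives a quadratic bound valid for every [del]. *)
Lemma sum_cos_tail (t0 : R) : 0 <= t0 -> exists C : R,
  \forall n \near \oo, cos_tail (P n) C (ZZ n t0).
Proof.
move=> t00; have [_ hV _] := weights.
pose t (_ : 'I_1) := t0; pose u (_ : 'I_1) := (1 : R).
have {}hV := hV 1%N t u (fun=> t00).
have [K K0 hm] := innovation_moments.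
set W2 := (X in _ --> X) in hV.
(* Three parts come from the comparison bound, and the fourth covers [1 - expR (- x / 2) <= x]; the
   limit plus 1 bounds the sum of squares eventually. *)
exists (4 * (`|W2| + 1)).
pose w0 n k := \sum_(i < 1) u i * block_weight (psum a) L V n (t i) k.
move/cvgrPdist_le/(_ _ ltr01) : hV => hV.
(* The rank is fixed before [del]: the threshold must be uniform in [del]. *)
near=> n => del.
have n2 : (2 <= n)%N by near: n; exists 2%N.
have [sp hk] : 0 < s2 n /\ forall k,
  [/\ (P n).-integrable setT (EFin \o (fun w => xi n k w ^+ 2)),
      (P n).-integrable setT (EFin \o (fun w => `|xi n k w| ^+ 3)),
      \int[P n]_w xi n k w = 0,
      \int[P n]_w (xi n k w ^+ 2) = s2 n &
      \int[P n]_w (`|xi n k w| ^+ 3) <= K * n%:R `^ (gamma * alpha / 2) * Num.sqrt (s2 n) ^+ 3].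
  by near: n.
have [indX _] := hxi n2.
have h4 : `|W2 - \sum_(k <- comb_support L t n) w0 n k ^+ 2| <= 1 by near: n.
set w := w0 n in h4.
have B := @independent_sum_cos_sqr _ _ _ (P n) (xi n) (s2 n) indX
  (fun k => let: And5 h _ _ _ _ := hk k in h)
  (fun k => let: And5 _ _ h _ _ := hk k in h) (fun k => let: And5 _ _ _ h _ := hk k in h) sp
  (fun k => del * w k) (comb_support L t n) 0 (uS t n).
have mZ : measurable_fun setT (ZZ n t0) by exact: (measurable_Z _ _ (lam_ge0 n) (s2E n)).
have bc : bmeas (fun v => cos (del * ZZ n t0 v)).
  by have := bmeas_comp (bmeas_cosD del 0) mZ; under eq_fun do rewrite addr0.
rewrite RintegralB//; [|exact: bmeas_integrable (bmeas_cst _ _)|exact: bmeas_integrable].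
rewrite (Rintegral_prob_cst (P n) 1).
have eZ : \int[P n]_v cos (del * ZZ n t0 v) =
    \int[P n]_v cos (\sum_(k <- comb_support L t n) del * w k / Num.sqrt (s2 n) * xi n k v + 0).
  apply: eq_Rintegral => v _; congr cos; rewrite addr0.
  have := @Z_comb n 1%N t u v; rewrite big_ord1 mul1r => ->.
  by rewrite mulr_sumr; apply: eq_bigr => k _; rewrite /w /w0 !mulrA.
rewrite eZ; set I := Rintegral _ _ _ in B *.
have wE : \sum_(k <- comb_support L t n) (del * w k) ^+ 2 = del ^+ 2 * \sum_(k <- comb_support L t n) w k ^+ 2.
  by rewrite mulr_sumr; apply: eq_bigr => k _; rewrite exprMn.
rewrite wE cos0 mul1r in B.
set S := \sum_(k <- _) w k ^+ 2 in h4 B.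
have S0 : 0 <= S by apply: sumr_ge0 => k _; exact: sqr_ge0.
have dS : 0 <= del ^+ 2 * S by rewrite mulr_ge0 ?sqr_ge0.
have : 0 <= del ^+ 2 * S / 2 by rewrite divr_ge0.
move=> /expRN_bound1; rewrite ler_norml => /andP[eb _].
move: B; rewrite ler_norml => /andP[B _].
have SW : S <= `|W2| + 1.
  by move: h4; rewrite ler_norml => /andP[h4 _]; have := ler_norm W2; lra.
have : del ^+ 2 * S <= del ^+ 2 * (`|W2| + 1) by rewrite ler_wpM2l ?sqr_ge0.
rewrite (mulrC (4 * _)) mulrCA; lra.
Unshelve. all: by end_near. Qed.

Lemma limit_cov0 s : 0 <= s -> cov s 0 = 0 /\ cov 0 s = 0.
Proof.
move=> s0; rewrite /limit_cov sub0r subr0 normrN ger0_norm//.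
have W0 : W j beta c 0 = 0 by rewrite /W eqxx.
by rewrite W0; split; ring.
Qed.

(** The quadratic form is a limit of sums of squared weights. *)
Lemma limit_cov_positive_semidefinite : positive_semidefinite cov.
Proof.
move=> m t u t0; have [_ hV _] := weights; have {}hV := hV m t u (fun i => ltW (t0 i)).
rewrite exchange_big/=.
have -> : \sum_(i < m) \sum_(k < m) u k * u i * cov (t k) (t i) =
    \sum_(i < m) \sum_(k < m) u i * u k * cov (t k) (t i).
  by apply: eq_bigr => i _; apply: eq_bigr => k _; rewrite (mulrC (u k)).
apply: (ler_cvg_to (cvg_cst 0) hV); apply: nearW => n.
by apply: sumr_ge0 => k _; exact: sqr_ge0.
Qed.

End main.

Unset Implicit Arguments.

Theorem theorem7 (R : realType) (j : nat) (hj : (1 <= j <= 9)%N)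
  (alpha gamma : R) (halpha : 0 < alpha < 2) (hgamma : 0 < gamma < alpha^-1)
  (* the filter and its taper *)
  (a : nat -> R) (beta gamma1 c : R)
  (ha : (a n * n%:R `^ beta) @[n --> \oo] --> (1 : R))
  (hfilter : filter_case j a beta) (htaper : taper_case j gamma1 c)
  (* a model of the Pareto and exponential variables *)
  (d0 : measure_display) (T0 : measurableType d0) (P0 : probability T0 R)
  (theta E : {RV P0 >-> R})
  (htheta : standard_pareto alpha theta) (hE : standard_exponential E)
  (hind : independent2 theta E)
  (* the innovations, on a possibly different probability space for each n *)
  (d : nat -> measure_display) (T : forall n, measurableType (d n))
  (P : forall n, probability (T n) R)
  (xi : forall n, int -> {RV (P n) >-> R})
  (hxi : forall n, (2 <= n)%N ->
    iid_copies (xi n) P0 (tapered_pareto P0 theta E (n%:R `^ gamma))) :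
  positive_semidefinite (limit_cov j beta c) /\
  forall (d' : measure_display) (T' : measurableType d')
    (Q : probability T' R) (U : R -> {RV Q >-> R}),
    centered_gaussian_process (limit_cov j beta c) U ->
    fdd_cvg P
      (fun n => Z (P n) a (lambda j gamma1 c n)
                  (Num.sqrt (Asq j a beta gamma1 c n)) (xi n) n)
      Q U.
Proof.
split; first exact: (limit_cov_positive_semidefinite hj ha hfilter htaper).
move=> d' T' Q U hU m t t0 f cf bf.
have [C hC] := choice (fun i => sum_cos_tail hj halpha hgamma ha hfilter htaper htheta hE hind hxi (t0 i)).
pose CU i := limit_cov j beta c (t i) (t i).
(* A single tail constant, above those of all coordinates of the sums and of the limit. *)
pose D := \sum_(i < m) (`|C i| + `|CU i|).
have le_tail d1 (T1 : measurableType d1) (P1 : probability T1 R) (X : T1 -> R) (x y : R) :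
    x <= y -> cos_tail P1 x X -> cos_tail P1 y X.
  by move=> xy hx del; apply: (le_trans (hx del)); rewrite ler_wpM2r ?sqr_ge0.
have CD i : C i <= D.
  rewrite /D (bigD1 i)//=; have := ler_norm (C i); have := normr_ge0 (CU i).
  have : 0 <= \sum_(k < m | k != i) (`|C k| + `|CU k|) by apply: sumr_ge0 => k _; rewrite addr_ge0.
  lra.
have UD i : CU i <= D.
  rewrite /D (bigD1 i)//=; have := ler_norm (CU i); have := normr_ge0 (C i).
  have : 0 <= \sum_(k < m | k != i) (`|C k| + `|CU k|) by apply: sumr_ge0 => k _; rewrite addr_ge0.
  lra.
have G0 s : 0 <= s -> limit_cov j beta c s 0 = 0 /\ limit_cov j beta c 0 s = 0 by exact: limit_cov0.
apply: (@fdd_transfer R m d' T' Q (fun i => U (t i)) d T P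
  (fun n i => Z (P n) a (lambda j gamma1 c n) (Num.sqrt (Asq j a beta gamma1 c n)) (xi n) n (t i)) D).
- move=> n i; apply: measurable_Z => //.
  exact: lambda_ge0.
- by move=> i; exact: measurable_funPT.
- move=> u phi; rewrite (gaussian_process_cos hU G0 t0).
  exact: (sum_characteristic_function hj halpha hgamma ha hfilter htaper htheta hE hind hxi).
- have : \forall n \near \oo, forall i, cos_tail (P n) (C i)
    (Z (P n) a (lambda j gamma1 c n) (Num.sqrt (Asq j a beta gamma1 c n)) (xi n) n (t i)).
    exact: filter_forall.
  by apply: filterS => n h i; apply: le_tail (CD i) (h i).
- by move=> i; apply: le_tail (UD i) _; exact: gaussian_process_cos_tail.
- exact: cf.
- exact: bf.
Qed.
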